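(* Let $F$ be a fixed graph containing a cycle, and assume that there exists a real number $\alpha$ such that $\mathrm{ex}(n,F)=\Theta(n^{\alpha})$ as $n\to\infty$. Then for any orientation $H$ of $F$, $$D(n,H)=2^{\Theta(n^{\alpha})}\quad\text{as } n\to\infty.$$
   Context: Graphs are finite, with no loops or multiple edges. An oriented graph has no loops, multiple edges or bidirected edges. An orientation of an undirected graph $G$ assigns to each edge exactly one of its two directions. It is $H$-free if it contains no (not necessarily induced) subgraph isomorphic to $H$ as an oriented graph. $D(n,H)$ denotes the maximum, over all $n$-vertex graphs $G$, of the number of $H$-free orientations of $G$. $\mathrm{ex}(n,F)$ is the maximum number of edges in an $n$-vertex graph containing no (not necessarily induced) copy of $F$. The implied constants in $\Theta$ are positive and independent of $n$ (they may depend on $F$, $H$, $\alpha$). *)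

(* Defs.v *)
From mathcomp Require Import all_boot.

Set Implicit Arguments.
Unset Strict Implicit.
Unset Printing Implicit Defensive.

(* A graph on a vertex type T is a set of edges, each a 2-element set of
   vertices; a digraph on T is a set of ordered pairs. *)
Definition simple_graph (T : finType) (G : {set {set T}}) : bool :=
  [forall e in G, #|e| == 2].

(* Irreflexive on simple graphs, as [set x; x] is a singleton. *)
Definition adj (T : finType) (G : {set {set T}}) : rel T :=
  [rel x y | [set x; y] \in G].

Definition arc (T : finType) (D : {set T * T}) : rel T :=
  [rel x y | (x, y) \in D].

(* D contains no loop when G is simple, since (x, x) then falls in the
   else branch; (+) is the exclusive or. *)
Definition is_orientation (T : finType) (G : {set {set T}}) (D : {set T * T})
    : bool :=
  [forall x, forall y,
     if adj G x y then arc D x y (+) arc D y x else ~~ arc D x y].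

(* Not necessarily induced copies; used both for graphs (via adj) and for
   oriented graphs (via arc). *)
Definition contains_copy (V T : finType) (r : rel V) (s : rel T) : bool :=
  [exists f : {ffun V -> T},
     injectiveb f && [forall x, forall y, r x y ==> s (f x) (f y)]].

Definition has_cycle (V : finType) (F : {set {set V}}) : Prop :=
  exists c : seq V, 2 < size c /\ ucycle (adj F) c.

Definition turan_number (V : finType) (F : {set {set V}}) (n : nat) : nat :=
  \max_(G : {set {set 'I_n}} |
        simple_graph G && ~~ contains_copy (adj F) (adj G)) #|G|.

Definition free_orientations (V T : finType) (H : {set V * V})
    (G : {set {set T}}) : {set {set T * T}} :=
  [set D | is_orientation G D & ~~ contains_copy (arc H) (arc D)].

Definition max_free_orientations (V : finType) (H : {set V * V}) (n : nat)
    : nat :=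
  \max_(G : {set {set 'I_n}} | simple_graph G) #|free_orientations H G|.

(* Main.v *)
(* Every orientation of an F-free graph is H-free, which gives the lower bound.

   For the upper bound, encode an orientation by its increasing arcs. A set of
   pairs shattered by the H-free orientations of G spans an F-free graph, since
   it carries all orientations of that graph, so by Pajor's lemma there are at
   most as many H-free orientations as F-free graphs on n vertices. These are
   counted by iterating a container lemma for the hypergraph of copies of F.
   The number of iterations costs no logarithmic factor provided that some
   gamma > 2 - alpha satisfies gamma (|S| - 1) <= |cover S| - 2 for all nonempty
   subgraphs S of F: then the fingerprint used at a graph with K n^alpha edges
   has size at most K^-(rho - 1) n^alpha for some rho > 1, and these sizes sum to
   O(n^alpha).

   Such a gamma exists because extremal F-free graphs are denser, by an unbounded
   factor, than the deletion method predicts. It suffices to see this for a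
   strictly 2-balanced graph with v vertices and e edges, for which the deletion
   bound is A = n^2 / l with l = n^((v-2)/(e-1)). Put on the F-free graphs I the
   Gibbs weight (K / l)^|I| exp (- energy I), where the energy penalises copies
   of proper subgraphs. If all F-free graphs had at most C A edges, then in a
   typical one most missing edges u could be inserted at bounded cost after
   deleting the edges that block u, which are few. As the Gibbs weight gives each
   insertion a rate of about K / l, the mean number of edges would be at least of
   order K^(1/2) A, which is absurd for large K. *)
Require Import Defs.
From mathcomp Require Import all_boot all_order all_algebra.
From mathcomp Require Import reals sequences exp.
From mathcomp Require Import zify ring lra.
Import Order.TTheory GRing.Theory Num.Theory.

Set Implicit Arguments.
Unset Strict Implicit.
Unset Printing Implicit Defensive.

(** * Copies and orientations *)

(** The obstacle is the strict inequality gamma > 2 - alpha: with equality, fingerprints would have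
    order n^alpha at every density and logarithms would enter the exponent. No denser graph is
    constructed; a bound C A on the edges of all F-free graphs is assumed and refuted. That
    assumption also helps: it bounds the exponential moment of the energy, so that the mean energy
    is at most Lam A with Lam linear in kappa = ln K. Since the energy charges b / l per missing
    edge, the copies of F minus an edge, which block missing edges, then number on average at most
    Lam / b per pair of vertices. With b a large multiple of C, all losses amount to a factor exp
    (kappa / 2 + O(1)), while the insertion rate gains exp kappa; this is the origin of K^(1/2).
    What remains is an error from edges that are addable, or cheaper, only because other edges were
    deleted. It requires three interlocking copies, and strict balancedness makes it smaller by a
    power of n. To keep the exponents integral, hosts have n = t^(e-1) vertices, so that l = t^(v-2)
    exactly and any strict inequality between exponents saves a full factor t. *)

Lemma simple_graph_card (T : finType) (G : {set {set T}}) :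
  simple_graph G -> #|G| <= #|T| ^ 2.
Proof.
move=> /forall_inP sG.
apply: (@leq_trans #|[set g : {set T} | #|g| == 2]|).
  by apply: subset_leq_card; apply/subsetP => g gG; rewrite inE sG.
rewrite card_draws bin2 leq_half_double leqW // (leq_trans (leq_mul (leqnn _) (leq_pred _))) //.
by rewrite mulnn -addnn leq_addr.
Qed.

Section Copies.
Variables V T : finType.
Implicit Types (f : {ffun V -> T}) (S F : {set {set V}}) (G I J : {set {set T}}).

Definition edge_image f S : {set {set T}} := [set f @: (g : {set V}) | g in S].

Definition copy_free F G : bool :=
  [forall f : {ffun V -> T}, injectiveb f ==> ~~ (edge_image f F \subset G)].

Lemma copy_freePn F G :
  reflect (exists2 f : {ffun V -> T}, injective f & edge_image f F \subset G)
          (~~ copy_free F G).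
Proof.
rewrite negb_forall; apply: (iffP existsP) => -[f].
  by rewrite negb_imply negbK => /andP[/injectiveP fI sfG]; exists f.
by move=> /injectiveP fI sfG; exists f; rewrite fI sfG.
Qed.

Lemma copy_freeS F G I : I \subset G -> copy_free F G -> copy_free F I.
Proof.
move=> sIG; apply: contraLR => /copy_freePn[f fI sfI].
by apply/copy_freePn; exists f => //; apply: subset_trans sIG.
Qed.

Lemma contains_copyE F G : simple_graph F ->
  contains_copy (adj F) (adj G) = ~~ copy_free F G.
Proof.
move=> /forall_inP sF; apply/existsP/copy_freePn.
  move=> [f /andP[/injectiveP fI /forallP H]]; exists f => //.
  apply/subsetP => _ /imsetP[g gF ->].
  have := sF g gF; move=> /cards2P[x [y] [xy gE]].
  move: (H x) => /forallP/(_ y)/implyP; rewrite /adj /= -gE => /(_ gF).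
  by rewrite gE imsetU1 imset_set1.
move=> [f fI sfG]; exists f; apply/andP; split; first exact/injectiveP.
apply/forallP => x; apply/forallP => y; apply/implyP; rewrite /adj /= => xyF.
apply: (subsetP sfG); apply/imsetP; exists [set x; y] => //.
by rewrite imsetU1 imset_set1.
Qed.

Lemma edge_image_inj f : injective f -> injective (fun g : {set V} => f @: g).
Proof. by move=> fI; apply: imset_inj. Qed.

Lemma card_edge_image f S : injective f -> #|edge_image f S| = #|S|.
Proof. by move=> fI; rewrite card_imset //; apply: edge_image_inj. Qed.

Lemma edge_imageS f S S' : S \subset S' -> edge_image f S \subset edge_image f S'.
Proof. exact: imsetS. Qed.

End Copies.

(** * Pajor's lemma on shattered sets *)

Section Pajor.
Variable X : finType.
Implicit Types (P : {set {set X}}) (S A B : {set X}).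

Definition shatters P S : bool :=
  [forall B : {set X}, (B \subset S) ==> [exists A in P, A :&: S == B]].

Lemma shattersP P S :
  reflect (forall B, B \subset S -> exists2 A, A \in P & A :&: S = B)
          (shatters P S).
Proof.
apply: (iffP forallP) => H B.
  by move=> sB; move: (H B); rewrite sB /= => /exists_inP[A AP /eqP]; exists A.
by apply/implyP => /H[A AP <-]; apply/exists_inP; exists A.
Qed.

Lemma shatters_sub P P' S : P' \subset P -> shatters P' S -> shatters P S.
Proof.
move=> sP /shattersP sh; apply/shattersP => B /sh[A AP <-].
by exists A => //; apply: (subsetP sP).
Qed.

(** Split [P] by membership of a point [x] on which two members differ. A set shattered by either
    half avoids [x]; a set shattered by both halves is counted twice, but then [P] also shatters it
    with [x] added. *)
Lemma pajor P : #|P| <= #|[set S | shatters P S]|.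
Proof.
have [n] := ubnP #|P|; elim: n P => // n IHn P ltPn.
have [le1|lt1] := leqP #|P| 1.
  have [-> |[A AP]] := set_0Vmem P; first by rewrite cards0.
  apply: leq_trans le1 _; apply/card_gt0P; exists set0; rewrite inE.
  by apply/shattersP => B; rewrite subset0 => /eqP ->; exists A; rewrite ?setI0.
have [A [B [AP BP neqAB]]] : exists A B, [/\ A \in P, B \in P & A != B].
  by have /card_gt1P[A [B [? ? ?]]] := lt1; exists A, B.
have [x xAB] : exists x, (x \in A) != (x \in B).
  apply/existsP; apply: contraNT neqAB; rewrite negb_exists => /forallP H.
  by apply/eqP/setP => x; apply/eqP; move: (H x); rewrite negbK.
pose P1 := [set C in P | x \in C]; pose P0 := [set C in P | x \notin C].
have cP : #|P| = #|P1| + #|P0|.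
  rewrite -cardsUI [P1 :&: P0](_ : _ = set0) ?cards0 ?addn0.
    by apply: eq_card => C; rewrite !inE -andb_orr orbN andbT.
  by apply/setP => C; rewrite !inE; case: (x \in C); rewrite ?andbF.
have sP1 : P1 \subset P by apply/subsetP => C; rewrite inE => /andP[].
have sP0 : P0 \subset P by apply/subsetP => C; rewrite inE => /andP[].
have [p1 p0] : 0 < #|P1| /\ 0 < #|P0|.
  case: (boolP (x \in A)) (xAB) => xA; case: (boolP (x \in B)) => // xB _.
    by split; apply/card_gt0P; [exists A | exists B]; rewrite inE ?AP ?BP.
  by split; apply/card_gt0P; [exists B | exists A]; rewrite inE ?AP ?BP.
have IH1 := IHn P1 ltac:(lia); have IH0 := IHn P0 ltac:(lia).
set S1 := [set S | shatters P1 S] in IH1; set S0 := [set S | shatters P0 S] in IH0.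
have xS1 S : shatters P1 S -> x \notin S.
  move=> /shattersP sh; apply/negP => xS.
  have [C CP E] := sh set0 (sub0set _).
  have : x \in C :&: S by move: CP; rewrite !inE xS => /andP[_ ->].
  by rewrite E inE.
have xS0 S : shatters P0 S -> x \notin S.
  move=> /shattersP sh; apply/negP => xS.
  have [C CP E] := sh S (subxx _).
  have : x \in C :&: S by rewrite E.
  by move: CP; rewrite !inE xS => /andP[_ /negbTE->].
rewrite cP; apply: leq_trans (leq_add IH1 IH0) _; rewrite -cardsUI.
have injU : {in S1 :&: S0 &, injective (fun S => x |: S)}.
  move=> S S'; rewrite !inE => /andP[/xS1 xS _] /andP[/xS1 xS' _] /setP E.
  apply/setP => y; move: (E y); rewrite !inE; case: eqP => [->|//].
  by rewrite (negbTE xS) (negbTE xS').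
rewrite -(card_in_imset injU) -cardsUI.
set U := S1 :|: S0; set W := _ @: _.
have -> : U :&: W = set0.
  apply/setP => S; rewrite !inE; apply/negP => /andP[].
  move=> HU /imsetP[S' _ ES].
  by case/orP: HU => [/xS1|/xS0]; rewrite ES setU11.
rewrite cards0 addn0; apply: subset_leq_card; apply/subsetP => S.
rewrite !inE => /orP[/orP[]|]; [exact: shatters_sub | exact: shatters_sub |].
move=> /imsetP[S']; rewrite !inE => /andP[sh1 sh0] ->.
apply/shattersP => C sC.
have sC' : C :\ x \subset S'.
  by apply/subsetP => y; rewrite !inE => /andP[yx /(subsetP sC)]; rewrite !inE (negbTE yx).
have [xC|xC] := boolP (x \in C).
  have [D] := shattersP _ _ sh1 _ sC'; rewrite inE => /andP[DP xD] E.
  exists D => //; apply/setP => y; move/setP/(_ y): E; rewrite !inE.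
  by case: eqP => [->|_] //=; rewrite xD xC.
have [D] := shattersP _ _ sh0 _ sC'; rewrite inE => /andP[DP xD] E.
exists D => //; apply/setP => y; move/setP/(_ y): E; rewrite !inE.
by case: eqP => [->|_] //=; rewrite (negbTE xD) (negbTE xC).
Qed.

End Pajor.

(** * H-free orientations against F-free graphs *)

Definition underlying (T : finType) (S : {set T * T}) : {set {set T}} :=
  [set [set p.1; p.2] | p in S].

Section OrientationsBound.
Variables (V : finType) (n : nat) (F : {set {set V}}) (H : {set V * V}).
Hypotheses (sF : simple_graph F) (oH : is_orientation F H).

Let upward (D : {set 'I_n * 'I_n}) := [set p in D | p.1 < p.2].

Lemma orientP (U : finType) (G : {set {set U}}) D x y : is_orientation G D ->
  if [set x; y] \in G then ((x, y) \in D) = ~~ ((y, x) \in D) else (x, y) \notin D.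
Proof.
move=> /forallP/(_ x)/forallP/(_ y); rewrite /adj /Defs.arc /=.
by case: ([set x; y] \in G) => //=; case: ((x, y) \in D); case: ((y, x) \in D).
Qed.

Lemma upward_inj (G : {set {set 'I_n}}) : simple_graph G ->
  {in [set D | is_orientation G D] &, injective upward}.
Proof.
move=> sG D D'; rewrite !inE => oD oD' /setP E.
have loop x : (x, x) \in D = ((x, x) \in D').
  have := orientP x x oD; have := orientP x x oD'.
  by case: ifP => _; case: (_ \in D'); case: (_ \in D).
apply/setP => -[x y]; have [lt|lt|/val_inj->//] := ltngtP x y.
  by move: (E (x, y)); rewrite !inE /= lt !andbT.
move: (E (y, x)); rewrite !inE /= lt !andbT => Eyx.
have := orientP x y oD; have := orientP x y oD'.
by case: ifP => _; [move=> -> ->; rewrite Eyx | move=> /negbTE-> /negbTE->].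
Qed.

Lemma card_free_orientations (G : {set {set 'I_n}}) : simple_graph G ->
  #|free_orientations H G| <= #|[set I : {set {set 'I_n}} | simple_graph I & copy_free F I]|.
Proof.
move=> sG; set P := free_orientations H G.
have injP : {in P &, injective upward}.
  move=> D D' HD HD'; apply: (upward_inj sG); rewrite inE.
    by move: HD; rewrite inE => /andP[].
  by move: HD'; rewrite inE => /andP[].
rewrite -(card_in_imset injP); apply: leq_trans (pajor _) _.
set Q := upward @: P.
have upS S p : shatters Q S -> p \in S -> p.1 < p.2.
  move=> /shattersP sh pS; have [_ /imsetP[D _ ->] E] := sh S (subxx _).
  have : p \in upward D :&: S by rewrite E.
  by rewrite !inE => /andP[/andP[]].
have edgeS S p : shatters Q S -> p \in S -> [set p.1; p.2] \in G.
  move=> /shattersP sh pS; have [_ /imsetP[D DP ->] E] := sh S (subxx _).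
  have : p \in upward D :&: S by rewrite E.
  rewrite !inE => /andP[/andP[pD _] _].
  move: DP; rewrite inE => /andP[oD _]; have := orientP p.1 p.2 oD.
  by case: ifP => // _; case: p pD {pS} => a b /= ->.
have memU S x y : shatters Q S -> [set x; y] \in underlying S ->
    x < y -> (x, y) \in S.
  move=> sh /imsetP[[a b] abS E] xy; have /= ab := upS _ _ sh abS.
  have [xa|xa] := eqVneq x a.
    have : y \in [set a; b] by rewrite -E !inE eqxx orbT.
    rewrite !inE => /orP[/eqP ya|/eqP ->]; last by rewrite xa.
    by move: xy; rewrite ya xa ltnn.
  have : x \in [set a; b] by rewrite -E !inE eqxx.
  rewrite !inE (negbTE xa) /= => /eqP xb.
  have : y \in [set a; b] by rewrite -E !inE eqxx orbT.
  rewrite !inE => /orP[]/eqP yE; move: xy; rewrite xb yE; last by rewrite ltnn.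
  by move=> /(ltn_trans ab); rewrite ltnn.
have injU : {in [set S | shatters Q S] &, injective (@underlying 'I_n)}.
  have half S S' : shatters Q S -> shatters Q S' ->
      underlying S = underlying S' -> S \subset S'.
    move=> sh sh' E; apply/subsetP => -[x y] xyS; have /= xy := upS _ _ sh xyS.
    by apply: memU => //; rewrite -E; apply/imsetP; exists (x, y).
  move=> S S'; rewrite !inE => sh sh' E.
  by apply/eqP; rewrite eqEsubset !half.
rewrite -(card_in_imset injU); apply: subset_leq_card; apply/subsetP => I.
move=> /imsetP[S]; rewrite inE => sh ->; rewrite inE; apply/andP; split.
  apply/forall_inP => _ /imsetP[p pS ->].
  by rewrite cards2 neq_ltn (upS _ _ sh pS).
apply/negPn/negP => /copy_freePn[f fI sfU].
(* [B] collects the pairs of [S] that are arcs of the image of [H] under [f]. An orientation tracing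
   [B] on [S] contains the increasing arcs of this image because they lie in [B], and the decreasing
   ones because their reversals do not; so it is not [H]-free. *)
pose B := [set p in S | [exists q in H, p == (f q.1, f q.2)]].
have sBS : B \subset S by apply/subsetP => p; rewrite inE => /andP[].
have [_ /imsetP[D DP ->] EB] := shattersP _ _ sh B sBS.
move: (DP); rewrite inE => /andP[oD /negP[]].
apply/existsP; exists f; apply/andP; split; first exact/injectiveP.
apply/forallP => a; apply/forallP => b; apply/implyP; rewrite /Defs.arc /= => abH.
have abF : [set a; b] \in F.
  by have := orientP a b oH; case: ifP => //; rewrite abH.
have baH : (b, a) \notin H by have := orientP a b oH; rewrite abF abH => <-.
have inU : [set f a; f b] \in underlying S.
  apply: (subsetP sfU); apply/imsetP; exists [set a; b] => //.
  by rewrite imsetU1 imset_set1.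
have neab : a != b.
  by move: (forall_inP sF _ abF); rewrite cards2; case: (a == b).
have [lt|lt|E] := ltngtP (f a) (f b).
- have abS := memU _ _ _ sh inU lt.
  have : (f a, f b) \in B.
    by rewrite inE abS; apply/exists_inP; exists (a, b).
  by rewrite -EB !inE => /andP[/andP[]].
- rewrite setUC in inU; have baS := memU _ _ _ sh inU lt.
  have : (f b, f a) \notin B.
    rewrite inE baS /=; apply/exists_inP => -[[c d] cdH /eqP[/fI bc /fI ad]].
    by move: baH; rewrite bc ad cdH.
  rewrite -EB !inE baS lt !andbT => nD.
  have := orientP (f a) (f b) oD; rewrite setUC.
  by rewrite (edgeS _ _ sh baS) => ->.
- by move/val_inj/fI: E => /eqP; rewrite (negbTE neab).
Qed.

End OrientationsBound.

Lemma card_orientations_ge n (G : {set {set 'I_n}}) : simple_graph G ->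
  2 ^ #|G| <= #|[set D : {set 'I_n * 'I_n} | is_orientation G D]|.
Proof.
(* Edges in [S] are oriented upwards, the other edges of [G] downwards. *)
move=> sG; pose o (S : {set {set 'I_n}}) : {set 'I_n * 'I_n} :=
  [set p | ([set p.1; p.2] \in G) && (([set p.1; p.2] \in S) == (p.1 < p.2))].
rewrite -card_powerset; suff <- : #|o @: powerset G| = #|powerset G|.
  apply/subset_leq_card/subsetP => _ /imsetP[S _ ->]; rewrite inE.
  apply/forallP => x; apply/forallP => y; rewrite /adj /Defs.arc /= !inE /= (setUC [set y]).
  case: (boolP ([set x; y] \in G)) => //= xyG; have := forall_inP sG _ xyG; rewrite cards2.
  have [<-//|xy _] := eqVneq x y; rewrite -val_eqE /= in xy.
  by case: ltngtP xy => //; case: (_ \in S).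
apply: card_in_imset => S S'; rewrite !inE => SG SG' /setP E.
apply/setP => g; have [gG|gG] := boolP (g \in G); last first.
  by rewrite (negbTE (contra (subsetP SG g) gG)) (negbTE (contra (subsetP SG' g) gG)).
have /cards2P[x [y [xy gE]]] := forall_inP sG g gG.
have := E (x, y); rewrite !inE /= -gE gG /=.
by case: (g \in S); case: (g \in S'); case: (x < y).
Qed.

Lemma orientation_copy_free (V T : finType) (F : {set {set V}}) (H : {set V * V})
    (G : {set {set T}}) (D : {set T * T}) :
  is_orientation F H -> is_orientation G D ->
  contains_copy (Defs.arc H) (Defs.arc D) -> contains_copy (adj F) (adj G).
Proof.
move=> oH oD /existsP[f /andP[fI /forallP hf]]; apply/existsP; exists f; rewrite fI /=.
apply/forallP => x; apply/forallP => y; apply/implyP => xyF.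
have DG a b : Defs.arc D a b -> adj G a b.
  by have := forallP (forallP oD a) b; case: ifP => // _ /negbTE ->.
have /forallP/(_ y) := hf x; have /forallP/(_ x) := hf y.
have := forallP (forallP oH x) y; rewrite xyF.
case: (Defs.arc H x y) => /=; first by move=> _ _ /DG.
by move=> -> /= /DG; rewrite /adj /= setUC.
Qed.

Section Bounds.
Variables (V : finType) (F : {set {set V}}) (H : {set V * V}).
Hypotheses (sF : simple_graph F) (F_gt0 : 0 < #|F|) (oH : is_orientation F H).

Lemma turan_le_max_free n : 2 ^ turan_number F n <= max_free_orientations H n.
Proof.
have P0 : simple_graph (set0 : {set {set 'I_n}}) && ~~ contains_copy (adj F) (adj (set0 : {set {set 'I_n}})).
  rewrite contains_copyE // negbK; apply/andP; split.
    by apply/forall_inP => e; rewrite inE.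
  apply/negPn/copy_freePn => -[f fI]; rewrite subset0 -cards_eq0 card_edge_image //.
  by rewrite -leqn0 leqNgt F_gt0.
pose P := [pred G : {set {set 'I_n}} | simple_graph G & ~~ contains_copy (adj F) (adj G)].
have [|G /andP[sG fG] GE] := @eq_bigmax_cond _ P (fun G => #|G|).
  by apply/card_gt0P; exists set0.
have -> : turan_number F n = #|G| by rewrite -GE.
apply: leq_trans (leq_bigmax_cond _ sG).
apply: leq_trans (card_orientations_ge sG) _; apply: subset_leq_card.
apply/subsetP => D; rewrite !inE => oD; rewrite oD /=.
by apply: contra fG; apply: orientation_copy_free oD.
Qed.

Lemma max_free_le n :
  max_free_orientations H n <= #|[set I : {set {set 'I_n}} | simple_graph I & copy_free F I]|.
Proof. by apply/bigmax_leqP => G; apply: card_free_orientations. Qed.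

Lemma copy_free_le_turan n (G : {set {set 'I_n}}) :
  simple_graph G -> copy_free F G -> #|G| <= turan_number F n.
Proof.
move=> sG fG; apply: (leq_bigmax_cond (P := fun G : {set {set 'I_n}} =>
  simple_graph G && ~~ contains_copy (adj F) (adj G))).
by rewrite sG contains_copyE // fG.
Qed.

Lemma max_free_gt0 n : 0 < max_free_orientations H n.
Proof. by apply: leq_trans (turan_le_max_free n); rewrite expn_gt0. Qed.

End Bounds.

Lemma max_free_le_sqr (V : finType) (F : {set {set V}}) (H : {set V * V}) n :
  simple_graph F -> is_orientation F H -> max_free_orientations H n <= 2 ^ (n ^ 2).
Proof.
move=> sF oH; apply: leq_trans (max_free_le sF oH n) _.
pose E := [set g : {set 'I_n} | #|g| == 2].
apply: (@leq_trans #|powerset E|).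
  apply: subset_leq_card; apply/subsetP => I; rewrite !inE => /andP[/forall_inP sI _].
  by apply/subsetP => g /sI; rewrite inE.
rewrite card_powerset leq_pexp2l // -[X in _ <= X ^ 2](card_ord n).
by apply: simple_graph_card; apply/forall_inP => g; rewrite inE.
Qed.

(** * A strictly balanced graph has dense copy-free hosts *)

(** Cross-multiplied form of (|S| - 1) / (|cover S| - 2) < (|F| - 1) / (|V| - 2): proper subgraphs
    with at least two edges have smaller 2-density. Only covered vertices of [S] count. *)
Definition strictly_balanced (V : finType) (F : {set {set V}}) : Prop :=
  forall S : {set {set V}}, S \subset F -> 1 < #|S| -> S != F ->
    (#|S| - 1) * (#|V| - 2) < (#|cover S| - 2) * (#|F| - 1).

Definition inner (V : finType) (S : {set {set V}}) (A : {set V}) :=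
  [set g in S | g \subset A].

Section BalancedGraph.
Variables (V : finType) (F : {set {set V}}).
Hypotheses (sF : simple_graph F) (cF : cover F = setT) (gt2V : 2 < #|V|)
  (leVF : #|V| <= #|F|) (bF : strictly_balanced F).

Lemma edge_card g : g \in F -> #|g| = 2.
Proof. by move=> /(forall_inP sF)/eqP. Qed.

(** In terms of n^(v-2) = l^(e-1): each of the |V| - |A| vertices outside [A] gives a factor n, each
    edge of [F] not counted in [inner S A] a factor 1 / l, and the product is at most 1. It equals 1
    only when nothing is left to extend or when [A] is the vertex set of a single edge. *)
Lemma balanced_inner (S : {set {set V}}) (A : {set V}) :
    S \subset F -> 0 < #|inner S A| ->
  (#|F| - 1) * (#|V| - #|A|) <= (#|V| - 2) * (#|F| - #|inner S A|)
  /\ ((#|F| - 1) * (#|V| - #|A|) = (#|V| - 2) * (#|F| - #|inner S A|) ->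
      [/\ S = F & A = setT] \/ #|inner S A| = 1 /\ #|A| = 2).
Proof.
move=> sSF gt0; set S' := inner S A.
have sS'S : S' \subset S by apply/subsetP => g; rewrite inE => /andP[].
have sS'F := subset_trans sS'S sSF.
have leS'F := subset_leq_card sS'F.
have leAV : #|A| <= #|V| := max_card _.
have sCA : cover S' \subset A.
  by apply/bigcupsP => g; rewrite inE => /andP[].
have leCA := subset_leq_card sCA.
have [g gS'] : exists g, g \in S' by apply/card_gt0P.
have ge2A : 2 <= #|A|.
  rewrite -(edge_card (subsetP sS'F _ gS')); apply: subset_leq_card.
  by move: gS'; rewrite inE => /andP[].
have [E|neS'] := eqVneq S' F.
  have AT : A = setT by apply/eqP; rewrite -subTset -cF -E.
  have SF : S = F by apply/eqP; rewrite eqEsubset sSF -E.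
  by rewrite AT cardsT subnn muln0; split=> // _; left.
have [le1|lt1] := leqP #|S'| 1.
  have -> : #|S'| = 1 by rewrite -/S' in gt0; lia.
  split; first by rewrite mulnC leq_mul2r leq_sub2l ?orbT.
  rewrite mulnC => /eqP; rewrite eqn_pmul2r; last by lia.
  by move=> /eqP E; right; split=> //; lia.
have lt := bF sS'F lt1 neS'.
have lt2 : (#|S'| - 1) * (#|V| - 2) < (#|A| - 2) * (#|F| - 1).
  by apply: leq_trans lt _; rewrite leq_mul2r leq_sub2r ?orbT.
suff : (#|F| - 1) * (#|V| - #|A|) < (#|V| - 2) * (#|F| - #|S'|).
  by move=> H; split; [exact: ltnW | move=> E; rewrite E ltnn in H].
move: lt2; move: #|S'| #|A| #|V| #|F| lt1 leS'F ge2A leAV => p a v e p1 pe a2 av.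
case: p p1 pe => // p _ pe; case: a a2 av => [|[|a]] // _ av.
have [k ->] : exists k, v = a + k + 2 by exists (v - a.+2); lia.
have [l ->] : exists l, e = p + l + 1 by exists (e - p.+1); lia.
by nia.
Qed.

Variable T : finType.
Implicit Types f : {ffun V -> T}.

Lemma card_preim_codom f (W : {set T}) : injective f ->
  #|f @^-1: W| = #|f @: setT :&: W|.
Proof.
move=> fI; rewrite -(card_imset _ fI); apply: eq_card => y; rewrite inE.
apply/imsetP/andP => [[x]|[/imsetP[x _ ->] yW]]; last by exists x; rewrite ?inE.
by rewrite inE => xW ->; split=> //; apply: imset_f.
Qed.

(* Two copies meeting in a single edge cannot jointly contain a third copy
   avoiding that edge and using edges of both: it would have too many edges
   on one of the two sides. *)
Lemma no_glued_copy f1 f2 f3 (u s t : {set T}) :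
    injective f1 -> injective f2 -> injective f3 ->
    u \in edge_image f1 F -> u \in edge_image f2 F -> u \notin edge_image f3 F ->
    s \in edge_image f3 F -> s \in edge_image f1 F ->
    t \in edge_image f3 F -> t \in edge_image f2 F ->
    #|f1 @: setT :&: f2 @: setT| = 2 ->
    ~ (edge_image f3 F \subset edge_image f1 F :|: edge_image f2 F).
Proof.
move=> f1I f2I f3I u1 u2 u3 s3 s1 t3 t2 c2 sub.
have in_codom f g : g \in edge_image f F -> g \subset f @: setT.
  by move=> /imsetP[h _ ->]; apply: imsetS; apply: subsetT.
have cardE f g : injective f -> g \in edge_image f F -> #|g| = 2.
  by move=> fI /imsetP[h hF ->]; rewrite card_imset // edge_card.
have uE : f1 @: setT :&: f2 @: setT = u.
  apply/eqP; rewrite eq_sym eqEcard c2 (cardE f1) // leqnn andbT.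
  by rewrite subsetI !in_codom.
(* The edges of the third copy are distributed over the first two. These share only the vertices of
   [u], and [u] is not in the third copy, so [E1] and [E2] partition [F]. *)
pose E1 := [set g in F | f3 @: (g : {set V}) \in edge_image f1 F].
pose E2 := [set g in F | f3 @: (g : {set V}) \in edge_image f2 F].
have EF : E1 :|: E2 = F.
  apply/setP => g; rewrite !inE -andb_orr; apply: andb_idr => gF.
  by have := subsetP sub _ (imset_f _ gF); rewrite inE.
have E0 : E1 :&: E2 = set0.
  apply/setP => g; rewrite !inE; apply/negP => /andP[/andP[gF g1] /andP[_ g2]].
  have : f3 @: (g : {set V}) \subset u by rewrite -uE subsetI !in_codom.
  move=> sgu; have /eqP gu : f3 @: (g : {set V}) == u.
    by rewrite eqEcard sgu card_imset // (edge_card gF) (cardE f1).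
  by move/negP: u3; apply; rewrite -gu; apply: imset_f.
have cE : #|E1| + #|E2| = #|F| by rewrite -cardsUI E0 EF cards0 addn0.
have E1_gt0 : 0 < #|E1|.
  apply/card_gt0P; case/imsetP: s3 => g gF sE; exists g.
  by rewrite inE gF -sE.
have E2_gt0 : 0 < #|E2|.
  apply/card_gt0P; case/imsetP: t3 => g gF tE; exists g.
  by rewrite inE gF -tE.
pose B1 := f3 @^-1: (f1 @: setT); pose B2 := f3 @^-1: (f2 @: setT).
have sE1 : E1 \subset inner F B1.
  apply/subsetP => g; rewrite !inE => /andP[-> /in_codom] /= /subsetP sg.
  by apply/subsetP => x xg; rewrite inE; apply: sg; apply: imset_f.
have sE2 : E2 \subset inner F B2.
  apply/subsetP => g; rewrite !inE => /andP[-> /in_codom] /= /subsetP sg.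
  by apply/subsetP => x xg; rewrite inE; apply: sg; apply: imset_f.
have BT : B1 :|: B2 = setT.
  apply/eqP; rewrite -subTset -cF; apply/bigcupsP => g; rewrite -EF inE.
  case/orP => [/(subsetP sE1)|/(subsetP sE2)]; rewrite inE => /andP[_] sg.
    by apply: subset_trans sg _; apply: subsetUl.
  by apply: subset_trans sg _; apply: subsetUr.
have cB : #|B1| + #|B2| = #|V| + #|B1 :&: B2| by rewrite -cardsUI BT cardsT.
have BI : B1 :&: B2 = f3 @^-1: u by rewrite -uE preimsetI.
have leBI : #|B1 :&: B2| <= 2.
  rewrite BI card_preim_codom // -(cardE f1 u) //.
  by apply: subset_leq_card; apply: subsetIr.
have leB1 : #|B1| <= #|V| := max_card _.
have leB2 : #|B2| <= #|V| := max_card _.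
have := balanced_inner (subxx F) (leq_trans E1_gt0 (subset_leq_card sE1)).
have := balanced_inner (subxx F) (leq_trans E2_gt0 (subset_leq_card sE2)).
move=> [ine2 _] [ine1 _].
have l1 := subset_leq_card sE1; have l2 := subset_leq_card sE2.
have m1 : #|inner F B1| <= #|F|.
  by apply: subset_leq_card; apply/subsetP => g; rewrite inE => /andP[].
have m2 : #|inner F B2| <= #|F|.
  by apply: subset_leq_card; apply/subsetP => g; rewrite inE => /andP[].
(* With at most one common vertex, the two extension inequalities add up to (|F| - 1)(|V| - 1) <=
   (|V| - 2)|F|, which fails for |V| <= |F|. *)
have [lt2|ge2] := ltnP #|B1 :&: B2| 2.
  have le1 : (#|F| - 1) * (#|V| - #|B1|) <= (#|V| - 2) * #|E2|.
    by apply: leq_trans ine1 _; rewrite leq_mul2l; apply/orP; right; clear -cE l1; lia.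
  have le2 : (#|F| - 1) * (#|V| - #|B2|) <= (#|V| - 2) * #|E1|.
    by apply: leq_trans ine2 _; rewrite leq_mul2l; apply/orP; right; clear -cE l2; lia.
  have := leq_add le1 le2; rewrite -!mulnDr addnC (addnC #|E2|) cE.
  have : #|V| - 1 <= #|V| - #|B2| + (#|V| - #|B1|) by clear -cB lt2 leB1 leB2; lia.
  move: (_ - _ + (_ - _)) => d dv.
  have : (#|F| - 1) * (#|V| - 1) <= (#|F| - 1) * d by rewrite leq_mul2l dv orbT.
  move: {dv} (_ * d) => x; clear -gt2V leVF.
  move: #|V| #|F| gt2V leVF => [|[|[|v]]] [|e] //= _ lve.
  by rewrite !subn1 /= => le1 le2; have := leq_trans le1 le2; nia.
have uB : u \subset f3 @: setT.
  have : #|f3 @: setT :&: u| = 2.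
    by rewrite -card_preim_codom // -BI; apply/eqP; rewrite eqn_leq leBI.
  move=> c; have /eqP <- : f3 @: setT :&: u == u; last exact: subsetIl.
  by rewrite eqEcard subsetIr c (cardE f1).
(* Here both vertices of [u] lie in the third copy. Seen through [f1] or [f2], where [u] is an edge,
   each side gains the edge [u] that it lacks in [f3]; the inequalities then add up to (|F| - 1)(|V|
   - 2) <= (|V| - 2)(|F| - 2). *)
have lift f : injective f -> u \in edge_image f F ->
    forall (E : {set {set V}}) (B : {set V}), E \subset F -> B = f3 @^-1: (f @: setT) ->
    (forall g, g \in E -> f3 @: (g : {set V}) \in edge_image f F) ->
    exists2 A : {set V}, #|A| = #|B| & #|E| < #|inner F A|.
  move=> fI uf E B sEF BE HE; exists (f @^-1: (f3 @: setT)).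
    by rewrite BE !card_preim_codom // setIC.
  have /imsetP[gu guF guE] := uf.
  have -> : #|E|.+1 = #|u |: edge_image f3 E|.
    rewrite cardsU1 card_edge_image //; case: (boolP (u \in _)) => // uE3.
    by case/negP: u3; apply: (subsetP (edge_imageS f3 sEF)).
  rewrite -(card_edge_image (inner F _) fI); apply: subset_leq_card.
  apply/subsetP => h; rewrite !inE => /orP[/eqP ->|/imsetP[g gE ->]].
    rewrite guE; apply: imset_f; rewrite inE guF; apply/subsetP => x xg.
    by rewrite inE; apply: (subsetP uB); rewrite guE; apply: imset_f.
  have /imsetP[g' g'F E'] := HE g gE.
  rewrite E'; apply: imset_f; rewrite inE g'F; apply/subsetP => x xg.
  rewrite inE; have : f x \in f @: (g' : {set V}) by apply: imset_f.
  by rewrite -E'; apply: (subsetP (imsetS _ (subsetT _))).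
have [||A1 cA1 lA1] := lift f1 f1I u1 E1 B1 _ erefl.
- by apply/subsetP => g; rewrite inE => /andP[].
- by move=> g; rewrite inE => /andP[].
have [||A2 cA2 lA2] := lift f2 f2I u2 E2 B2 _ erefl.
- by apply/subsetP => g; rewrite inE => /andP[].
- by move=> g; rewrite inE => /andP[].
have [inA1 _] := balanced_inner (subxx F) (leq_ltn_trans (leq0n _) lA1).
have [inA2 _] := balanced_inner (subxx F) (leq_ltn_trans (leq0n _) lA2).
have n1 : #|inner F A1| <= #|F|.
  by apply: subset_leq_card; apply/subsetP => g; rewrite inE => /andP[].
have n2 : #|inner F A2| <= #|F|.
  by apply: subset_leq_card; apply/subsetP => g; rewrite inE => /andP[].
rewrite cA1 in inA1; rewrite cA2 in inA2.
have le1 : (#|F| - 1) * (#|V| - #|B1|) <= (#|V| - 2) * (#|E2| - 1).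
  by apply: leq_trans inA1 _; rewrite leq_mul2l; apply/orP; right; clear -cE lA1; lia.
have le2 : (#|F| - 1) * (#|V| - #|B2|) <= (#|V| - 2) * (#|E1| - 1).
  by apply: leq_trans inA2 _; rewrite leq_mul2l; apply/orP; right; clear -cE lA2; lia.
have := leq_add le1 le2; rewrite -!mulnDr.
have -> : #|V| - #|B1| + (#|V| - #|B2|) = #|V| - 2.
  by clear -cB ge2 leBI leB1 leB2; lia.
by rewrite mulnC leq_mul2l; clear -gt2V leVF cE E1_gt0 E2_gt0; lia.
Qed.

End BalancedGraph.

Fact regroup_powers (R : fieldType) (y1 y2 y3 y4 y5 x1 x2 x3 x4 x5 : R) :
  (x4 != 0 -> x5 != 0 -> x1 != 0 -> x2 != 0 -> x3 != 0 ->
  y1 * x1 * y2 * y3 * (y4 / (x1 * x2 * x3 * x4) * (y5 / x5)) =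
  y1 * (y4 * y5) * ((y2 / x2) * (y3 / (x5 * x3)) / x4))%R.
Proof. by move=> *; field; do ?[apply/andP; split]. Qed.

Fact pred_sum_leq (e a b d m : nat) :
  0 < e -> e + a + b + d <= m -> e - 1 + a + b + d <= m - 1.
Proof. lia. Qed.

Fact sum3_leq (e i s j : nat) (d : bool) : 0 < e -> s <= e -> j <= s ->
  e - 1 + (e - i) + (s - j) + d <= 3 * e.
Proof. by case: d; lia. Qed.

Fact regroup_counts (R : comPzRingType) (x a y b z w : R) :
  (x * (a * y * (b * z)) * w = a * b * (x * y * z * w))%R.
Proof. by ring. Qed.

(** * Weighted count of triples of interlocking copies *)

Section CopyTriples.
Variables (V T : finType) (F : {set {set V}}).
Hypotheses (sF : simple_graph F) (cF : cover F = setT) (gt2V : 2 < #|V|)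
  (leVF : #|V| <= #|F|) (bF : strictly_balanced F).
Implicit Types (f : {ffun V -> T}) (S : {set {set V}}).

Lemma card_maps_into (A : {set V}) (W : {set T}) :
  #|[set f : {ffun V -> T} | f @: A \subset W]| = #|W| ^ #|A| * #|T| ^ (#|V| - #|A|).
Proof.
pose D (x : V) : pred T := fun y => (x \in A) ==> (y \in W).
have DA x : x \in A -> #|D x| = #|W|.
  by move=> xA; apply: eq_card => y; rewrite unfold_in /D xA.
have DN x : x \notin A -> #|D x| = #|T|.
  by move=> xA; apply: eq_card => y; rewrite unfold_in /D (negbTE xA).
have -> : #|[set f : {ffun V -> T} | f @: A \subset W]| = #|family D|.
  apply: eq_card => f; rewrite inE; apply/subsetP/familyP => H x.
    by rewrite unfold_in; apply/implyP => xA; apply: H; apply: imset_f.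
  by move=> /imsetP[y yA ->]; move: (H y); rewrite unfold_in /D yA.
rewrite card_family foldrE big_map enumT -/(index_enum V) /=.
rewrite (bigID (mem A)) /= (eq_bigr (fun=> #|W|)); last exact: DA.
rewrite [X in _ * X](eq_bigr (fun=> #|T|)); last exact: DN.
rewrite !prod_nat_const; congr (_ * _ ^ _).
by rewrite -(cardC A) addKn.
Qed.

Lemma card_new_edges f S (E : {set {set T}}) (A : {set V}) :
    injective f -> (forall g, g \in S -> f @: (g : {set V}) \in E -> g \subset A) ->
  #|S| - #|inner S A| <= #|edge_image f S :\: E|.
Proof.
move=> fI HE; rewrite leq_subLR -(card_edge_image S fI) -(cardsID E (edge_image f S)).
rewrite leq_add2r -(card_edge_image (inner S A) fI); apply: subset_leq_card.
apply/subsetP => h; rewrite inE => /andP[/imsetP[g gS ->] gE].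
by apply: imset_f; rewrite inE gS HE.
Qed.

(** The configuration met when room is made for [u]: an edge [s] is deleted because of the copy [f1]
    of [F] through [u], this destroys the copy [f3] of [S] through [t], and [t] itself blocks [u]
    through the copy [f2]. *)
Definition linked_triple S f1 f2 f3 (u t : {set T}) : bool :=
  [&& [&& injectiveb f1, injectiveb f2 & injectiveb f3],
      [&& u \in edge_image f1 F, u \in edge_image f2 F & u \notin edge_image f3 S],
      [&& t \notin edge_image f1 F, t \in edge_image f2 F & t \in edge_image f3 S] &
      [exists s, [&& s \in edge_image f1 F, s \notin edge_image f2 F
                    & s \in edge_image f3 S]]].

Definition triple_edges S f1 f2 f3 : {set {set T}} :=
  edge_image f1 F :|: edge_image f2 F :|: edge_image f3 S.

(** Equality in [balanced_inner]: attaching the rest of a copy along [A] loses no power of the host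
    size. *)
Definition tight S (A : {set V}) : bool :=
  (#|F| - 1) * (#|V| - #|A|) == (#|V| - 2) * (#|F| - #|inner S A|).

(** Glue [f2] onto [f1], then [f3] onto the union; each gluing adds at least the edges not inside
    the part already present. Suppose both are tight and no further edge appears. Then [f3] is a
    copy of [F] inside the union of the other two, and [f2] either adds no edge, contradicting [t],
    or meets [f1] in two vertices, contradicting [no_glued_copy]. *)
Lemma linked_triple_edges S f1 f2 f3 u t : S \subset F ->
    linked_triple S f1 f2 f3 u t ->
  let A2 := f2 @^-1: (f1 @: setT) in
  let A3 := f3 @^-1: (f1 @: setT :|: f2 @: setT) in
  [/\ 0 < #|inner F A2|, 1 < #|inner S A3| &
      #|F| + (#|F| - #|inner F A2|) + (#|S| - #|inner S A3|)
        + (tight F A2 && tight S A3)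
      <= #|triple_edges S f1 f2 f3|].
Proof.
move=> sSF /and4P[/and3P[/injectiveP f1I /injectiveP f2I /injectiveP f3I]].
move=> /and3P[u1 u2 u3] /and3P[t1 t2 t3] /existsP[s /and3P[s1 s2 s3]] A2 A3.
have in_codom f S' g : g \in edge_image f S' -> g \subset f @: setT.
  by move=> /imsetP[h _ ->]; apply: imsetS; apply: subsetT.
have preim f (W : {set T}) (g : {set V}) :
    f @: (g : {set V}) \subset W -> g \subset f @^-1: W.
  move=> /subsetP sub; apply/subsetP => x xg; rewrite inE.
  by apply: sub; apply: imset_f.
have i2 : 0 < #|inner F A2|.
  case/imsetP: (u2) => g gF uE; apply/card_gt0P; exists g; rewrite inE gF /=.
  by apply: preim; rewrite -uE; apply: in_codom u1.
have i3 : 1 < #|inner S A3|.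
  case/imsetP: (t3) => g gS tE; case/imsetP: (s3) => h hS sE.
  apply/card_gt1P; exists g, h; split; rewrite ?inE ?gS ?hS /=.
  - apply: preim; rewrite -tE; apply: subset_trans (in_codom _ _ _ t2) _.
    exact: subsetUr.
  - apply: preim; rewrite -sE; apply: subset_trans (in_codom _ _ _ s1) _.
    exact: subsetUl.
  - by apply: contraNneq s2 => gh; rewrite sE -gh -tE.
split=> //.
have new2 : #|F| - #|inner F A2| <= #|edge_image f2 F :\: edge_image f1 F|.
  by apply: card_new_edges => // g _ /in_codom; apply: preim.
have new3 : #|S| - #|inner S A3|
            <= #|edge_image f3 S :\: (edge_image f1 F :|: edge_image f2 F)|.
  apply: card_new_edges => // g _ gE; apply: preim; move: gE; rewrite inE.
  case/orP => /in_codom sub; apply: subset_trans sub _.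
    exact: subsetUl.
  exact: subsetUr.
have cU (E E' : {set {set T}}) : #|E :|: E'| = #|E| + #|E' :\: E|.
  have -> : E :|: E' = E :|: (E' :\: E).
    by apply/setP => x; rewrite !inE; case: (x \in E).
  by have := cardsUI E (E' :\: E); rewrite setDE setICA setICr setI0 cards0 addn0.
have base : #|triple_edges S f1 f2 f3| = #|F|
    + #|edge_image f2 F :\: edge_image f1 F|
    + #|edge_image f3 S :\: (edge_image f1 F :|: edge_image f2 F)|.
  by rewrite /triple_edges cU cU card_edge_image.
case: (boolP (_ && _)) => [/andP[t2' t3']|_]; last first.
  by rewrite addn0 base; apply: leq_add new3; rewrite leq_add2l.
rewrite addn1 ltnNge; apply/negP => le.
have [_ /(_ (eqP t3'))[[SF AT]|[E _]]] :=
  balanced_inner sF cF gt2V leVF bF sSF (ltnW i3); last by rewrite E in i3.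
have c3 : #|inner S A3| = #|S|.
  by apply: eq_card => g; rewrite inE AT subsetT andbT.
have eq3 : edge_image f3 S \subset edge_image f1 F :|: edge_image f2 F.
  by rewrite -setD_eq0 -cards_eq0; clear -base le new2 c3; lia.
have [_ /(_ (eqP t2'))[[_ AT2]|[_ c2]]] :=
  balanced_inner sF cF gt2V leVF bF (subxx F) i2.
  have cI : #|inner F A2| = #|F|.
    by apply: eq_card => g; rewrite inE AT2 subsetT andbT.
  have : #|edge_image f2 F :\: edge_image f1 F| == 0.
    by clear -base le cI c3; lia.
  by rewrite cards_eq0 setD_eq0 => /subsetP/(_ t t2); rewrite (negbTE t1).
rewrite SF in eq3 u3 t3 s3.
apply: (no_glued_copy sF cF gt2V leVF bF f1I f2I f3I u1 u2 u3 s3 s1 t3 t2) => //.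
by rewrite setIC -card_preim_codom.
Qed.

Variables (R : realFieldType) (K b : R) (t : nat).
Let e := #|F|.
Let v := #|V|.
Let n : R := t%:R ^+ (e - 1).
Let l : R := t%:R ^+ (v - 2).
Hypotheses (K1 : (1 <= K)%R) (b1 : (1 <= b)%R) (t_gt0 : 0 < t)
  (Kl : (K <= l)%R) (cT : #|T| = t ^ (e - 1)).

Local Open Scope ring_scope.

Let tR_gt0 : (0 : R) < t%:R. Proof. by rewrite ltr0n. Qed.
Let tR_ge1 : (1 : R) <= t%:R. Proof. by rewrite ler1n. Qed.
Let l_gt0 : 0 < l. Proof. exact: exprn_gt0. Qed.
Let n_gt0 : 0 < n. Proof. exact: exprn_gt0. Qed.
Let K_gt0 : 0 < K. Proof. exact: lt_le_trans ltr01 K1. Qed.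
Let b_gt0 : 0 < b. Proof. exact: lt_le_trans ltr01 b1. Qed.

Let good2 (A : {set V}) := (0 < #|inner F A|)%N.
Let good3 S (A : {set V}) := (1 < #|inner S A|)%N.
(** The exponent of K / l is one less than the number of edges guaranteed by [linked_triple_edges]
    for copies glued along [A2] and [A3]. *)
Let wt S (A2 A3 : {set V}) : R :=
  (K / l) ^+ (e - 1 + (e - #|inner F A2|) + (#|S| - #|inner S A3|)
              + (tight F A2 && tight S A3)) * (b / l) ^+ (e - #|S|).

(** All exponents of [t] are integers, so a strict inequality in [balanced_inner] saves a whole
    factor [t]. *)
Let expand S (A : {set V}) : S \subset F -> (0 < #|inner S A|)%N ->
  n ^+ (v - #|A|) * l ^- (e - #|inner S A|) <= t%:R ^- (~~ tight S A).
Proof.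
move=> sSF i; have [le eqv] := balanced_inner sF cF gt2V leVF bF sSF i.
rewrite -/e -/v in le eqv; rewrite /n /l -!exprM ler_pdivrMr ?exprn_gt0 //.
rewrite mulrC ler_pdivlMr ?exprn_gt0 // -exprD.
rewrite ler_weXn2l //; rewrite /tight -/e -/v.
by case: eqP => /= E; [rewrite addn0 | rewrite addn1 ltn_neqAle le andbT; apply/eqP].
Qed.

(** Every pattern loses a factor [t] against n^2: a gluing that is not tight loses it by [expand],
    and if both are tight the additional edge contributes 1 / l <= 1 / t. *)
Let pattern_weight S A2 A3 : S \subset F -> good2 A2 -> good3 S A3 ->
  n ^+ v * n ^+ (v - #|A2|) * n ^+ (v - #|A3|) * wt S A2 A3
  <= K ^+ (3 * e) * b ^+ e * n ^+ 2 / t%:R.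
Proof.
move=> sSF g2 g3; set d := tight F A2 && tight S A3.
have h2 := expand (subxx F) g2; have h3 := expand sSF (ltnW g3).
have leSe : (#|S| <= e)%N by apply: subset_leq_card.
have leiS : (#|inner S A3| <= #|S|)%N.
  by apply: subset_leq_card; apply/subsetP => g; rewrite inE => /andP[].
have nl : n ^+ v = n ^+ 2 * l ^+ (e - 1).
  rewrite /n /l -exprM -exprM -exprM -exprD; congr (_ ^+ _).
  by rewrite (mulnC (v - 2)%N) -mulnDr subnKC // ltnW.
have -> : n ^+ v * n ^+ (v - #|A2|) * n ^+ (v - #|A3|) * wt S A2 A3 =
   n ^+ 2 * (K ^+ (e - 1 + (e - #|inner F A2|) + (#|S| - #|inner S A3|) + d)
   * b ^+ (e - #|S|)) * ((n ^+ (v - #|A2|) * l ^- (e - #|inner F A2|)) *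
   (n ^+ (v - #|A3|) * l ^- (e - #|inner S A3|)) * l ^- d).
  rewrite nl /wt -/d !expr_div_n.
  have -> : (e - #|inner S A3| = e - #|S| + (#|S| - #|inner S A3|))%N.
    by rewrite addnBA // subnK.
  rewrite !(exprD l).
  have nz i : l ^+ i != 0 by rewrite expf_neq0 ?gt_eqF.
  move: (nz (e - 1)%N) (nz (e - #|inner F A2|)%N) (nz (#|S| - #|inner S A3|)%N).
  move: (nz d) (nz (e - #|S|)%N); exact: regroup_powers.
rewrite [leRHS]mulrAC [leRHS]mulrC.
rewrite -mulrA ler_pM2l ?exprn_gt0 //; apply: ler_pM.
- by rewrite mulr_ge0 // exprn_ge0 // ltW.
- by rewrite !mulr_ge0 // ?invr_ge0 exprn_ge0 // ltW.
- apply: ler_pM; rewrite ?exprn_ge0 ?(ltW K_gt0) ?(ltW b_gt0) //.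
    rewrite ler_weXn2l //.
    have e1 : (0 < e)%N by apply: leq_trans leVF; apply: ltnW; apply: ltnW.
    exact: sum3_leq.
  by rewrite ler_weXn2l // leq_subr.
have lt : (t%:R : R) <= l by rewrite /l -{1}(expr1 t%:R) ler_weXn2l // subn_gt0.
have pos (A : {set V}) i : 0 <= n ^+ (v - #|A|) * l ^- i.
  by rewrite mulr_ge0 ?invr_ge0 ?exprn_ge0 // ltW.
apply: le_trans (_ : t%:R ^- (~~ tight F A2) * t%:R ^- (~~ tight S A3) * l ^- d <= _).
  rewrite ler_pM2r ?invr_gt0 ?exprn_gt0 //; exact: ler_pM.
have it : (t%:R : R)^-1 <= 1 by rewrite invf_le1.
have it0 : 0 <= (t%:R : R)^-1 by rewrite invr_ge0 ltW.
rewrite /d; case: (tight F A2); case: (tight S A3) => /=;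
  rewrite ?expr0 ?expr1 ?invr1 ?mulr1 ?mul1r //.
  by rewrite lef_pV2.
by rewrite -[leRHS]mulr1 ler_pM.
Qed.

Let triples S : R := \sum_(f1 : {ffun V -> T}) \sum_(f2 : {ffun V -> T})
  \sum_(f3 : {ffun V -> T}) \sum_(u : {set T}) \sum_(w : {set T})
   (linked_triple S f1 f2 f3 u w)%:R *
   ((b / l) ^+ (e - #|S|) * (K / l) ^+ (#|triple_edges S f1 f2 f3| - 1)).

Let pat S f1 f2 f3 : R := \sum_(A2 : {set V} | good2 A2) \sum_(A3 | good3 S A3)
  (f2 @: A2 \subset f1 @: setT)%:R *
  (f3 @: A3 \subset f1 @: setT :|: f2 @: setT)%:R * wt S A2 A3.

Let wt_ge0 S A2 A3 : 0 <= wt S A2 A3.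
Proof. by rewrite mulr_ge0 ?exprn_ge0 ?divr_ge0 // ltW. Qed.

Let pat_ge0 S f1 f2 f3 : 0 <= pat S f1 f2 f3.
Proof. by do 2!(apply: sumr_ge0 => ? _); rewrite mulr_ge0 ?wt_ge0 ?mulr_ge0. Qed.

Let le_pat S f1 f2 f3 u w : S \subset F -> linked_triple S f1 f2 f3 u w ->
  (b / l) ^+ (e - #|S|) * (K / l) ^+ (#|triple_edges S f1 f2 f3| - 1) <= pat S f1 f2 f3.
Proof.
move=> sSF lk; have [i2 i3 le] := linked_triple_edges sSF lk.
rewrite /pat (bigD1 _ i2) /= (bigD1 _ i3) /= -addrA ler_wpDr //.
  rewrite addr_ge0 ?sumr_ge0 // => A ?; first by rewrite mulr_ge0 ?wt_ge0 ?mulr_ge0.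
  by apply: sumr_ge0 => ? _; rewrite mulr_ge0 ?wt_ge0 ?mulr_ge0.
have sub f (W : {set T}) : f @: (f @^-1: W) \subset W.
  by apply/subsetP => _ /imsetP[x xW ->]; rewrite inE in xW.
rewrite !sub !mul1r mulrC ler_pM2r ?exprn_gt0 ?divr_gt0 //.
rewrite ler_wiXn2l ?divr_ge0 ?(ltW K_gt0) ?(ltW l_gt0) ?ler_pdivrMr ?mul1r //.
by apply: pred_sum_leq le; apply: leq_trans leVF; apply: ltnW; apply: ltnW.
Qed.

Let sum_maps (A : {set V}) (W : {set T}) m : (#|W| <= m)%N ->
  \sum_(f : {ffun V -> T}) (f @: A \subset W)%:R <= m.+1%:R ^+ v * n ^+ (v - #|A|) :> R.
Proof.
move=> leW.
have -> : \sum_(f : {ffun V -> T}) (f @: A \subset W)%:R =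
    #|[set f : {ffun V -> T} | f @: A \subset W]|%:R :> R.
  by rewrite -sum1dep_card natr_sum [RHS]big_mkcond; apply: eq_bigr => f _; case: ifP.
rewrite card_maps_into.
rewrite cT natrM !natrX ler_pM ?exprn_ge0 //.
(* A base of at least one, even for m = 0, allows the exponent |A| to be raised to v. *)
apply: le_trans (_ : m.+1%:R ^+ #|A| <= _).
  by apply: lerXn2r; rewrite ?nnegrE ?ler_nat // leqW.
by rewrite ler_weXn2l ?ler1n // max_card.
Qed.

(** The two marked edges lie in [f1] and [f2], which leaves e^2 choices. The triples are sorted by
    the sets [A2] and [A3] along which they are glued, at most 2^v choices each; the powers of v.+1
    and (2 * v).+1 count the maps of [A2] into one image and of [A3] into the union of two. *)
Lemma sum_linked_triples S : S \subset F ->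
  triples S <= (e ^ 2 * (2 ^ v * (2 ^ v * (v.+1 ^ v * (2 * v).+1 ^ v))))%:R
     * (K ^+ (3 * e) * b ^+ e * n ^+ 2 / t%:R).
Proof.
move=> sSF; rewrite natrM -mulrA.
pose P : R := \sum_(f1 : {ffun V -> T}) \sum_(f2 : {ffun V -> T})
  \sum_(f3 : {ffun V -> T}) pat S f1 f2 f3.
apply: (@le_trans _ _ ((e ^ 2)%:R * P)).
  rewrite mulr_sumr; apply: ler_sum => f1 _.
  rewrite mulr_sumr; apply: ler_sum => f2 _.
  rewrite mulr_sumr; apply: ler_sum => f3 _.
  have -> : (e ^ 2)%:R * pat S f1 f2 f3 = \sum_(g in F) \sum_(h in F) pat S f1 f2 f3.
    by rewrite !sumr_const -mulrnA mulr_natl mulnn.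
  have key f (X : {set T} -> R) (c : R) : 0 <= c ->
      (forall u, X u <= c) -> (forall u, u \notin edge_image f F -> X u <= 0) ->
      \sum_u X u <= \sum_(g in F) c.
    move=> c0 Xc X0; rewrite (bigID (mem (edge_image f F))) /= -[leRHS]addr0.
    apply: lerD; last by apply: sumr_le0 => u /X0.
    apply: le_trans (ler_sum _ (fun u _ => Xc u)) _.
    rewrite !sumr_const; apply: ler_wpMn2l => //.
    exact: leq_imset_card.
  apply: (key f1) => [|u|u uN].
  - by apply: sumr_ge0 => *; apply: pat_ge0.
  - apply: (key f2) => [|w|w wN]; first exact: pat_ge0.
      by case: (boolP (linked_triple _ _ _ _ _ _)) => [/(le_pat sSF)|_];
         rewrite ?mul1r ?mul0r ?pat_ge0.
    case: (boolP (linked_triple _ _ _ _ _ _)) => [|_]; last by rewrite mul0r.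
    by case/and4P => _ _ /and3P[_ w2 _]; rewrite w2 in wN.
  - apply: sumr_le0 => w _.
    case: (boolP (linked_triple _ _ _ _ _ _)) => [|_]; last by rewrite mul0r.
    by case/and4P => _ /and3P[u1 _ _]; rewrite u1 in uN.
rewrite ler_wpM2l //; set c := _ / t%:R; set d := (v.+1 ^ v * _)%N.
have -> : P = \sum_(A2 | good2 A2) \sum_(A3 | good3 S A3) (\sum_(f1 : {ffun V -> T})
   \sum_(f2 : {ffun V -> T}) (f2 @: A2 \subset f1 @: setT)%:R *
   \sum_(f3 : {ffun V -> T}) (f3 @: A3 \subset f1 @: setT :|: f2 @: setT)%:R) * wt S A2 A3.
  rewrite /P /pat.
  under eq_bigr => f1 _ do under eq_bigr => f2 _ do rewrite exchange_big.
  under eq_bigr => f1 _ do rewrite exchange_big.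
  rewrite exchange_big; apply: eq_bigr => A2 _.
  under eq_bigr => f1 _ do under eq_bigr => f2 _ do rewrite exchange_big.
  under eq_bigr => f1 _ do rewrite exchange_big.
  rewrite exchange_big; apply: eq_bigr => A3 _.
  rewrite mulr_suml; apply: eq_bigr => f1 _.
  rewrite mulr_suml; apply: eq_bigr => f2 _.
  by rewrite mulr_sumr mulr_suml.
have cimg f : (#|f @: [set: V]| <= v)%N by rewrite (leq_trans (leq_imset_card _ _)) ?cardsT.
have c_ge0 : 0 <= c.
  by rewrite /c !mulr_ge0 ?invr_ge0 ?exprn_ge0 // ltW.
apply: (@le_trans _ _ (\sum_(A2 : {set V}) \sum_(A3 : {set V}) d%:R * c)); last first.
  have cs : #|{: {set V}}| = (2 ^ v)%N by rewrite -cardsT -powersetT card_powerset cardsT.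
  by rewrite !sumr_const cs -mulrnA -[leLHS]mulr_natl [leLHS]mulrA -natrM -mulnA.
have dc0 : 0 <= d%:R * c by rewrite mulr_ge0.
rewrite big_mkcond; apply: ler_sum => A2 _; case: ifP => g2; last exact: sumr_ge0.
rewrite big_mkcond; apply: ler_sum => A3 _; case: ifP => g3 //.
have le3 f1 f2 : \sum_(f3 : {ffun V -> T}) (f3 @: A3 \subset f1 @: setT :|: f2 @: setT)%:R
    <= (2 * v).+1%:R ^+ v * n ^+ (v - #|A3|).
  apply: sum_maps; rewrite mul2n -addnn (leq_trans (leq_card_setU _ _)) //.
  by rewrite leq_add ?cimg.
have x3_ge0 : 0 <= (2 * v).+1%:R ^+ v * n ^+ (v - #|A3|).
  by rewrite mulr_ge0 // exprn_ge0 // ltW.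
have le2 f1 : \sum_(f2 : {ffun V -> T}) (f2 @: A2 \subset f1 @: setT)%:R *
   (\sum_(f3 : {ffun V -> T}) (f3 @: A3 \subset f1 @: setT :|: f2 @: setT)%:R)
    <= v.+1%:R ^+ v * n ^+ (v - #|A2|) * ((2 * v).+1%:R ^+ v * n ^+ (v - #|A3|)).
  apply: (@le_trans _ _ (\sum_(f2 : {ffun V -> T}) (f2 @: A2 \subset f1 @: setT)%:R *
     ((2 * v).+1%:R ^+ v * n ^+ (v - #|A3|)))).
    by apply: ler_sum => f2 _; rewrite ler_wpM2l.
  by rewrite -mulr_suml ler_wpM2r // sum_maps.
apply: (@le_trans _ _ (n ^+ v * (v.+1%:R ^+ v * n ^+ (v - #|A2|) *
    ((2 * v).+1%:R ^+ v * n ^+ (v - #|A3|))) * wt S A2 A3)).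
  rewrite ler_wpM2r //; apply: le_trans (ler_sum _ (fun f1 _ => le2 f1)) _.
  by rewrite sumr_const -[leLHS]mulr_natl card_ffun cT !natrX.
have -> : n ^+ v * (v.+1%:R ^+ v * n ^+ (v - #|A2|) *
    ((2 * v).+1%:R ^+ v * n ^+ (v - #|A3|))) * wt S A2 A3 =
  d%:R * (n ^+ v * n ^+ (v - #|A2|) * n ^+ (v - #|A3|) * wt S A2 A3).
  rewrite /d natrM !natrX; exact: regroup_counts.
by rewrite ler_wpM2l // pattern_weight.
Qed.

End CopyTriples.

Local Open Scope ring_scope.

Lemma sum_prod_subsets (R : comNzRingType) (U : finType) (E : {set U}) (z : U -> R) :
  \sum_(B : {set U} | B \subset E) \prod_(s in B) z s = \prod_(s in E) (1 + z s).
Proof.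
rewrite [RHS]big_mkcond /=.
rewrite [RHS](eq_bigr (fun s => (if s \in E then z s else 0) + 1)); last first.
  by move=> s _; case: (s \in E); rewrite ?add0r // addrC.
rewrite bigA_distr [RHS](bigID (fun B : {set U} => B \subset E)) /= [X in _ + X]big1 ?addr0.
  apply: eq_bigr => B sB; rewrite -big_mkcond; apply: eq_bigr => s sB'.
  by rewrite (subsetP sB).
by move=> B /subsetPn[s sB sE]; rewrite (bigD1 s) //= sB (negbTE sE) mul0r.
Qed.

Lemma sum_prod_subsets_le (R : realType) (U : finType) (E : {set U}) (z : U -> R) :
    (forall s, s \in E -> 0 <= z s) ->
  \sum_(B : {set U} | B \subset E) \prod_(s in B) z s <= expR (\sum_(s in E) z s).
Proof.
move=> z0; rewrite sum_prod_subsets expR_sum; apply: ler_prod => s sE.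
by rewrite expR_ge1Dx addr_ge0 ?z0.
Qed.

Fact leq_sqr_bin (m : nat) : (1 < m -> m ^ 2 <= 'C(m, 2) * 4)%N.
Proof.
case: m => [|[|m]] // _; have := bin_ffact m.+2 2.
rewrite ffactnS ffactn1 /= -[2`!]/2%N => E.
have -> : ('C(m.+2, 2) * 4 = m.+2 * m.+1 * 2)%N by rewrite -E; lia.
by rewrite -mulnn -mulnA leq_mul2l /=; lia.
Qed.

(** * The Gibbs measure on F-free graphs *)

Section GibbsMeasure.
Variables (R : realType) (V T : finType) (F : {set {set V}}).
Hypotheses (sF : simple_graph F) (cF : cover F = [set: V]) (gt2V : (2 < #|V|)%N)
  (leVF : (#|V| <= #|F|)%N) (bF : strictly_balanced F).
Variables (C kappa b : R) (t : nat).
Let e := #|F|.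
Let v := #|V|.
Let K : R := expR kappa.
Let n : R := t%:R ^+ (e - 1).
Let l : R := t%:R ^+ (v - 2).
Let A : R := n ^+ 2 / l.
Let lam : R := K / l.
Hypotheses (C1 : 1 <= C) (kappa0 : 0 <= kappa) (b1 : 1 <= b) (t_gt0 : (0 < t)%N)
  (Kl : K <= l) (cT : #|T| = (t ^ (e - 1))%N).

Implicit Types (f : {ffun V -> T}) (S : {set {set V}}) (I J : {set {set T}}) (u s : {set T}).

Definition pairs_of : {set {set T}} := [set u : {set T} | #|u| == 2].
Local Notation EE := pairs_of.

Definition ncopies S I : R := \sum_(f : {ffun V -> T} | injectiveb f)
  (edge_image f S \subset I)%:R.

Definition subgraph_index S : bool := [&& S \subset F, S != set0 & S != F].

(** A copy of [S] is charged b / l for each edge that [S] lacks, as if it were to be completed to a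
    copy of [F] by random edges of density b / l. *)
Definition energy I : R :=
  \sum_(S | subgraph_index S) (b / l) ^+ (e - #|S|) * ncopies S I.

Definition legal I : bool := (I \subset EE) && copy_free F I.

Definition weight I : R := lam ^+ #|I| * expR (- energy I).

Definition partition_fun : R := \sum_(I | legal I) weight I.
Local Notation Z := partition_fun.

Definition cost u I : R := energy (u |: I) - energy I.

Let tR_gt0 : (0 : R) < t%:R. Proof. by rewrite ltr0n. Qed.
Let l_gt0 : 0 < l. Proof. exact: exprn_gt0. Qed.
Let n_gt0 : 0 < n. Proof. exact: exprn_gt0. Qed.
Let K_gt0 : 0 < K. Proof. exact: expR_gt0. Qed.
Let b_gt0 : 0 < b. Proof. exact: lt_le_trans ltr01 b1. Qed.
Let K1 : 1 <= K. Proof. by rewrite -expR0 ler_expR. Qed.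
Let lam_gt0 : 0 < lam. Proof. exact: divr_gt0. Qed.
Let lam_le1 : lam <= 1. Proof. by rewrite ler_pdivrMr // mul1r. Qed.
Let q_gt0 S : 0 < (b / l) ^+ (e - #|S|). Proof. by rewrite exprn_gt0 // divr_gt0. Qed.
Let e_gt2 : (2 < e)%N. Proof. exact: leq_trans leVF. Qed.

Lemma ncopies_ge0 S I : 0 <= ncopies S I.
Proof. by apply: sumr_ge0. Qed.

Lemma ncopiesS S I J : I \subset J -> ncopies S I <= ncopies S J.
Proof.
move=> sIJ; apply: ler_sum => f _; rewrite ler_nat.
by case: (boolP (_ \subset I)) => // sfI; rewrite (subset_trans sfI sIJ).
Qed.

Lemma energy_ge0 I : 0 <= energy I.
Proof. by apply: sumr_ge0 => S _; rewrite mulr_ge0 ?ncopies_ge0 // ltW. Qed.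

Lemma energyS I J : I \subset J -> energy I <= energy J.
Proof. by move=> sIJ; apply: ler_sum => S _; rewrite ler_pM2l // ncopiesS. Qed.

Lemma cost_ge0 u I : 0 <= cost u I.
Proof. by rewrite subr_ge0 energyS // subsetUr. Qed.

Lemma weight_gt0 I : 0 < weight I.
Proof. by rewrite mulr_gt0 ?exprn_gt0 ?expR_gt0. Qed.

Lemma legalS I J : I \subset J -> legal J -> legal I.
Proof.
by move=> sIJ /andP[sJ fJ]; rewrite /legal (subset_trans sIJ) // (copy_freeS sIJ).
Qed.

Lemma small_copy_free I : (#|I| < e)%N -> copy_free F I.
Proof.
rewrite ltnNge; apply: contraNT => /copy_freePn[f fI sf].
by rewrite /e -(card_edge_image F fI) subset_leq_card.
Qed.

Lemma energy0 : energy set0 = 0.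
Proof.
apply: big1 => S /and3P[_ S0 _]; rewrite /ncopies big1 ?mulr0 // => f fI.
by rewrite subset0 imset_eq0 (negbTE S0).
Qed.

Lemma partition_fun_ge1 : 1 <= Z.
Proof.
have l0 : legal set0 by rewrite /legal sub0set small_copy_free // cards0; apply: ltnW (ltnW _).
rewrite /partition_fun (bigD1 _ l0) /= -[leLHS]addr0 lerD ?sumr_ge0 //.
  by rewrite /weight cards0 expr0 energy0 oppr0 expR0 mulr1.
by move=> I _; apply/ltW/weight_gt0.
Qed.

Let nE : n = #|T|%:R. Proof. by rewrite /n cT natrX. Qed.
Let Z_gt0 : 0 < Z. Proof. exact: lt_le_trans ltr01 partition_fun_ge1. Qed.

(* Every edge has conditional probability at most [lam]. *)
Lemma weight_superset (D : {set {set T}}) :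
  \sum_(I | legal I && (D \subset I)) weight I <= lam ^+ #|D| * Z.
Proof.
rewrite (reindex_onto (fun I => D :|: I) (fun I => I :\: D)); last first.
  by move=> I /andP[_ sD]; rewrite -{1}(setIidPr sD) setID.
rewrite /partition_fun mulr_sumr [leRHS](bigID (fun I => [disjoint D & I])) /=.
rewrite -[leLHS]addr0 lerD ?sumr_ge0 //; last first.
  by move=> I _; rewrite mulr_ge0 ?exprn_ge0 ?(ltW (weight_gt0 _)) // ltW.
rewrite big_mkcond [leRHS]big_mkcond; apply: ler_sum => I _.
case: ifP => [/andP[/andP[lDI _] /eqP DI]|_]; last first.
  by case: ifP => // _; rewrite mulr_ge0 ?exprn_ge0 ?(ltW (weight_gt0 _)) // ltW.
have dD : [disjoint D & I].
  by rewrite disjoint_sym -DI -setI_eq0 setDE -setIA [~: D :&: D]setIC setICr setI0.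
rewrite dD (legalS (subsetUr D I) lDI) /= /weight mulrA -exprD.
have -> : #|D :|: I| = (#|D| + #|I|)%N.
  by apply/eqP; rewrite (leq_card_setU D I).
rewrite ler_pM2l ?exprn_gt0 // ler_expR lerN2 energyS //; exact: subsetUr.
Qed.

Lemma weightU1 u I : u \notin I -> weight (u |: I) = lam * expR (- cost u I) * weight I.
Proof.
move=> uI; rewrite /weight cardsU1 uI exprS.
have -> : expR (- energy (u |: I)) = expR (- cost u I) * expR (- energy I).
  by rewrite -expRD /cost opprB addrAC subrr sub0r.
by rewrite mulrACA.
Qed.

(* Gibbs property: resampling the edge [u] given the rest. *)
Lemma resample (h : {set {set T}} -> {set T} -> R) :
  \sum_(I | legal I) \sum_(u in I) weight I * h I u =
  \sum_(u : {set T}) \sum_(I : {set {set T}} | (u \notin I) && legal (u |: I))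
     lam * expR (- cost u I) * weight I * h (u |: I) u.
Proof.
under eq_bigr do rewrite big_mkcond.
rewrite exchange_big; apply: eq_bigr => u _; rewrite -big_mkcondr.
rewrite (reindex_onto (fun I => u |: I) (fun I => I :\ u)) /=; last first.
  by move=> I /andP[_ uI]; rewrite setD1K.
apply: eq_big => [I|I /andP[/andP[lI _] /eqP E]].
  rewrite setU11 andbT andbC; congr (_ && _).
  by apply/eqP/idP => [<-|/setU1K//]; rewrite !inE eqxx.
by rewrite weightU1 // -E !inE eqxx.
Qed.

Hypothesis small : forall I, legal I -> #|I|%:R <= C * A.

Let Lam : R := 2 * (C * kappa + 1).

(** By [small], K^|I| is at most exp (kappa C A); the factors l^-|I|, summed over all graphs, give
    at most exp (|EE| / l) <= exp A; and the energy in [weight] still outweighs the tilt by energy /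
    2. *)
Let sum_tilted : \sum_(I | legal I) weight I * expR (energy I / 2) <= expR (A * (C * kappa + 1)).
Proof.
have EEl : #|EE|%:R / l <= A.
  rewrite ler_pM2r ?invr_gt0 // /pairs_of card_draws nE -natrX ler_nat bin2 -mulnn.
  rewrite leq_half_double leqW // (leq_trans (leq_mul (leqnn _) (leq_pred _))) //.
  by rewrite -addnn leq_addr.
apply: (@le_trans _ _ (\sum_(I : {set {set T}} | I \subset EE) expR (kappa * (C * A)) * l^-1 ^+ #|I|)).
  rewrite big_mkcond [leRHS]big_mkcond; apply: ler_sum => I _.
  case: ifP => [lI|_]; last by case: ifP => // _; rewrite mulr_ge0 ?expR_ge0 ?exprn_ge0 ?invr_ge0 ?ltW.
  have [sI _] := andP lI; rewrite sI /weight expr_div_n -exprVn.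
  have reorder (a c x y : R) : a * c * x * y = a * (x * y * c) by ring.
  rewrite reorder.
  apply: ler_pM; rewrite ?mulr_ge0 ?exprn_ge0 ?expR_ge0 ?invr_ge0 ?(ltW K_gt0) ?(ltW l_gt0) //.
    by rewrite /K -expRM_natl ler_expR mulrC ler_wpM2l ?small //.
  rewrite -expRD ler_piMl ?exprn_ge0 ?invr_ge0 ?(ltW l_gt0) // expR_le1.
  have := energy_ge0 I; lra.
rewrite -mulr_sumr.
have -> : \sum_(I : {set {set T}} | I \subset EE) l^-1 ^+ #|I| = (1 + l^-1) ^+ #|EE|.
  by rewrite -prodr_const -sum_prod_subsets; apply: eq_bigr => I _; rewrite prodr_const.
rewrite mulrDr mulr1 expRD; apply: ler_pM; rewrite ?expR_ge0 ?exprn_ge0 //.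
- by rewrite addr_ge0 ?ler01 ?invr_ge0 ?ltW.
- by rewrite ler_expR mulrA mulrC (mulrC kappa).
apply: (@le_trans _ _ (expR l^-1 ^+ #|EE|)).
  by rewrite lerXn2r ?nnegrE ?expR_ge0 ?expR_ge1Dx // addr_ge0 ?ler01 ?invr_ge0 ?ltW.
by rewrite -expRM_natl ler_expR.
Qed.

(** The inequality 1 + x <= exp x at x = energy I / 2 - c turns the exponential moment into a mean,
    the leftover constant being absorbed by Z >= 1. It matters that [Lam] is linear in [kappa],
    hence logarithmic in [K]. *)
Lemma mean_energy : \sum_(I | legal I) weight I * energy I <= Lam * A * Z.
Proof.
set c := A * (C * kappa + 1).
apply: (@le_trans _ _ (\sum_(I | legal I) (2 * (c - 1) * weight I +
    2 * expR (- c) * (weight I * expR (energy I / 2))))).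
  apply: ler_sum => I _; have := expR_ge1Dx (energy I / 2 - c).
  rewrite expRD; have := weight_gt0 I; move: (energy I) (weight I) (expR (- c)) (expR (energy I / 2)).
  move=> E w x y w0 h; have : w * (1 + (E / 2 - c)) <= w * (y * x) by rewrite ler_pM2l.
  lra.
rewrite big_split /= -!mulr_sumr -/Z.
have h : 2 * expR (- c) * (\sum_(I | legal I) weight I * expR (energy I / 2)) <= 2.
  rewrite -mulrA ger_pMr // -[leRHS](expRxMexpNx_1 c) mulrC ler_pM2r ?expR_gt0 //.
have -> : Lam * A = 2 * c by rewrite /Lam /c -mulrA (mulrC A).
move: partition_fun_ge1 h; move: (2 * expR _ * _) => x; move: Z c => z c; lra.
Qed.

Lemma mean_ncopies S : subgraph_index S ->
  \sum_(I | legal I) weight I * ncopies S I <= Lam * A * (l / b) ^+ (e - #|S|) * Z.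
Proof.
move=> iS; rewrite mulrAC -[(l / b) ^+ _]invrK -exprVn invf_div ler_pdivlMr // mulrC mulr_sumr.
apply: le_trans mean_energy; apply: ler_sum => I _.
rewrite mulrCA ler_pM2l ?weight_gt0 // /energy (bigD1 S) //= lerDl sumr_ge0 // => S' _.
by rewrite mulr_ge0 ?ncopies_ge0 // ltW.
Qed.

(** A copy of [S] created by [u] contains [u] as the image of some edge [g], and its other edges
    already form a copy of [S :\ g] in [I]. *)
Lemma ncopiesU1 S I : \sum_(u : {set T}) (ncopies S (u |: I) - ncopies S I)
  <= \sum_(g in S) ncopies (S :\ g) I.
Proof.
rewrite [leRHS]exchange_big /=; under eq_bigr do rewrite -sumrB.
rewrite [leLHS]exchange_big /=; apply: ler_sum => f /injectiveP fI.
rewrite (bigID (mem (edge_image f S))) /= -[leRHS]addr0; apply: lerD.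
  rewrite big_imset /=; last by move=> g h _ _; apply: imset_inj.
  apply: ler_sum => g gS.
  case: (boolP (_ \subset f @: g |: I)) => [sub|_]; last first.
    by rewrite sub0r; apply: le_trans (_ : 0 <= _); rewrite ?oppr_le0.
  have -> : edge_image f (S :\ g) \subset I.
    apply/subsetP => _ /imsetP[h /setD1P[hg hS] ->].
    have := subsetP sub _ (imset_f _ hS); rewrite !inE => /orP[/eqP/imset_inj|//].
    by move=> /(_ fI) E; rewrite E eqxx in hg.
  by rewrite gerBl.
apply: sumr_le0 => u uS; rewrite subr_le0 ler_nat.
case: (boolP (_ \subset u |: I)) => // sub.
suff -> : edge_image f S \subset I by [].
apply/subsetP => h hS; have := subsetP sub _ hS; rewrite !inE => /orP[/eqP E|//].
by rewrite -E hS in uS.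
Qed.

Let nlv : n ^+ v = n ^+ 2 * l ^+ (e - 1).
Proof.
rewrite /n /l -!exprM -exprD; congr (_ ^+ _).
by rewrite (mulnC (v - 2)%N) -mulnDr subnKC // ltnW.
Qed.

Let Al : A * l = n ^+ 2. Proof. by rewrite divfK // gt_eqF. Qed.

Let cancel_powers i : (b / l) ^+ i * (l / b) ^+ i.+1 = l / b.
Proof.
by rewrite exprS mulrCA -exprMn mulrA divfK ?divff ?expr1n ?mulr1 // gt_eqF.
Qed.

Lemma ncopies_le S I : ncopies S I <= n ^+ v.
Proof.
apply: (@le_trans _ _ (\sum_(f : {ffun V -> T}) 1)).
  by rewrite /ncopies big_mkcond; apply: ler_sum => f _; case: ifP => // _; case: (_ \subset _).
by rewrite sumr_const card_ffun natrX nE.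
Qed.

Let Lam_ge0 : 0 <= Lam. Proof. by rewrite /Lam mulr_ge0 // addr_ge0 // mulr_ge0 // (le_trans _ C1). Qed.

(** Deleting [g] costs one more factor l / b in [mean_ncopies], and A l = n^2 leaves the term with
    Lam / b. If [S] is a single edge, nothing remains to be penalised and the trivial count n^v =
    n^2 l^(e-1) gives the term with b^(e-1). *)
Lemma mean_ncopies_del S g : subgraph_index S -> g \in S ->
  (b / l) ^+ (e - #|S|) * (\sum_(I | legal I) weight I * ncopies (S :\ g) I)
  <= (Lam / b + b ^+ (e - 1)) * n ^+ 2 * Z.
Proof.
move=> iS gS; have /and3P[sSF S0 SF] := iS.
have ltSe : (#|S| < e)%N by rewrite proper_card // properEneq SF.
have cS : #|S| = #|S :\ g|.+1 by rewrite (cardsD1 g S) gS.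
have [S1|S1] := eqVneq (S :\ g) set0.
  have -> : #|S| = 1%N by rewrite cS S1 cards0.
  apply: (@le_trans _ _ ((b / l) ^+ (e - 1) * (n ^+ v * Z))).
    rewrite ler_pM2l ?exprn_gt0 ?divr_gt0 // /partition_fun mulr_sumr.
    by apply: ler_sum => I _; rewrite mulrC ler_pM2r ?weight_gt0 // ncopies_le.
  rewrite nlv expr_div_n.
  have -> : b ^+ (e - 1) / l ^+ (e - 1) * (n ^+ 2 * l ^+ (e - 1) * Z) = b ^+ (e - 1) * n ^+ 2 * Z.
    have H (x y z w : R) : y != 0 -> x / y * (z * y * w) = x * z * w by move=> *; field.
    by apply: H; rewrite expf_neq0 // gt_eqF.
  rewrite ler_pM2r // ler_pM2r ?exprn_gt0 // lerDr.
  by rewrite divr_ge0 // ltW.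
have iSg : subgraph_index (S :\ g).
  apply/and3P; split=> //; first by apply: subset_trans sSF; apply: subsetDl.
  by apply: contraTneq ltSe => E; rewrite -leqNgt /e -E cS leqnSn.
apply: (@le_trans _ _ ((b / l) ^+ (e - #|S|) * (Lam * A * (l / b) ^+ (e - #|S :\ g|) * Z))).
  by rewrite ler_pM2l // mean_ncopies.
have -> : (e - #|S :\ g| = (e - #|S|).+1)%N by rewrite cS subnSK // -cS ltnW.
have H (x y z w : R) : x * (y * z * w) = y * (x * z) * w by ring.
rewrite H cancel_powers ler_pM2r // -mulrA mulrA.
have H2 (x y z : R) : x * y * (z / b) = x / b * (y * z) by ring.
by rewrite -mulrA [A * _]mulrA Al [n ^+ 2 / b]mulrC mulrA ler_pM2r ?exprn_gt0 // lerDl exprn_ge0 // ltW.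
Qed.

Lemma mean_cost : \sum_(I | legal I) weight I * (\sum_(u : {set T}) cost u I)
  <= (2 ^ e * e)%:R * ((Lam / b + b ^+ (e - 1)) * n ^+ 2 * Z).
Proof.
set c := _ * Z.
apply: (@le_trans _ _ (\sum_(I | legal I) weight I * (\sum_(S | subgraph_index S)
    (b / l) ^+ (e - #|S|) * (\sum_(g in S) ncopies (S :\ g) I)))).
  apply: ler_sum => I _; rewrite ler_pM2l ?weight_gt0 // /cost.
  under eq_bigr do rewrite /energy -sumrB.
  rewrite exchange_big; apply: ler_sum => S _.
  under eq_bigr do rewrite -mulrBr.
  by rewrite -mulr_sumr ler_pM2l // ncopiesU1.
apply: (@le_trans _ _ (\sum_(S | subgraph_index S) \sum_(g in S)
    (b / l) ^+ (e - #|S|) * (\sum_(I | legal I) weight I * ncopies (S :\ g) I))).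
  under eq_bigr do rewrite mulr_sumr.
  rewrite exchange_big le_eqVlt; apply/orP; left; apply/eqP; apply: eq_bigr => S _.
  under eq_bigr do rewrite mulrCA mulr_sumr.
  by rewrite -[LHS]mulr_sumr -[RHS]mulr_sumr [in RHS]exchange_big.
have c_ge0 : 0 <= c.
  rewrite /c !mulr_ge0 ?exprn_ge0 ?(ltW n_gt0) ?(ltW Z_gt0) // addr_ge0 //.
    by rewrite divr_ge0 // ltW.
  by rewrite exprn_ge0 // ltW.
apply: (@le_trans _ _ (\sum_(S : {set {set V}} | S \subset F) c *+ e)).
  rewrite big_mkcond [leRHS]big_mkcond; apply: ler_sum => S _.
  case: ifP => [iS|_]; last by case: ifP => // _; rewrite mulrn_wge0.
  have [sSF _ _] := and3P iS; rewrite sSF.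
  apply: le_trans (ler_sum _ (fun g gS => mean_ncopies_del iS gS)) _.
  by rewrite sumr_const ler_wpMn2l // subset_leq_card.
rewrite sumr_const -mulrnA mulr_natl mulnC ler_wpMn2l // leq_mul2r.
by rewrite -card_powerset; apply/orP; right; apply: subset_leq_card; apply/subsetP => S; rewrite !inE.
Qed.

(** For [u] outside an F-free [J]: [s] is [u] or one of the edges of [J] taking part in blocking
    [u]. *)
Definition rooted u s J : bool := [exists f : {ffun V -> T}, [&& injectiveb f,
  u \in edge_image f F, s \in edge_image f F & edge_image f F \subset u |: J]].

Lemma sum_rooted J : \sum_(u | u \notin J) \sum_(s : {set T}) (rooted u s J)%:R
  <= e%:R * \sum_(g in F) ncopies (F :\ g) J.
Proof.
apply: (@le_trans _ _ (\sum_(f : {ffun V -> T} | injectiveb f)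
   \sum_(u | u \notin J) \sum_(s : {set T})
   [&& u \in edge_image f F, s \in edge_image f F & edge_image f F \subset u |: J]%:R)).
  rewrite [leRHS]exchange_big; apply: ler_sum => u _.
  rewrite [leRHS]exchange_big; apply: ler_sum => s _.
  case: (boolP (rooted u s J)) => [/existsP[f /andP[fI H]]|_]; last exact: sumr_ge0.
  by rewrite (bigD1 f) //= H lerDl sumr_ge0.
rewrite [X in _ <= _ * X]exchange_big mulr_sumr; apply: ler_sum => f /injectiveP fI.
rewrite mulr_sumr.
apply: (@le_trans _ _ (\sum_(u in edge_image f F) e%:R * ((u \notin J) && (edge_image f F \subset u |: J))%:R)).
  rewrite big_mkcond [leRHS]big_mkcond; apply: ler_sum => u _.
  case: ifP => uJ; last by case: ifP => // _; rewrite mulr_ge0.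
  case: ifP => uf; last by rewrite big1.
  case: (_ \subset _); last by rewrite big1 ?mulr_ge0 // => s _; rewrite !andbF.
  rewrite ?uJ /= ?mulr1 /e -(card_edge_image F fI) -sumr_const [leRHS]big_mkcond.
  by apply: ler_sum => s _; case: ifP.
rewrite big_imset /=; last by move=> g h _ _; apply: imset_inj.
apply: ler_sum => g gF; rewrite ler_wpM2l // ler_nat.
case: (boolP (_ && _)) => // /andP[gJ sub].
suff -> : edge_image f (F :\ g) \subset J by [].
apply/subsetP => _ /imsetP[h /setD1P[hg hS] ->].
have := subsetP sub _ (imset_f _ hS); rewrite !inE => /orP[/eqP/imset_inj|//].
by move=> /(_ fI) E; rewrite E eqxx in hg.
Qed.

(** What blocks [u] is a copy of some [F :\ g], a subgraph charged b / l by the energy; with A l =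
    n^2 this leaves Lam / b per pair. *)
Lemma mean_rooted : \sum_(I | legal I) weight I *
    (\sum_(u | u \notin I) \sum_(s : {set T}) (rooted u s I)%:R)
  <= (e * e)%:R * (Lam / b * n ^+ 2 * Z).
Proof.
apply: (@le_trans _ _ (e%:R * (\sum_(g in F) \sum_(I | legal I) weight I * ncopies (F :\ g) I))).
  rewrite [X in _ <= _ * X]exchange_big mulr_sumr; apply: ler_sum => I _.
  by rewrite -mulr_sumr mulrCA ler_pM2l ?weight_gt0 // sum_rooted.
rewrite natrM -mulrA ler_wpM2l // mulr_natl -/e /e -sumr_const; apply: ler_sum => g gF.
have cF' : #|F| = #|F :\ g|.+1 by rewrite (cardsD1 g F) gF.
apply: le_trans (mean_ncopies _) _.
  apply/and3P; split; first exact: subsetDl.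
    by rewrite -cards_eq0; move: e_gt2; rewrite /e cF'; case: #|_|.
  by apply/eqP => E; apply: (n_Sn #|F|); rewrite {1}cF' E.
have -> : (e - #|F :\ g| = 1)%N by rewrite /e cF' subSnn.
rewrite expr1 ler_pM2r //.
have H (x y z : R) : x * y * (z / b) = x / b * (y * z) by ring.
by rewrite H Al.
Qed.

Lemma cost_diff s I J : J \subset I -> s \notin I ->
  cost s I - cost s J = \sum_(S | subgraph_index S) (b / l) ^+ (e - #|S|) *
    \sum_(f : {ffun V -> T} | injectiveb f)
      [&& s \in edge_image f S, edge_image f S \subset s |: I
        & ~~ (edge_image f S \subset s |: J)]%:R.
Proof.
move=> sJI sI; rewrite /cost /energy -!sumrB; apply: eq_bigr => S _.
rewrite -!mulrBr; congr (_ * _); rewrite /ncopies -!sumrB; apply: eq_bigr => f _.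
set E := edge_image f S.
have sub1 (X : {set {set T}}) : s \notin E -> (E \subset s |: X) = (E \subset X).
  move=> sE; apply/idP/idP => [/subsetP sub|sub]; last first.
    by apply: subset_trans sub (subsetUr _ _).
  apply/subsetP => x xE; have := sub x xE; rewrite !inE => /orP[/eqP xs|//].
  by rewrite -xs xE in sE.
have sub2 (X : {set {set T}}) : s \in E -> s \notin X -> (E \subset X) = false.
  by move=> sE sX; apply/negP => /subsetP/(_ s sE); rewrite (negbTE sX).
have sJ : s \notin J by apply: contra sI; apply: (subsetP sJI).
case: (boolP (s \in E)) => sE /=.
  rewrite (sub2 I) // (sub2 J) // !subr0.
  case: (boolP (E \subset s |: J)) => [sub|_] /=; last by rewrite subr0 andbT.
  by rewrite (subset_trans sub (setUS _ sJI)) subrr.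
by rewrite !sub1 // !subrr.
Qed.

Lemma costS s I J : J \subset I -> s \notin I -> cost s J <= cost s I.
Proof.
move=> sJI sI; rewrite -subr_ge0 cost_diff //; apply: sumr_ge0 => S _.
by rewrite mulr_ge0 ?sumr_ge0 // ltW.
Qed.

(** A copy not contained in [J] is completed by at most one single edge of [I :\: J], so the
    separate increments of the energy never exceed the joint one. *)
Lemma sum_cost_le I J : J \subset I ->
  \sum_(s in I :\: J) cost s J <= energy I - energy J.
Proof.
move=> sJI; rewrite /cost /energy -sumrB; under eq_bigr do rewrite -sumrB.
rewrite exchange_big; apply: ler_sum => S _; rewrite -mulrBr.
under eq_bigr do rewrite -mulrBr.
rewrite -mulr_sumr ler_pM2l // /ncopies -sumrB.
under eq_bigr do rewrite -sumrB.
rewrite exchange_big; apply: ler_sum => f _; set E := edge_image f S.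
case: (boolP (E \subset J)) => [sEJ|EJ].
  rewrite (subset_trans sEJ sJI) subrr big1 // => s _.
  by rewrite (subset_trans sEJ (subsetUr _ _)) subrr.
under eq_bigr do rewrite subr0; rewrite subr0.
case: (boolP [exists s in I :\: J, E \subset s |: J]) => [/exists_inP[s sIJ sE]|]; last first.
  rewrite negb_exists_in => /forall_inP H; rewrite big1 // => s sIJ.
  by rewrite (negbTE (H s sIJ)).
have -> : E \subset I.
  apply: subset_trans sE _; rewrite subUset sJI sub1set andbT.
  by move: sIJ; rewrite inE => /andP[].
rewrite (bigD1 s) //= sE big1 ?addr0 // => s' /andP[_ ss'].
case: (boolP (E \subset s' |: J)) => // sE'; case/negP: EJ.
apply/subsetP => x xE; have := subsetP sE x xE; have := subsetP sE' x xE.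
by rewrite !inE => /orP[/eqP ->|//]; rewrite (negbTE ss').
Qed.

Definition intensity s J : R := lam * expR (- cost s J).

Let intensity_gt0 s J : 0 < intensity s J.
Proof. by rewrite mulr_gt0 ?expR_gt0. Qed.

Lemma weight_le I J : J \subset I ->
  weight I <= weight J * \prod_(s in I :\: J) intensity s J.
Proof.
move=> sJI; rewrite /intensity big_split prodr_const /= -expR_sum /weight.
rewrite mulrACA -exprD -expRD.
have -> : (#|J| + #|I :\: J| = #|I|)%N.
  by rewrite -(cardsID J I) (setIidPr sJI).
rewrite ler_pM2l ?exprn_gt0 // ler_expR sumrN.
by have := sum_cost_le sJI; lra.
Qed.

(** An inclusion-maximal part of [I] that leaves room for [u]. The default [set0] is never reached,
    since the empty set qualifies and a maximal set therefore exists. *)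
Definition freed u I : {set {set T}} := odflt set0
  [pick J | maxset (fun J : {set {set T}} => (J \subset I) && copy_free F (u |: J)) J].

Lemma freedP u I : [/\ freed u I \subset I, copy_free F (u |: freed u I) &
  forall s, s \in I -> s \notin freed u I -> ~~ copy_free F (u |: (s |: freed u I))].
Proof.
rewrite /freed; case: pickP => [J /maxsetP[/andP[sJ fJ] maxJ]|none] /=.
  split=> // s sI sJ'; apply: contra sJ' => H.
  have E : s |: J = J by apply: maxJ; rewrite ?subsetUr // subUset sub1set sI sJ H.
  by rewrite -E setU11.
have P0 : (set0 \subset I) && copy_free F (u |: set0).
  by rewrite sub0set setU0 small_copy_free // cards1; apply: ltnW.
have [J1 maxJ1 _] := @maxset_exists _ (fun J => (J \subset I) && copy_free F (u |: J)) _ P0.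
by have := none J1; rewrite maxJ1.
Qed.

(** For J = [freed u I] these are the only edges that [I] can have in addition to [J]. *)
Definition swap_candidate u J s : bool :=
  [&& s \in EE, s \notin J, s != u, copy_free F (s |: J) & ~~ copy_free F (u |: (s |: J))].

Definition swap_rate u J : R := \sum_(s | swap_candidate u J s) intensity s J.

(** Within the fibre over [J], the graph [I] is determined by the set [I :\: J] of swap candidates.
    By [weight_le] the fibre weighs at most [weight J] times the sum over all such sets of the
    product of intensities, which is at most the exponential of the sum of intensities. *)
Lemma sum_freed u (P : pred {set {set T}}) :
  \sum_(I | [&& legal I, u \notin I & P (freed u I)]) weight I <=
  \sum_(J | [&& legal J, u \notin J, copy_free F (u |: J) & P J])
     weight J * expR (swap_rate u J).
Proof.
rewrite (partition_big (freed u) (fun J =>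
  [&& legal J, u \notin J, copy_free F (u |: J) & P J])) /=; last first.
  move=> I /and3P[lI uI ->]; have [sJ fJ _] := freedP u I.
  by rewrite (legalS sJ) // fJ andbT /= (contra (subsetP sJ u)).
apply: ler_sum => J _.
pose X := [set I | [&& legal I, u \notin I & P (freed u I)] && (freed u I == J)].
have XJ I : I \in X -> [/\ legal I, u \notin I, J \subset I &
    forall s, s \in I :\: J -> swap_candidate u J s].
  rewrite inE => /andP[/and3P[lI uI _] /eqP <-]; have [sJ fJ max] := freedP u I.
  split=> // s; rewrite inE => /andP[sJ' sI]; have [sIE fI] := andP lI.
  rewrite /swap_candidate (subsetP sIE) // sJ' max //= andbT (contraNneq _ uI) => [|<-//].
  by apply: copy_freeS fI; rewrite subUset sub1set sI.
rewrite [leLHS](eq_bigl (fun I => I \in X)); last by move=> I; rewrite inE.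
apply: (@le_trans _ _ (\sum_(I in X) weight J * \prod_(s in I :\: J) intensity s J)).
  by apply: ler_sum => I /XJ[_ _ sJI _]; apply: weight_le.
rewrite -mulr_sumr ler_pM2l ?weight_gt0 //.
have injX : {in X &, injective (fun I => I :\: J)}.
  move=> I I' /XJ[_ _ sI _] /XJ[_ _ sI' _] E.
  by rewrite -(setID I J) -(setID I' J) E (setIidPr sI) (setIidPr sI').
rewrite -(big_imset (fun B : {set {set T}} => \prod_(s in B) intensity s J) injX).
have := @sum_prod_subsets_le R _ [set s | swap_candidate u J s] (intensity^~ J)
   (fun s _ => ltW (intensity_gt0 s J)).
rewrite /swap_rate (eq_bigl _ _ (in_set _)); apply: le_trans.
rewrite big_mkcond [leRHS]big_mkcond; apply: ler_sum => B _.
case: ifP => [/imsetP[I /XJ[_ _ _ H] ->]|_].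
  suff -> : I :\: J \subset [set s | swap_candidate u J s] by [].
  by apply/subsetP => s /H; rewrite inE.
by case: ifP => // _; apply: prodr_ge0 => s _; apply: ltW.
Qed.

(** The error made when [freed u I] is replaced by [I]: weighted linked triples that are present in
    [I] apart from [u] and [s]. *)
Definition reopening u I : R := \sum_(s : {set T}) \sum_(S : {set {set V}} | S \subset F)
  \sum_(f1 : {ffun V -> T}) \sum_(f2 : {ffun V -> T}) \sum_(f3 : {ffun V -> T})
  (linked_triple F S f1 f2 f3 u s && (triple_edges F S f1 f2 f3 :\: [set u; s] \subset I))%:R
  * (b / l) ^+ (e - #|S|).

(** Averages are available for [I] but not for [freed u I], so the rate has to be expressed through
    [I]. A candidate inside [I] takes part in blocking [u] there. A candidate that can be added to
    [I] blocks [u] in the enlarged graph, and only its intensity has changed. Any other candidate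
    became addable by the deletions. The last two effects are charged to [reopening]. *)
Lemma swap_rate_le u I : legal I -> u \notin I ->
  swap_rate u (freed u I) <= \sum_(s : {set T}) (rooted u s I)%:R
    + \sum_(s | (s \notin I) && legal (s |: I))
        intensity s I * ((u \notin s |: I) && rooted u s (s |: I))%:R
    + lam * reopening u I.
Proof.
move=> lI uI; have [sJI fJ _] := freedP u I; set J := freed u I in sJI fJ *.
have [sIE fI] := andP lI.
rewrite /swap_rate [X in _ + X + _]big_mkcond /reopening mulr_sumr -!big_split big_mkcond /=.
apply: ler_sum => s _.
set a1 := (X in _ <= X + _ + _); set a2 := (X in _ <= _ + X + _).
set err := (X in _ <= _ + _ * X).
have a1_ge0 : 0 <= a1 by [].
have a2_ge0 : 0 <= a2 by rewrite /a2; case: ifP => // _; rewrite mulr_ge0 // ltW.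
have term_ge0 S f1 f2 f3 : 0 <=
    (linked_triple F S f1 f2 f3 u s && (triple_edges F S f1 f2 f3 :\: [set u; s] \subset I))%:R
    * (b / l) ^+ (e - #|S|) by rewrite mulr_ge0 // ltW.
have err_ge0 : 0 <= err by do 4!(apply: sumr_ge0 => ? _).
have lerr_ge0 : 0 <= lam * err by rewrite mulr_ge0 // ltW.
case: ifP => [|_]; last by rewrite !addr_ge0.
move=> /and5P[sE sJ su fsJ].
have fsJ' : ~~ ~~ copy_free F (s |: J) by rewrite negbK.
rewrite setUCA => /copy_freePn[f2 f2I sub2].
have sub2' : edge_image f2 F \subset u |: (s |: J) by rewrite setUCA.
have u2 : u \in edge_image f2 F.
  apply: contraLR fsJ => u2; apply/copy_freePn; exists f2 => //.
  apply/subsetP => x x2; have := subsetP sub2' x x2; rewrite in_setU1 => /orP[/eqP xu|//].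
  by rewrite -xu x2 in u2.
have s2 : s \in edge_image f2 F.
  apply: contraLR fJ => s2; apply/copy_freePn; exists f2 => //.
  apply/subsetP => x x2; have := subsetP sub2 x x2; rewrite in_setU1 => /orP[/eqP xs|//].
  by rewrite -xs x2 in s2.
have [sI|sI] := boolP (s \in I).
  have r : rooted u s I.
    apply/existsP; exists f2; apply/and4P; split=> //; first exact/injectiveP.
    by apply: subset_trans sub2' _; rewrite setUS // subUset sub1set sI.
  rewrite /a1 r; apply: (@le_trans _ _ 1); last by rewrite -addrA lerDl addr_ge0.
  by rewrite mulr_ile1 ?expR_ge0 ?(ltW lam_gt0) // -expR0 ler_expR oppr_le0 cost_ge0.
have rS (X : {set {set T}}) : J \subset X -> rooted u s (s |: X).
  move=> sJX; apply/existsP; exists f2; apply/and4P; split=> //; first exact/injectiveP.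
  by apply: subset_trans sub2' _; rewrite !setUS.
have usI : u \notin s |: I by rewrite !inE negb_or eq_sym su.
(* A copy of [S] through [s] destroyed by passing from [I] to [J] uses an edge
   [r] removed because of some copy through [u] and [r]. *)
have witness S f3 : S \subset F -> injective f3 -> s \in edge_image f3 S ->
    edge_image f3 S \subset s |: I -> ~~ (edge_image f3 S \subset s |: J) ->
    (b / l) ^+ (e - #|S|) <= \sum_(f1 : {ffun V -> T}) \sum_(f2 : {ffun V -> T})
      (linked_triple F S f1 f2 f3 u s && (triple_edges F S f1 f2 f3 :\: [set u; s] \subset I))%:R
      * (b / l) ^+ (e - #|S|).
  move=> sSF f3I s3 sub3 /subsetPn[r r3 rsJ].
  have rI : r \in I.
    have := subsetP sub3 r r3; rewrite !inE => /orP[/eqP rs|//].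
    by rewrite rs setU11 in rsJ.
  have rJ : r \notin J by apply: contra rsJ => rJ; rewrite setU1r.
  have [_ _ max] := freedP u I.
  have /copy_freePn[f1 f1I sub1] := max r rI rJ; rewrite -/J in sub1.
  have u1 : u \in edge_image f1 F.
    apply: contraLR fI => u1; apply/copy_freePn; exists f1 => //.
    apply/subsetP => x x1; have := subsetP sub1 x x1; rewrite !in_setU1.
    case/or3P => [/eqP xu|/eqP->//|/(subsetP sJI)//].
    by rewrite -xu x1 in u1.
  have r1 : r \in edge_image f1 F.
    apply: contraLR fJ => r1; apply/copy_freePn; exists f1 => //.
    apply/subsetP => x x1; have := subsetP sub1 x x1; rewrite !in_setU1.
    case/or3P => [->//|/eqP xr|->]; last by rewrite orbT.
    by rewrite -xr x1 in r1.
  have sub1I : edge_image f1 F \subset u |: I.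
    by apply: subset_trans sub1 _; rewrite setUS // subUset sub1set rI.
  have lk : linked_triple F S f1 f2 f3 u s.
    apply/and4P; split.
    - by apply/and3P; split; apply/injectiveP.
    - apply/and3P; split=> //; apply: contra usI; exact: (subsetP sub3).
    - apply/and3P; split=> //; apply: contra sI => s1.
      by have := subsetP sub1I s s1; rewrite in_setU1 (negbTE su).
    - apply/existsP; exists r; apply/and3P; split=> //; apply: contra rsJ => r2.
      have := subsetP sub2' r r2; rewrite in_setU1 => /orP[/eqP ru|//].
      by rewrite -ru rI in uI.
  have sD : triple_edges F S f1 f2 f3 :\: [set u; s] \subset I.
    apply/subsetP => x; rewrite 2!inE negb_or => /andP[/andP[/set1P xu /set1P xs]].
    have xI : x \in u |: (s |: I) -> x \in I by rewrite !in_setU1 => /or3P[/eqP|/eqP|].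
    rewrite /triple_edges !in_setU -orbA => /or3P[x1|x2|x3]; apply: xI.
    - by apply: (subsetP (setUS _ (subsetUr _ _))); apply: (subsetP sub1I).
    - by apply: (subsetP (setUS _ (setUS _ sJI))); apply: (subsetP sub2').
    - by rewrite in_setU1 (subsetP sub3) // orbT.
  rewrite (bigD1 f1) //= (bigD1 f2) //= lk sD mul1r -addrA lerDl addr_ge0 ?sumr_ge0 // => *.
  by rewrite sumr_ge0.
have broken_le S : S \subset F -> \sum_(f : {ffun V -> T} | injectiveb f) (b / l) ^+ (e - #|S|) *
      [&& s \in edge_image f S, edge_image f S \subset s |: I
        & ~~ (edge_image f S \subset s |: J)]%:R <=
   \sum_(f1 : {ffun V -> T}) \sum_(f2 : {ffun V -> T}) \sum_(f3 : {ffun V -> T})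
     (linked_triple F S f1 f2 f3 u s && (triple_edges F S f1 f2 f3 :\: [set u; s] \subset I))%:R
     * (b / l) ^+ (e - #|S|).
  move=> sSF; under [leRHS]eq_bigr do rewrite exchange_big.
  rewrite [leRHS]exchange_big big_mkcond; apply: ler_sum => f3 _.
  have rhs_ge0 : 0 <= \sum_(f1 : {ffun V -> T}) \sum_(f2 : {ffun V -> T})
      (linked_triple F S f1 f2 f3 u s && (triple_edges F S f1 f2 f3 :\: [set u; s] \subset I))%:R
      * (b / l) ^+ (e - #|S|) by do 2!(apply: sumr_ge0 => ? _).
  case: ifP => // /injectiveP f3I; case: (boolP [&& _, _ & _]) => [|_]; last by rewrite mulr0.
  by case/and3P => s3 sub3 sub3'; rewrite mulr1 witness.
(* If [s] can be added to [I], then exp (-x) - exp (-y) <= y - x for 0 <= x <= y bounds the change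
   of intensity by the change of cost, which consists of destroyed copies of subgraphs through
   [s]. *)
have [lsI|] := boolP (legal (s |: I)).
  have -> : a2 = intensity s I by rewrite /a2 sI lsI /= usI rS // mulr1.
  rewrite -addrA ler_wpDl //.
  have dcost : cost s I - cost s J <= err.
    rewrite cost_diff // big_mkcond /err [leRHS]big_mkcond; apply: ler_sum => S _.
    case: ifP => [/and3P[sSF _ _]|_]; last by case: ifP => // _; do 3!(apply: sumr_ge0 => ? _).
    by rewrite sSF mulr_sumr broken_le.
  rewrite /intensity -mulrDr ler_pM2l //.
  have h := expR_ge1Dx (cost s J - cost s I); have h0 := cost_ge0 s J.
  have h1 := costS sJI sI.
  have E : expR (- cost s I) = expR (- cost s J) * expR (cost s J - cost s I).
    by rewrite -expRD addrA addNr sub0r.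
  have x0 : 0 < expR (- cost s J) by apply: expR_gt0.
  have x1 : expR (- cost s J) <= 1 by rewrite -expR0 ler_expR oppr_le0.
  have : expR (- cost s J) * (1 + (cost s J - cost s I)) <= expR (- cost s I).
    by rewrite E ler_pM2l.
  have : expR (- cost s J) * (cost s I - cost s J) <= cost s I - cost s J.
    by rewrite ler_piMl // subr_ge0.
  by move: dcost; lra.
(* Otherwise a copy of [F] through [s] lies in [s |: I] but not in [s |: J]. It is charged to the
   term S = F of [reopening], whose weight is 1. *)
rewrite /legal subUset sub1set sE sIE /= => /copy_freePn[f3 f3I sub3].
have s3 : s \in edge_image f3 F.
  apply: contraLR fI => s3; apply/copy_freePn; exists f3 => //.
  apply/subsetP => x x3; have := subsetP sub3 x x3; rewrite in_setU1 => /orP[/eqP xs|//].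
  by rewrite -xs x3 in s3.
apply: (@le_trans _ _ (lam * err)); last by rewrite -[leLHS]add0r lerD ?addr_ge0.
rewrite ler_pM2l //; apply: (@le_trans _ _ 1).
  by rewrite -expR0 ler_expR oppr_le0 cost_ge0.
rewrite /err (bigD1 F) //= -[leLHS]addr0 lerD ?sumr_ge0 //; last first.
  by move=> S _; do 3!(apply: sumr_ge0 => ? _).
apply: le_trans (broken_le F (subxx F)).
rewrite (bigD1 f3) /=; last exact/injectiveP.
rewrite s3 sub3 subnn expr0 mul1r -[leLHS]addr0 lerD ?sumr_ge0 //.
  case: (boolP (_ \subset _)) => // sub; have /negP[] := fsJ'; apply/copy_freePn.
  by exists f3.
by move=> f _; rewrite mulr_ge0 // ltW.
Qed.

Let sum_weighted_le (J : finType) (P : pred J) (W : {set {set T}} -> R)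
    (X : J -> {set {set T}} -> R) (Y : J -> R) :
  (forall j, P j -> \sum_(I | legal I) W I * X j I <= Y j) ->
  \sum_(I | legal I) W I * (\sum_(j | P j) X j I) <= \sum_(j | P j) Y j.
Proof.
by move=> H; under eq_bigr do rewrite mulr_sumr; rewrite exchange_big; apply: ler_sum.
Qed.

Let c_triples : R := (2 ^ e)%:R * (e ^ 2 * (2 ^ v * (2 ^ v * (v.+1 ^ v * (2 * v).+1 ^ v))))%:R.

(** All edges of the triple except [u] and [s] must lie in [I], each at the price [lam] by
    [weight_superset]; the prefactor [lam] raises the exponent to the number of edges minus one, as
    in [sum_linked_triples]. *)
Lemma mean_reopening : \sum_(I | legal I) weight I *
    (\sum_(u | u \notin I) lam * reopening u I)
  <= c_triples * (K ^+ (3 * e) * b ^+ e * n ^+ 2 / t%:R) * Z.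
Proof.
have term_ge0 S f1 f2 f3 u s I : 0 <=
    (linked_triple F S f1 f2 f3 u s && (triple_edges F S f1 f2 f3 :\: [set u; s] \subset I))%:R
    * (b / l) ^+ (e - #|S|) by rewrite mulr_ge0 // ltW.
have reop_ge0 u I : 0 <= reopening u I by do 5!(apply: sumr_ge0 => ? _).
pose W I := lam * weight I.
pose G S f1 f2 f3 u s : R := (linked_triple F S f1 f2 f3 u s)%:R *
   ((b / l) ^+ (e - #|S|) * lam ^+ (#|triple_edges F S f1 f2 f3| - 1)).
apply: (@le_trans _ _ (\sum_(I | legal I) W I * (\sum_(u : {set T}) reopening u I))).
  apply: ler_sum => I _; rewrite -mulr_sumr mulrCA /W mulrA.
  rewrite ler_pM2l; last exact: mulr_gt0 lam_gt0 (weight_gt0 I).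
  by rewrite big_mkcond; apply: ler_sum => u _; case: ifP.
apply: (@le_trans _ _ (\sum_(u : {set T}) \sum_(s : {set T}) \sum_(S : {set {set V}} | S \subset F)
  \sum_(f1 : {ffun V -> T}) \sum_(f2 : {ffun V -> T}) \sum_(f3 : {ffun V -> T})
   G S f1 f2 f3 u s * Z)).
  apply: sum_weighted_le => u _; apply: sum_weighted_le => s _.
  apply: sum_weighted_le => S _; apply: sum_weighted_le => f1 _.
  apply: sum_weighted_le => f2 _; apply: sum_weighted_le => f3 _.
  rewrite /G; case: (boolP (linked_triple _ _ _ _ _ _ _)) => [lk|_] /=; last first.
    by rewrite big1 => [|I _]; rewrite !mul0r ?mulr0.
  set D := _ :\: _.
  have cD : (#|D| + 2 = #|triple_edges F S f1 f2 f3|)%N.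
    case/and4P: lk => _ /and3P[u1 u2 _] /and3P[s1 s2 _] _.
    have us : u != s by apply: contraNneq s1 => <-.
    rewrite -(cardsID [set u; s] (triple_edges _ _ _ _ _)) addnC; congr (_ + _)%N.
    rewrite (setIidPr _) ?cards2 ?us //; apply/subsetP => x.
    by rewrite !inE => /orP[/eqP ->|/eqP ->]; rewrite ?u1 ?s2 ?orbT.
  rewrite mul1r -cD addn2 subn1 /= exprS.
  apply: (@le_trans _ _ (lam * (b / l) ^+ (e - #|S|) * (\sum_(I | legal I && (D \subset I)) weight I))).
    rewrite mulr_sumr [leRHS]big_mkcondr; apply: ler_sum => I _.
    case: (D \subset I) => /=; last by rewrite mul0r mulr0.
    by rewrite mul1r /W mulrAC.
  have H (x y z w : R) : x * (y * z) * w = y * x * (z * w) by ring.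
  by rewrite H ler_pM2l ?weight_superset //; apply: mulr_gt0 lam_gt0 (q_gt0 S).
have -> : \sum_(u : {set T}) \sum_(s : {set T}) \sum_(S : {set {set V}} | S \subset F)
  \sum_(f1 : {ffun V -> T}) \sum_(f2 : {ffun V -> T}) \sum_(f3 : {ffun V -> T})
   G S f1 f2 f3 u s * Z = \sum_(S : {set {set V}} | S \subset F) (\sum_(f1 : {ffun V -> T})
   \sum_(f2 : {ffun V -> T}) \sum_(f3 : {ffun V -> T})
   \sum_(u : {set T}) \sum_(s : {set T}) G S f1 f2 f3 u s) * Z.
  under eq_bigr do rewrite exchange_big; rewrite exchange_big; apply: eq_bigr => S _.
  under eq_bigr do rewrite exchange_big; rewrite exchange_big mulr_suml; apply: eq_bigr => f1 _.
  under eq_bigr do rewrite exchange_big; rewrite exchange_big mulr_suml; apply: eq_bigr => f2 _.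
  under eq_bigr do rewrite exchange_big; rewrite exchange_big mulr_suml; apply: eq_bigr => f3 _.
  by rewrite mulr_suml; apply: eq_bigr => u _; rewrite mulr_suml.
rewrite -mulr_suml ler_pM2r // /c_triples -mulrA mulr_natl.
apply: le_trans (ler_sum _ (fun S sSF => sum_linked_triples sF cF gt2V leVF bF K1 b1 t_gt0 Kl cT sSF)) _.
rewrite sumr_const ler_wpMn2l //.
  by rewrite !mulr_ge0 ?invr_ge0 ?exprn_ge0 ?(ltW K_gt0) ?(ltW b_gt0) ?(ltW n_gt0).
by rewrite -card_powerset; apply: subset_leq_card; apply/subsetP => S; rewrite !inE.
Qed.

Hypotheses (t_big : c_triples * (K ^+ (3 * e) * b ^+ e) <= t%:R) (l_big : 16 * C <= l)
  (T_gt1 : (1 < #|T|)%N).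

Let Jc : R := 16 * ((2 ^ e * e)%:R * (Lam / b + b ^+ (e - 1))).
Let Bc : R := 16 * (2 * (e * e)%:R * (Lam / b) + 1).

Let mean_swap_rate : \sum_(I | legal I) weight I *
    (\sum_(u | u \notin I) swap_rate u (freed u I)) <= Bc / 16 * n ^+ 2 * Z.
Proof.
apply: (@le_trans _ _ (\sum_(I | legal I) (weight I * (\sum_(u | u \notin I)
   \sum_(s : {set T}) (rooted u s I)%:R)
   + weight I * (\sum_(u | u \notin I) \sum_(s | (s \notin I) && legal (s |: I))
        intensity s I * ((u \notin s |: I) && rooted u s (s |: I))%:R)
   + weight I * (\sum_(u | u \notin I) lam * reopening u I)))).
  apply: ler_sum => I lI; rewrite -!mulrDr -!big_split ler_pM2l ?weight_gt0 //=.
  by apply: ler_sum => u uI; apply: swap_rate_le.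
rewrite !big_split /=.
have h1 := mean_rooted; have h3 := mean_reopening.
(* By the Gibbs property, adding [s] at rate [intensity] is the same as summing over the edges [s]
   already present, so this sum is again bounded by [mean_rooted]. *)
have h2 : \sum_(I | legal I) weight I * (\sum_(u | u \notin I)
    \sum_(s | (s \notin I) && legal (s |: I))
      intensity s I * ((u \notin s |: I) && rooted u s (s |: I))%:R)
  <= (e * e)%:R * (Lam / b * n ^+ 2 * Z).
  apply: le_trans mean_rooted.
  apply: (@le_trans _ _ (\sum_(I | legal I) \sum_(s in I) weight I *
      (\sum_(u : {set T}) ((u \notin I) && rooted u s I)%:R))); last first.
    apply: ler_sum => I lI; rewrite -mulr_sumr ler_pM2l ?weight_gt0 //.
    rewrite exchange_big [leRHS]big_mkcond; apply: ler_sum => u _.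
    case: ifP => uI; last by rewrite big1.
    by rewrite [leLHS]big_mkcond; apply: ler_sum => s _; case: ifP.
  rewrite resample [leRHS](exchange_big_dep legal) /=; last first.
    by move=> s I _ /andP[_]; apply: legalS; apply: subsetUr.
  apply: ler_sum => I lI; rewrite [X in _ * X]exchange_big mulr_sumr /=.
  rewrite big_mkcond [leRHS]big_mkcond; apply: ler_sum => s _.
  case: ifP => // sI; rewrite -/(intensity s I) (mulrC (intensity s I) (weight I)) -[leRHS]mulrA.
  rewrite ler_pM2l ?weight_gt0 // -mulr_sumr ler_pM2l //.
  by rewrite big_mkcond; apply: ler_sum => u _; case: ifP.
have h3' : c_triples * (K ^+ (3 * e) * b ^+ e * n ^+ 2 / t%:R) * Z <= n ^+ 2 * Z.
  rewrite ler_pM2r // mulrA ler_pdivrMr // mulrA mulrC ler_pM2l ?exprn_gt0 //.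
apply: le_trans (lerD (lerD h1 h2) (le_trans h3 h3')) _.
rewrite /Bc; have H (x y z w : R) : x * (y * z * w) + x * (y * z * w) + z * w =
   16 * (2 * x * y + 1) / 16 * z * w by field.
by rewrite H.
Qed.

Let card_pairs : n ^+ 2 / 4 <= #|EE|%:R.
Proof.
rewrite /pairs_of card_draws nE ler_pdivrMr //.
by rewrite -natrX -natrM ler_nat leq_sqr_bin.
Qed.

(** Pairs of [I] and a missing edge [u] have total weight at least 3/16 of n^2 Z. As [Jc] and [Bc]
    are 16 times the bounds on the means, Markov's inequality discards at most 1/16 for each. On the
    remaining pairs, passing to [freed u I] loses a factor exp Bc and inserting [u] a factor exp Jc
    / lam; [resample] then turns the sum into the mean number of edges, which is at most C A. *)
Lemma gibbs_bound : K <= 16 * C * expR (Jc + Bc).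
Proof.
have Jc_gt0 : 0 < Jc.
  rewrite /Jc !mulr_gt0 // ?ltr0n ?muln_gt0 ?expn_gt0 ?(ltnW (ltnW e_gt2)) //.
  by rewrite ltr_wpDl ?exprn_gt0 // divr_ge0 // ltW.
have Bc_gt0 : 0 < Bc.
  have L0 : 0 <= Lam / b by rewrite divr_ge0 // ltW.
  by rewrite /Bc mulr_gt0 // ltr_wpDl //; apply: mulr_ge0 L0; rewrite mulr_ge0.
pose P u : pred {set {set T}} := fun J => (swap_rate u J <= Bc) && (cost u J <= Jc).
pose M := n ^+ 2 * Z.
pose X1 := \sum_(u in EE) \sum_(I | [&& legal I, u \notin I & P u (freed u I)]) weight I.
pose X2 := \sum_(I | legal I) weight I * (\sum_(u in EE) (u \notin I)%:R).
have rate_ge0 u J : 0 <= swap_rate u J by apply: sumr_ge0 => s _; apply: ltW.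
have lower : M * (3 / 16) <= X2.
  rewrite /M mulrAC mulr_sumr /X2; apply: ler_sum => I lI.
  rewrite mulrC ler_pM2l ?weight_gt0 //.
  have -> : \sum_(u in EE) (u \notin I)%:R = #|EE|%:R - #|I|%:R :> R.
    have sIE : I \subset EE by case/andP: lI.
    rewrite -(cardsID I EE) (setIidPr sIE) natrD addrAC subrr add0r.
    rewrite -sum1_card natr_sum big_mkcond [RHS]big_mkcond; apply: eq_bigr => u _.
    by rewrite !inE; case: (u \in I); rewrite ?andbF ?andbT //=; case: ifP.
  have := small lI; have := card_pairs.
  have : C * A <= n ^+ 2 / 16.
    rewrite /A mulrA ler_pdivrMr // mulrAC ler_pdivlMr // mulrC mulrA mulrC.
    by rewrite ler_pM2l ?exprn_gt0.
  lra.
have split : X2 <= X1 + M / 8.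
  have -> : X2 = \sum_(u in EE) \sum_(I | legal I && (u \notin I)) weight I.
    rewrite /X2; under eq_bigr do rewrite mulr_sumr.
    rewrite exchange_big; apply: eq_bigr => u _; rewrite [RHS]big_mkcondr; apply: eq_bigr => I _.
    by case: (_ \notin _); rewrite ?mulr1 ?mulr0.
  apply: (@le_trans _ _ (X1 + \sum_(u in EE) \sum_(I | legal I && (u \notin I))
      weight I * (swap_rate u (freed u I) / Bc + cost u I / Jc))).
    rewrite /X1 -big_split; apply: ler_sum => u _ /=.
    rewrite (bigID (fun I => P u (freed u I))) /=; apply: lerD.
      by rewrite le_eqVlt; apply/orP; left; apply/eqP; apply: eq_bigl => I; rewrite andbA.
    rewrite big_mkcondr; apply: ler_sum => I /andP[lI uI].
    have [sJ _ _] := freedP u I; have cS := costS sJ uI.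
    have a0 : 0 <= swap_rate u (freed u I) / Bc by rewrite divr_ge0 // ltW.
    have b0 : 0 <= cost u I / Jc by rewrite divr_ge0 ?cost_ge0 // ltW.
    case: ifP => [|_]; last by rewrite mulr_ge0 ?addr_ge0 // ltW // weight_gt0.
    rewrite negb_and -!ltNge => bad; rewrite -[leLHS]mulr1 ler_pM2l ?weight_gt0 //.
    case/orP: bad => bad.
      by rewrite -[leLHS]addr0 lerD // ler_pdivlMr // mul1r ltW.
    by rewrite -[leLHS]add0r lerD // ler_pdivlMr // mul1r (le_trans (ltW bad)).
  rewrite lerD2l.
  apply: (@le_trans _ _ ((\sum_(I | legal I) weight I *
      (\sum_(u | u \notin I) swap_rate u (freed u I))) / Bc
    + (\sum_(I | legal I) weight I * (\sum_(u : {set T}) cost u I)) / Jc)).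
    rewrite (exchange_big_dep legal) /=; last by move=> u I _ /andP[].
    rewrite 2!mulr_suml -big_split; apply: ler_sum => I lI /=.
    rewrite -mulr_sumr -2!mulrA -mulrDr ler_pM2l ?weight_gt0 // 2!mulr_suml.
    rewrite big_mkcond [X in _ <= X + _]big_mkcond -big_split; apply: ler_sum => u _ /=.
    have b0 : 0 <= cost u I / Jc by rewrite divr_ge0 ?cost_ge0 // ltW.
    have a0 : 0 <= swap_rate u (freed u I) / Bc by rewrite divr_ge0 // ltW.
    by case: (u \in I); rewrite ?andbF ?andbT ?add0r //=; case: ifP => //; rewrite addr_ge0.
  have -> : M / 8 = M / 16 + M / 16 by rewrite -mulrDr; congr (_ * _); field.
  apply: lerD.
    rewrite ler_pdivrMr //; apply: le_trans mean_swap_rate _.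
    by rewrite /M; have H (x y z : R) : x / 16 * y * z = y * z / 16 * x; [field|rewrite H].
  rewrite ler_pdivrMr //; apply: le_trans mean_cost _.
  rewrite /Jc /M; have H (x y z w : R) : x * (y * z * w) = z * w / 16 * (16 * (x * y)) by field.
  by rewrite H.
have upper : X1 <= expR (Jc + Bc) / lam * (C * A * Z).
  apply: (@le_trans _ _ (\sum_(u : {set T}) \sum_(J : {set {set T}} | (u \notin J) && legal (u |: J))
      expR (Jc + Bc) / lam * (intensity u J * weight J * 1))).
    rewrite /X1 big_mkcond; apply: ler_sum => u _.
    have t0 J : 0 <= expR (Jc + Bc) / lam * (intensity u J * weight J * 1).
      apply: mulr_ge0; first by rewrite divr_ge0 ?expR_ge0 // ltW.
      by rewrite mulr1; apply/ltW/mulr_gt0; rewrite ?weight_gt0.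
    case: ifP => uE; last exact: sumr_ge0.
    apply: le_trans (sum_freed u (P u)) _.
    rewrite big_mkcond [leRHS]big_mkcond; apply: ler_sum => J _.
    case: ifP => [/and4P[lJ uJ fJ /andP[rJ cJ]]|_]; last by case: ifP.
    have lu : legal (u |: J) by rewrite /legal fJ subUset sub1set uE; case/andP: lJ => ->.
    rewrite uJ lu mulr1 mulrA [leRHS]mulrC ler_pM2l ?weight_gt0 //.
    rewrite /intensity mulrA divfK ?gt_eqF // -expRD ler_expR; lra.
  under eq_bigr do rewrite -mulr_sumr.
  rewrite -mulr_sumr ler_pM2l ?divr_gt0 ?expR_gt0 // -(resample (fun _ _ => 1)).
  rewrite mulr_sumr; apply: ler_sum => I lI.
  by rewrite sumr_const -mulr_natl mulr1 ler_pM2r ?weight_gt0 // small.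
have M_gt0 : 0 < M by rewrite mulr_gt0 // exprn_gt0.
have h : M / 16 <= expR (Jc + Bc) / lam * (C * A * Z) by lra.
have E : expR (Jc + Bc) / lam * (C * A * Z) = M * (C * expR (Jc + Bc) / K).
  rewrite /lam /A /M; have H (x k y c m z : R) : k != 0 -> y != 0 ->
    x / (k / y) * (c * (m / y) * z) = m * z * (c * x / k).
    by move=> *; field; apply/andP.
  by rewrite H // gt_eqF.
move: h; rewrite E ler_pM2l // ler_pdivlMr // => h.
by move: h; lra.
Qed.

End GibbsMeasure.

(** With b = 4 a C, which does not involve [kappa], the part of the exponent linear in [kappa] is
    exactly kappa / 2, and the rest is at most [c0]. Since kappa = 16 C + c0 + kappa / 2, only 16 C
    < exp (16 C) is left. *)
Fact kappa_choice (R : realType) (C c1 c2 : R) (m : nat) :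
  1 <= C -> 1 <= c1 -> 1 <= c2 -> exists b kappa : R, [/\ 1 <= b, 0 <= kappa &
    16 * C * expR (16 * (c1 * (2 * (C * kappa + 1) / b + b ^+ m)) +
      16 * (2 * c2 * (2 * (C * kappa + 1) / b) + 1)) < expR kappa].
Proof.
move=> C1 c1_ge1 c2_ge1; pose a := 16 * (c1 + 2 * c2); pose b := 4 * a * C.
have a_ge1 : 1 <= a by rewrite /a; lra.
have b_ge1 : 1 <= b by rewrite /b; nra.
have b0 : 0 < b := lt_le_trans ltr01 b_ge1.
have q_ge0 : 0 <= b ^+ m by rewrite exprn_ge0 // ltW.
have [c0 c0E] : exists c0, c0 = 17 + 16 * (c1 * b ^+ m) by eexists.
have c0_ge0 : 0 <= c0.
  by rewrite c0E; have : 0 <= c1 * b ^+ m; [apply: mulr_ge0; lra | lra].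
pose kappa : R := 2 * (16 * C + c0); exists b, kappa.
split=> //; first by rewrite /kappa; lra.
have h : 16 * (c1 * (2 * (C * kappa + 1) / b + b ^+ m)) +
   16 * (2 * c2 * (2 * (C * kappa + 1) / b) + 1) <= kappa / 2 + c0.
  have -> : 2 * (C * kappa + 1) / b = kappa / (2 * a) + (2 * a * C)^-1.
    rewrite /b; field; apply/andP; split; lra.
  have h1 : a * (2 * a * C)^-1 <= 1.
    rewrite ler_pdivrMr ?mul1r; nra.
  have h2 : a * (kappa / (2 * a)) = kappa / 2 by field; lra.
  move: h1 h2; rewrite c0E {1 3}/a; move: (kappa / (2 * a)) (2 * a * C)^-1 (kappa / 2) (b ^+ m).
  by move=> p q r s; lra.
apply: (@le_lt_trans _ _ (16 * C * expR (kappa / 2 + c0))).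
  by rewrite ler_pM2l ?ler_expR //; lra.
have -> : expR kappa = expR (16 * C) * expR (kappa / 2 + c0).
  by rewrite -expRD /kappa; congr expR; field.
rewrite ltr_pM2r ?expR_gt0 //; have := expR_ge1Dx (16 * C); lra.
Qed.

Fact common_bound (R : realType) (x C K : R) : 0 <= x -> 0 <= C -> 0 <= K ->
  exists y : R, [/\ 0 <= y, x <= y, 16 * C <= y, K <= y & 2 <= y].
Proof. by move=> *; exists (x + 16 * C + K + 2); split; lra. Qed.

(** Otherwise all F-free graphs on the given vertex set satisfy the hypothesis [small], and
    [gibbs_bound] contradicts [kappa_choice]. Host sizes t^(|F| - 1) are enough to refute an upper
    bound valid for all sizes. *)
Theorem strictly_balanced_dense (R : realType) (V : finType) (F : {set {set V}}) (C : R) :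
    simple_graph F -> cover F = [set: V] -> (2 < #|V|)%N -> (#|V| <= #|F|)%N ->
    strictly_balanced F -> 1 <= C ->
  exists t0 : nat, forall t : nat, (t0 <= t)%N ->
    exists2 G : {set {set 'I_(t ^ (#|F| - 1))}}, simple_graph G && copy_free F G &
      C * ((t%:R ^+ (#|F| - 1)) ^+ 2 / t%:R ^+ (#|V| - 2)) < #|G|%:R.
Proof.
move=> sF cF gt2V leVF bF C1.
set e := #|F|; set v := #|V|.
have e0 : (0 < e)%N by apply: leq_trans leVF; apply: ltnW (ltnW _).
have c1_ge1 : (1 : R) <= (2 ^ e * e)%:R by rewrite ler1n muln_gt0 expn_gt0.
have c2_ge1 : (1 : R) <= (e * e)%:R by rewrite ler1n muln_gt0 e0.
have [b [kappa [b_ge1 kappa_ge0 big]]] := kappa_choice (e - 1) C1 c1_ge1 c2_ge1.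
have b0 : 0 < b := lt_le_trans ltr01 b_ge1.
pose x : R := (2 ^ e)%:R * (e ^ 2 * (2 ^ v * (2 ^ v * (v.+1 ^ v * (2 * v).+1 ^ v))))%:R
   * (expR kappa ^+ (3 * e) * b ^+ e).
have [y [y0 yx yC yK y2]] :
    exists y : R, [/\ 0 <= y, x <= y, 16 * C <= y, expR kappa <= y & 2 <= y].
  have x_ge0 : 0 <= x.
    by rewrite /x mulr_ge0 // ?mulr_ge0 ?exprn_ge0 ?expR_ge0 ?(ltW b0).
  have K_ge0 := expR_ge0 kappa.
  exact: common_bound x_ge0 (le_trans ler01 C1) K_ge0.
exists (Num.bound y) => t tt.
have ty : y <= t%:R.
  have := archi_boundP y0; rewrite -(ler_nat R) in tt => h.
  by apply: le_trans (ltW h) tt.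
have t2 : (2 <= t)%N by rewrite -(ler_nat R); exact: le_trans y2 ty.
have t1 : (1 : R) <= t%:R by rewrite ler1n ltnW.
have tl : y <= t%:R ^+ (v - 2).
  apply: le_trans ty _.
  by rewrite -{1}(expr1 (t%:R : R)) ler_weXn2l // subn_gt0.
case: (boolP [exists G : {set {set 'I_(t ^ (e - 1))}}, (simple_graph G && copy_free F G) &&
   (C * ((t%:R ^+ (e - 1)) ^+ 2 / t%:R ^+ (v - 2)) < #|G|%:R)]).
  by move=> /existsP[G /andP[H1 H2]]; exists G.
rewrite negb_exists => /forallP small; exfalso.
have small' (I : {set {set 'I_(t ^ (e - 1))}}) : legal F I ->
    #|I|%:R <= C * ((t%:R ^+ (e - 1)) ^+ 2 / t%:R ^+ (v - 2)).
  move=> /andP[sI fI]; rewrite leNgt; apply/negP => lt; have := small I.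
  rewrite fI lt !andbT /simple_graph => /negP[]; apply/forall_inP => u uI.
  by have := subsetP sI u uI; rewrite inE.
have e1 : (0 < e - 1)%N.
  by rewrite subn_gt0; apply: leq_trans leVF; apply: ltnW.
have T2 : (1 < #|'I_(t ^ (e - 1))|)%N.
  by rewrite card_ord; apply: (leq_trans t2); rewrite -{1}(expn1 t); exact: leq_pexp2l (ltnW t2) e1.
have := gibbs_bound sF cF gt2V leVF bF C1 kappa_ge0 b_ge1 (ltnW t2) (le_trans yK tl)
  (card_ord _) small' (le_trans yx ty) (le_trans yC tl) T2.
by rewrite leNgt big.
Qed.

(** * The exponent of an arbitrary graph *)

(** The edges of the cycle itself: a length above two makes the pairs [x], [next c x] distinct, so
    there are as many edges as vertices. *)
Lemma cycle_edges (V : finType) (F : {set {set V}}) : has_cycle F ->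
  exists S : {set {set V}}, [/\ S \subset F, (1 < #|S|)%N & (#|cover S| <= #|S|)%N].
Proof.
move=> [c [c_gt2 /andP[cyc uc]]].
pose E x := [set x; next c x].
have injE : {in c &, injective E}.
  move=> x y xc yc Exy; apply/eqP/negPn/negP => xy.
  have nx : next c x = y.
    have : y \in E x by rewrite Exy !inE eqxx.
    by rewrite !inE eq_sym (negbTE xy) => /eqP.
  have ny : next c y = x.
    have : x \in E y by rewrite -Exy !inE eqxx.
    by rewrite !inE (negbTE xy) => /eqP.
  have [i p pE] := rot_to xc.
  move: nx ny; rewrite -(next_rot i uc) -(next_rot i uc) pE.
  have : uniq (x :: p) by rewrite -pE rot_uniq.
  have : (2 < size (x :: p))%N by rewrite -pE size_rot.
  case: p {pE} => [|y' [|z q]] // _ /= /andP[xp /andP[yp _]].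
  have yx : (y == x) = false by rewrite eq_sym (negbTE xy).
  rewrite eqxx => ->; rewrite ?yx ?(negbTE xy) eqxx => zx.
  by move: xp; rewrite -zx !inE eqxx orbT.
exists (E @: [set x in c]).
have cE : #|E @: [set x in c]| = size c.
  rewrite card_in_imset; last by move=> x y; rewrite !inE; apply: injE.
  by rewrite cardsE; apply/card_uniqP.
split.
- apply/subsetP => _ /imsetP[x xc ->]; rewrite inE in xc; exact: next_cycle cyc xc.
- by rewrite cE ltnW.
- rewrite cE -(card_uniqP uc); apply: subset_leq_card; apply/subsetP => y.
  case/bigcupP => _ /imsetP[x xc ->]; rewrite inE in xc => /set2P[->|->] //.
  by rewrite mem_next.
Qed.

Lemma has_cycle_gt0 (V : finType) (F : {set {set V}}) : has_cycle F -> (0 < #|F|)%N.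
Proof.
by move=> /cycle_edges[S [sSF S1 _]]; rewrite (leq_trans _ (subset_leq_card sSF)) // ltnW.
Qed.

Lemma cover_gt2 (V : finType) (S : {set {set V}}) :
  simple_graph S -> (1 < #|S|)%N -> (2 < #|cover S|)%N.
Proof.
move=> /forall_inP sS /card_gt1P[g [h [gS hS gh]]].
have /eqP cg := sS g gS; have /eqP ch := sS h hS.
rewrite ltnNge; apply: contra gh => le.
have sub (k : {set V}) : k \in S -> k \subset cover S by move=> kS; apply: bigcup_sup.
have eqc (k : {set V}) : k \in S -> k = cover S.
  move=> kS; apply/eqP; rewrite eqEcard sub //.
  by rewrite (eqP (sS k kS)).
by rewrite (eqc g) // -(eqc h).
Qed.

Section Restriction.
Variables (V : finType) (S : {set {set V}}).
Hypothesis sS : simple_graph S.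
Let W := {x : V | x \in cover S}.
Let up (g : {set W}) : {set V} := val @: g.

(** The Gibbs argument is for graphs without isolated vertices, so [S] is moved to the type of the
    vertices that it covers. *)
Definition restricted : {set {set W}} := [set g : {set W} | up g \in S].

Let up_inj : injective up. Proof. exact/imset_inj/val_inj. Qed.

Let up_onto g : g \in S -> exists2 h : {set W}, h \in restricted & up h = g.
Proof.
move=> gS; have E : up [set x : W | val x \in g] = g.
  apply/setP => x; apply/imsetP/idP => [[y]|xg]; first by rewrite inE => yg ->.
  have xS : x \in cover S by apply/bigcupP; exists g.
  by exists (Sub x xS); rewrite ?inE ?SubK.
by exists [set x : W | val x \in g] => //; rewrite inE E.
Qed.

Lemma image_restricted : up @: restricted = S.
Proof.
apply/setP => g; apply/imsetP/idP => [[h]|/up_onto[h hS <-]]; last by exists h.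
by rewrite inE => hS ->.
Qed.

Lemma card_up_cover (S' : {set {set W}}) : #|cover (up @: S')| = #|cover S'|.
Proof.
rewrite -(card_imset (mem (cover S')) val_inj); apply: eq_card => x.
apply/bigcupP/imsetP => [[_ /imsetP[g gS ->] /imsetP[y yg ->]]|[y /bigcupP[g gS yg] ->]].
  by exists y => //; apply/bigcupP; exists g.
by exists (up g); apply: imset_f.
Qed.

Lemma simple_restricted : simple_graph restricted.
Proof.
apply/forall_inP => g; rewrite inE => /(forall_inP sS).
by rewrite card_imset //; apply: val_inj.
Qed.

Lemma card_restricted : #|restricted| = #|S|.
Proof. by rewrite -[in RHS]image_restricted card_imset. Qed.

Lemma cover_restricted : cover restricted = [set: W].
Proof.
apply/setP => x; rewrite inE; apply/bigcupP; case: x => x xS.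
have /bigcupP[g gS xg] := xS; have [h hS hg] := up_onto gS; exists h => //.
move: xg; rewrite -hg => /imsetP[y yh xy].
by have -> : exist _ x xS = y by apply: val_inj.
Qed.

Lemma card_restricted_vertices : #|{: W}| = #|cover S|.
Proof. by rewrite card_sig. Qed.

Lemma copy_free_restricted (F : {set {set V}}) (T : finType) (G : {set {set T}}) :
  S \subset F -> copy_free restricted G -> copy_free F G.
Proof.
move=> sSF; apply: contraLR => /copy_freePn[f fI sf]; apply/copy_freePn.
exists [ffun x : W => f (val x)].
  by move=> x y; rewrite !ffunE => /fI/val_inj.
apply/subsetP => _ /imsetP[g gS ->].
have -> : [ffun x : W => f (val x)] @: g = f @: (up g).
  by rewrite /up -imset_comp; apply: eq_imset => x; rewrite ffunE.
by apply: (subsetP sf); apply: imset_f; apply: (subsetP sSF); move: gS; rewrite inE.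
Qed.

End Restriction.

(** [gamma] is the least value of (|cover S| - 2) / (|S| - 1) over subgraphs with at least two
    edges. A minimiser with fewest edges is strictly balanced, and a cycle gives gamma < 1. If gamma
    <= 2 - alpha, graphs avoiding this minimiser with more than (1 + |C|) n^(2 - gamma) edges would
    violate the bound C n^alpha. *)
Theorem subgraph_exponent (R : realType) (V : finType) (F : {set {set V}}) (alpha C : R) :
    simple_graph F -> has_cycle F ->
    (forall n (G : {set {set 'I_n}}), (0 < n)%N -> simple_graph G -> copy_free F G ->
       #|G|%:R <= C * n%:R `^ alpha) ->
  exists gamma : R, [/\ 2 - alpha < gamma, 0 < gamma < 1 &
    forall S : {set {set V}}, S \subset F -> S != set0 ->
      gamma * (#|S|%:R - 1) <= #|cover S|%:R - 2].
Proof.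
move=> sF /cycle_edges[S1 [sS1F S1gt1 leS1]] hC.
pose P (S : {set {set V}}) := (S \subset F) && (1 < #|S|)%N.
have PS1 : P S1 by rewrite /P sS1F.
have simple_sub (S : {set {set V}}) : S \subset F -> simple_graph S.
  by move=> sSF; apply/forall_inP => g /(subsetP sSF)/(forall_inP sF).
have cov_gt2 S : P S -> (2 < #|cover S|)%N.
  by move=> /andP[sSF]; apply: cover_gt2; apply: simple_sub.
pose rho (S : {set {set V}}) : R := (#|cover S|%:R - 2) / (#|S|%:R - 1).
have sz S : P S -> (0 : R) < #|S|%:R - 1.
  by move=> /andP[_ gt1]; rewrite subr_gt0 ltr1n.
case: (arg_minP rho PS1) => S2 PS2 minS2.
pose Q S := P S && (rho S == rho S2).
have QS2 : Q S2 by rewrite /Q PS2 eqxx.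
case: (@arg_minnP _ S2 Q (fun S => #|S|) QS2) => S0 /andP[PS0 /eqP rS0] minS0.
have min0 S : P S -> rho S0 <= rho S by rewrite rS0; apply: minS2.
have /andP[sS0F S0gt1] := PS0; have covS0 := cov_gt2 _ PS0.
have rho_gt0 : 0 < rho S0 by rewrite divr_gt0 ?sz // subr_gt0 ltr_nat.
have rho_lt1 : rho S0 < 1.
  apply: le_lt_trans (min0 _ PS1) _; rewrite ltr_pdivrMr ?sz // mul1r.
  by have : (#|cover S1|%:R : R) <= #|S1|%:R; [rewrite ler_nat | lra].
have leV : (#|cover S0| <= #|S0|)%N.
  have : #|cover S0|%:R - 2 < #|S0|%:R - 1 :> R.
    by move: rho_lt1; rewrite /rho ltr_pdivrMr ?sz // mul1r.
  have : (#|S0|.+1%:R : R) = #|S0|%:R + 1 by rewrite -natr1.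
  by rewrite -ltnS -(ltr_nat R); lra.
have s0 : simple_graph S0 := simple_sub _ sS0F.
have bal : strictly_balanced (restricted S0).
  move=> S' sS' gt1 neS'.
  pose S : {set {set V}} := [set val @: (g : {set _}) | g in S'].
  have cS : #|S| = #|S'| by rewrite card_imset //; apply/imset_inj/val_inj.
  have cc : #|cover S| = #|cover S'| := card_up_cover S'.
  rewrite card_restricted_vertices card_restricted -cS -cc.
  have sS : S \subset S0 by have := imsetS (fun g : {set _} => val @: g) sS'; rewrite image_restricted.
  have PS : P S by rewrite /P (subset_trans sS) // cS.
  have : rho S0 < rho S.
    rewrite lt_neqAle min0 // andbT; apply/negP => /eqP E.
    have : (#|S0| <= #|S|)%N by apply: minS0; rewrite /Q PS -E rS0 eqxx.
    rewrite cS -(card_restricted S0) => le; case/negP: neS'.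
    by rewrite eqEcard sS'.
  have nz := cov_gt2 _ PS.
  rewrite /rho ltr_pdivrMr ?sz // mulrAC ltr_pdivlMr ?sz //.
  rewrite -(natrB _ (ltnW covS0)) -(natrB _ (ltnW nz)).
  have /andP[_ S1'] := PS.
  by rewrite -(natrB _ (ltnW S0gt1)) -(natrB _ (ltnW S1')) -!natrM ltr_nat mulnC.
exists (rho S0); split; last 1 first.
- move=> S sSF S_neq0; have [gt1|le1] := ltnP 1 #|S|.
    have PS : P S by rewrite /P sSF.
    by rewrite -ler_pdivlMr ?sz // min0.
  have c1 : #|S| = 1%N by apply/eqP; rewrite eqn_leq le1 card_gt0.
  have [g gS] := set0Pn _ S_neq0.
  have : (2 <= #|cover S|)%N.
    by rewrite -(eqP (forall_inP (simple_sub _ sSF) g gS)) subset_leq_card // bigcup_sup.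
  rewrite c1 subrr mulr0 subr_ge0 -(ler_nat R) //.
- rewrite ltNge; apply/negP => le.
  have leW : (#|{: {x : V | x \in cover S0}}| <= #|restricted S0|)%N.
    by rewrite card_restricted card_restricted_vertices.
  have gt2W : (2 < #|{: {x : V | x \in cover S0}}|)%N by rewrite card_restricted_vertices.
  have C1 : 1 <= 1 + `|C| by rewrite lerDl.
  have [t0] := strictly_balanced_dense (simple_restricted s0) (cover_restricted S0) gt2W leW bal C1.
  move=> /(_ (maxn t0 1) (leq_maxl _ _)) [G /andP[sG fG]].
  set t := maxn t0 1; have t_gt0 : (0 < t)%N by rewrite /t leq_max orbT.
  have t1 : (1 : R) <= t%:R by rewrite ler1n.
  rewrite card_restricted_vertices => lt.
  have n0 : (0 < t ^ (#|restricted S0| - 1))%N by rewrite expn_gt0 t_gt0.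
  have up := hC _ G n0 sG (copy_free_restricted sS0F fG).
  have := lt_le_trans lt up; rewrite ltNge => /negP; apply.
  set N : R := (t ^ (#|restricted S0| - 1))%:R.
  have N1 : 1 <= N by rewrite /N ler1n.
  have lE : t%:R ^+ (#|cover S0| - 2) = N `^ rho S0.
    rewrite /N card_restricted natrX -!powR_mulrn ?ler0n // -powRrM.
    rewrite (natrB _ (ltnW S0gt1)) (natrB _ (ltnW covS0)).
    by rewrite mulrCA divff ?mulr1 // gt_eqF ?sz.
  rewrite -natrX -/N lE -powR_mulrn ?(le_trans ler01) // -powRB; last first.
    by apply/implyP => _; rewrite gt_eqF // (lt_le_trans ltr01).
  apply: (@le_trans _ _ (`|C| * N `^ alpha)).
    by rewrite ler_wpM2r ?powR_ge0 ?ler_norm.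
  apply: ler_pM; rewrite ?powR_ge0 // ?lerDr //.
  by apply: ler_powR => //; rewrite lerBrDr addrC -lerBrDr.
- by rewrite rho_gt0 rho_lt1.
Qed.

(** * A container lemma *)

Section WeightedHypergraphs.
Variables (R : realType) (X : finType).
Implicit Types (w u : {set X} -> R) (A B S T Z G I : {set X}).

Definition mass w : R := \sum_(A : {set X}) w A.
Definition codegree w T : R := \sum_(A : {set X} | T \subset A) w A.
Definition independent w I := forall A, A \subset I -> w A = 0.

(** A weighted [i]-uniform hypergraph on [G]. Each further element of [T] must lower the codegree by
    a factor [t]; fingerprints will have size of order t |G|. *)
Record spread (i : nat) (c D t : R) G w : Prop := Spread {
  spread_ge0 : forall A, 0 <= w A;
  spread_supp : forall A, w A != 0 -> #|A| = i /\ A \subset G;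
  spread_codeg : forall T, T != set0 -> codegree w T <= D * t ^+ (#|T| - 1);
  spread_total : c * #|G|%:R <= mass w }.

Lemma sum_codegree w i : (forall A, 0 <= w A) -> (forall A, w A != 0 -> #|A| = i) ->
  \sum_(T : {set X}) codegree w T = 2 ^+ i * mass w.
Proof.
move=> w0 wi; rewrite /codegree (exchange_big_dep xpredT) //= /mass mulr_sumr.
apply: eq_bigr => A _; have [->|wA] := eqVneq (w A) 0; first by rewrite mulr0 big1.
rewrite sumr_const -[LHS]mulr_natl; congr (_ * _).
rewrite -(wi A wA) -natrX -card_powerset; congr (_%:R).
by apply: eq_card => T; rewrite inE.
Qed.

(** [[pick ...]] returns the first witness in enumeration order, so shrinking the predicate does not
    change the result as long as that witness survives. *)
Lemma pick_sub (P Q : pred X) x : [pick y | P y] = Some x -> (forall y, Q y -> P y) ->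
  Q x -> [pick y | Q y] = Some x.
Proof.
move=> Px sQP Qx; move: Px; rewrite /pick /enum_mem.
elim: (Finite.enum X) => //= y s IHs.
rewrite !unfold_in /=; case: (boolP (P y)) => [Py|Py] /=.
  by move=> [->]; rewrite Qx.
by move=> /IHs; case: (boolP (Q y)) => // /sQP; rewrite (negbTE Py).
Qed.

Section Algorithm.
Variables (w : {set X} -> R) (beta kap t : R).

(* The state records the vertices picked so far and the weighted link they
   generate; a set with a link of too large weight blocks all its supersets. *)
Definition active S u A : bool := [disjoint S & A] &&
  [forall T : {set X}, (T != set0) && (T \subset A) ==> (codegree u T < kap * t ^+ #|T|)].

Definition active_degree S u x : R := \sum_(A : {set X} | (x \in A) && active S u A) w A.

Definition eligible Z S u x : bool := [&& x \in Z, x \notin S & beta <= active_degree S u x].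

Definition step Z (s : {set X} * ({set X} -> R)) : {set X} * ({set X} -> R) :=
  if [pick x | eligible Z s.1 s.2 x] is Some x then
    (x |: s.1, fun B => s.2 B + (if (x \notin B) && active s.1 s.2 (x |: B) then w (x |: B) else 0))
  else s.

Definition run k Z := iter k (step Z) (set0, fun=> 0).

Lemma stepS Z (s : {set X} * ({set X} -> R)) : s.1 \subset (step Z s).1.
Proof. by rewrite /step; case: pickP => //= x _; apply: subsetUr. Qed.

Lemma runS k m Z : (k <= m)%N -> (run k Z).1 \subset (run m Z).1.
Proof.
move=> /subnK <-; elim: (m - k)%N => // j IH.
by rewrite addSn /run iterS; apply: subset_trans IH (stepS _ _).
Qed.

(** [Z] is consulted only for choosing elements, and all elements chosen for [I] lie in [Z]. So the
    run can be replayed from any set between the picks and [I]. *)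
Lemma run_determined k Z I : (run k I).1 \subset Z -> Z \subset I -> run k Z = run k I.
Proof.
move=> + sZI; suff H m : (m <= k)%N -> (run k I).1 \subset Z -> run m Z = run m I by apply: H.
elim: m => // m IH mk sub; rewrite /run !iterS -!/(run m _) IH ?(ltnW mk) //.
have := subset_trans (runS I mk) sub; rewrite /run iterS -/(run m I) /step.
set s := run m I.
case E: [pick y | eligible I s.1 s.2 y] => [x|] /=.
  rewrite subUset sub1set => /andP[xZ _].
  have /and3P[xI xS db] : eligible I s.1 s.2 x.
    by move: E; case: pickP => // y ely [<-].
  rewrite (pick_sub E) //; last by rewrite /eligible xZ xS.
  by move=> y /and3P[yZ yS dy]; rewrite /eligible (subsetP sZI) // yS.
move=> _; case: pickP => // x /and3P[xZ xS db].
by move: E; case: pickP => // /(_ x); rewrite /eligible (subsetP sZI) // xS db.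
Qed.

Section Invariant.
Variables (i : nat) (c D : R) (G I : {set X}).
Hypotheses (c_gt0 : 0 < c) (D_gt0 : 0 < D) (t_gt0 : 0 < t) (kap_gt0 : 0 < kap) (beta_gt0 : 0 < beta).
Hypotheses (sw : spread i.+1 c D t G w) (iI : independent w I).

Let w0 := spread_ge0 sw.

(** In [ls_codeg], a set still below the threshold kap t^|T| can overshoot it by one link, that is
    by D t^|T|. By [ls_stop], fewer than [k] picks mean that no eligible element is left. *)
Record link_state k S u : Prop := LinkState {
  ls_sub : S \subset I;
  ls_ge0 : forall A, 0 <= u A;
  ls_supp : forall A, u A != 0 -> #|A| = i /\ A \subset G;
  ls_codeg : forall T, T != set0 -> codegree u T <= (kap + D) * t ^+ #|T|;
  ls_up : mass u <= #|S|%:R * D;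
  ls_low : #|S|%:R * beta <= mass u;
  ls_indep : independent u I;
  ls_card : (#|S| <= k)%N;
  ls_stop : #|S| = k \/ (forall x, ~~ eligible I S u x) }.

Lemma sum_link (P : pred {set X}) x (h : {set X} -> R) :
  \sum_(B : {set X} | (x \notin B) && P (x |: B)) h (x |: B) = \sum_(A : {set X} | (x \in A) && P A) h A.
Proof.
rewrite [RHS](reindex_onto (fun B => x |: B) (fun A => A :\ x)) /=; last first.
  by move=> A /andP[xA _]; rewrite setD1K.
apply: eq_bigl => B; rewrite setU11 /= andbC; congr (_ && _).
by apply/idP/eqP => [/setU1K//|<-]; rewrite !inE eqxx.
Qed.

Lemma active_degree_le S u x : active_degree S u x <= D.
Proof.
have := spread_codeg sw (_ : [set x] != set0).
rewrite cards1 subnn expr0 mulr1 -cards_eq0 cards1 => /(_ isT); apply: le_trans.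
rewrite /active_degree /codegree [leRHS]big_mkcond [leLHS]big_mkcond; apply: ler_sum => A _.
by rewrite sub1set; case: (x \in A) => //=; case: ifP.
Qed.

Lemma run_invariant k : link_state k (run k I).1 (run k I).2.
Proof.
elim: k => [|k IHk].
  split; rewrite /= ?cards0 ?mul0r ?sub0set //; try by rewrite /mass big1.
  - by move=> A; rewrite eqxx.
  - by move=> T _; rewrite /codegree big1 // mulr_ge0 ?exprn_ge0 ?addr_ge0 // ltW.
  - by left.
rewrite /run iterS -/(run k I) /step; move: IHk; case: (run k I) => S u /= [sub u0 us cd up lo ind ck st].
case: pickP => [x elx|none] /=; last first.
  split=> //; first exact: leqW.
  by right=> x; rewrite none.
have /and3P[xI xS dx] := elx.
have kE : #|S| = k by case: st => // /(_ x); rewrite elx.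
pose d B := if (x \notin B) && active S u (x |: B) then w (x |: B) else 0.
have d0 B : 0 <= d B by rewrite /d; case: ifP.
have totE : mass (fun B => u B + d B) = mass u + active_degree S u x.
  rewrite /mass big_split /=; congr (_ + _).
  by rewrite /d -big_mkcond /= (sum_link (active S u)).
have cE T : codegree (fun B => u B + d B) T = codegree u T + codegree d T.
  by rewrite /codegree big_split.
split; rewrite /= ?cardsU1 ?xS ?add1n ?kE //.
- by rewrite subUset sub1set xI.
- by move=> A; apply: (addr_ge0 (u0 A) (d0 A)).
- move=> A; rewrite -/(d A); have [uA|uA] := eqVneq (u A) 0; last by move=> _; apply: us.
  rewrite uA add0r /d; case: ifP => [/andP[xA _]|]; last by rewrite eqxx.
  move=> /(spread_supp sw); rewrite cardsU1 xA add1n subUset => -[[->]] /andP[_ ->].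
  by split.
- move=> T T0; rewrite cE.
  have [xT|xT] := boolP (x \in T).
    rewrite [codegree d T]big1 ?addr0 ?cd // => A sTA.
    by rewrite /d (subsetP sTA x xT).
  have dw : codegree d T <= D * t ^+ #|T|.
    have xT0 : x |: T != set0 by apply/set0Pn; exists x; rewrite setU11.
    have := spread_codeg sw xT0; rewrite cardsU1 xT add1n subn1 /=; apply: le_trans.
    rewrite /codegree /d -big_mkcondr /=.
    rewrite (eq_bigl (fun B => (x \notin B) && ((x |: T \subset x |: B) && active S u (x |: B)))); last first.
      move=> B; rewrite andbCA; case: (boolP (x \in B)) => //= xB; congr (_ && _).
      apply/idP/idP => [/setUS->//|/subsetP sub']; apply/subsetP => y yT.
      have := sub' y; rewrite !inE yT orbT => /(_ isT)/orP[/eqP yx|//].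
      by rewrite -yx yT in xT.
    rewrite (sum_link (fun A => (x |: T \subset A) && active S u A)).
    rewrite big_mkcond [leRHS]big_mkcond; apply: ler_sum => A _.
    by case: (x |: T \subset A); rewrite ?andbF //=; case: ifP.
  have [z|nz] := eqVneq (codegree d T) 0; first by rewrite z addr0 cd.
  rewrite mulrDl lerD //.
  have [B sTB dB] : exists2 B : {set X}, T \subset B & d B != 0.
    apply/exists_inP; apply: contraNT nz; rewrite negb_exists_in => /forall_inP H.
    by apply/eqP/big1 => B /H; rewrite negbK => /eqP.
  move: dB; rewrite /d; case: ifP => [/andP[_ /andP[_ /forallP/(_ T) H]] _|]; last by rewrite eqxx.
  by move: H; rewrite T0 (subset_trans sTB (subsetUr _ _)) => /ltW.
- by rewrite [leLHS]totE -natr1 -kE mulrDl mul1r lerD // active_degree_le.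
- by rewrite totE -natr1 -kE mulrDl mul1r lerD.
- move=> A sAI; rewrite ind // add0r /d; case: ifP => // _; apply: iI.
  by rewrite subUset sub1set xI.
- by left.
Qed.

Definition low_degree S u : {set X} := [set x in G | active_degree S u x < beta] :|: S.

Lemma sub_low_degree k S u : I \subset G -> link_state k S u ->
  (forall x, ~~ eligible I S u x) -> I \subset low_degree S u.
Proof.
move=> sIG st stop; apply/subsetP => x xI; rewrite !inE (subsetP sIG) //=.
have := stop x; rewrite /eligible xI /= negb_and negbK -ltNge orbC.
by case/orP => ->; rewrite ?orbT.
Qed.

(** Weight becomes inactive in two ways. Sets meeting [S] weigh at most |S| D. For a saturated [T],
    the codegree in [w] is at most D / (kap t) times that in [u], and the codegrees in [u] sum to
    2^i mass u. *)
Lemma active_total k S u : link_state k S u ->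
  mass w - (#|S|%:R * D + D / (kap * t) * (2 ^+ i * (#|S|%:R * D)))
  <= \sum_(A | active S u A) w A.
Proof.
move=> st; rewrite lerBlDr addrC -lerBlDr.
have -> : mass w - \sum_(A | active S u A) w A = \sum_(A | ~~ active S u A) w A.
  by rewrite /mass (bigID (active S u)) /= addrAC subrr add0r.
pose sat T := (T != set0) && (kap * t ^+ #|T| <= codegree u T).
apply: (@le_trans _ _ (\sum_(x in S) codegree w [set x] + \sum_(T : {set X} | sat T) codegree w T)).
  rewrite /codegree (exchange_big_dep xpredT) //= [X in _ + X](exchange_big_dep xpredT) //=.
  rewrite -big_split big_mkcond /=; apply: ler_sum => A _.
  have s1 : 0 <= \sum_(x in S | [set x] \subset A) w A by apply: sumr_ge0.
  have s2 : 0 <= \sum_(T : {set X} | sat T && (T \subset A)) w A by apply: sumr_ge0.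
  case: ifP => [|_]; last exact: addr_ge0.
  rewrite negb_and => /orP[|].
    rewrite -setI_eq0 => /set0Pn[x]; rewrite inE => /andP[xS xA].
    rewrite (bigD1 x) /= ?xS ?sub1set // -addrA lerDl addr_ge0 ?sumr_ge0 //.
  rewrite negb_forall => /existsP[T]; rewrite negb_imply -leNgt => /andP[/andP[T0 sTA] hT].
  rewrite addrC (bigD1 T) /=; last by rewrite /sat T0 hT.
  by rewrite -addrA lerDl addr_ge0 ?sumr_ge0.
apply: lerD.
  rewrite mulr_natl -sumr_const; apply: ler_sum => x _.
  have := spread_codeg sw (_ : [set x] != set0).
  by rewrite cards1 subnn expr0 mulr1 -cards_eq0 cards1 => /(_ isT).
apply: (@le_trans _ _ (\sum_(T : {set X}) D / (kap * t) * codegree u T)).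
  rewrite big_mkcond; apply: ler_sum => T _.
  have cu : 0 <= codegree u T by apply: sumr_ge0 => A _; apply: ls_ge0 st A.
  case: ifP => [/andP[T0 hT]|_]; last by rewrite mulr_ge0 // divr_ge0 ?mulr_ge0 // ltW.
  apply: le_trans (spread_codeg sw T0) _; rewrite -mulrA ler_pM2l //.
  rewrite mulrC ler_pdivlMr ?mulr_gt0 //; apply: le_trans hT.
  rewrite mulrC -mulrA ler_pM2l // -exprS.
  by rewrite subn1 prednK // card_gt0.
rewrite -mulr_sumr ler_pM2l ?divr_gt0 ?mulr_gt0 //.
rewrite (sum_codegree (ls_ge0 st) (fun A nz => proj1 (ls_supp st nz))).
by rewrite ler_pM2l ?exprn_gt0 // (ls_up st).
Qed.

(** The constants make each loss in [active_total] at most c / 8 times |G|, so the active weight is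
    at least 3 c / 4 times |G|. Elements of degree below c / 4 account for c / 4 of it, the others
    for at most D each; hence a share c / (2 D) of [G] has high degree, of which [S] puts back at
    most c / (8 D). *)
Lemma card_low_degree k S u : link_state k S u -> S \subset G ->
    kap = 2 ^+ (i + 4) * D ^+ 2 / c -> beta = c / 4 -> t <= c / (16 * D) ->
    #|S|%:R <= 2 * (t * #|G|%:R) ->
  #|low_degree S u|%:R <= (1 - c / (8 * D)) * #|G|%:R.
Proof.
move=> st sSG kapE betaE tle leS; have act := active_total st.
set M : R := #|G|%:R in leS *.
have M0 : 0 <= M by apply: ler0n.
pose hi := [set x in G | beta <= active_degree S u x].
have hi_low : #|low_degree S u|%:R <= M - #|hi|%:R + #|S|%:R :> R.
  have E : G = hi :|: [set x in G | active_degree S u x < beta].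
    by apply/setP => x; rewrite !inE; case: (x \in G) => //=; case: leP.
  have dj : hi :&: [set x in G | active_degree S u x < beta] = set0.
    by apply/setP => x; rewrite !inE; case: (x \in G) => //=; case: leP.
  have -> : M = #|hi|%:R + #|[set x in G | active_degree S u x < beta]|%:R.
    by rewrite /M {1}E -natrD -cardsUI dj cards0 addn0.
  rewrite (addrAC #|hi|%:R) subrr add0r -natrD ler_nat; apply: leq_card_setU.
have sum_deg : \sum_(A | active S u A) w A <= D * #|hi|%:R + beta * M.
  apply: (@le_trans _ _ (\sum_(x : X) active_degree S u x)).
    rewrite /active_degree (exchange_big_dep (active S u)) /=; last by move=> x A _ /andP[].
    apply: ler_sum => A aA; have [->|wA] := eqVneq (w A) 0; first exact: sumr_ge0.
    have [cA _] := spread_supp sw wA; have [x xA] : exists x, x \in A.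
      by apply/set0Pn; rewrite -card_gt0 cA.
    by rewrite (bigD1 x) /= ?xA ?aA // lerDl sumr_ge0.
  apply: (@le_trans _ _ (\sum_(x in hi) D + \sum_(x in G) beta)); last first.
    by rewrite !sumr_const !mulr_natr.
  rewrite big_mkcond [X in _ <= X + _]big_mkcond [X in _ <= _ + X]big_mkcond -big_split.
  apply: ler_sum => x _ /=; rewrite inE.
  have [xG|xG] := boolP (x \in G); last first.
    rewrite /active_degree big1 ?addr0 // => A /andP[xA _].
    by apply/eqP; apply: contraNT xG => /(spread_supp sw)[_ /subsetP]; apply.
  rewrite /=; case: (leP beta) => h; last by rewrite add0r ltW.
  by rewrite -[leLHS]addr0 lerD ?active_degree_le // ltW.
have tot := spread_total sw; rewrite -/M in tot.
have Dn0 := lt0r_neq0 D_gt0; have cn0 := lt0r_neq0 c_gt0; have tn0 := lt0r_neq0 t_gt0.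
have tM : t * M <= c / (16 * D) * M by rewrite ler_wpM2r.
have D16 : D * (c / (16 * D)) = c / 16 by field.
have b1 : #|S|%:R * D <= c / 8 * M.
  apply: (@le_trans _ _ (2 * (c / (16 * D) * M) * D)).
    by rewrite ler_wpM2r ?(ltW D_gt0) // (le_trans leS) // ler_wpM2l.
  by rewrite -subr_ge0 (_ : _ - _ = 0) //; field; lra.
have b2 : D / (kap * t) * (2 ^+ i * (#|S|%:R * D)) <= c / 8 * M.
  apply: (@le_trans _ _ (D / (kap * t) * (2 ^+ i * (2 * (t * M) * D)))).
    rewrite ler_wpM2l ?divr_ge0 ?mulr_ge0 ?(ltW D_gt0) ?(ltW kap_gt0) ?(ltW t_gt0) //.
    by rewrite ler_wpM2l ?exprn_ge0 // ler_wpM2r ?(ltW D_gt0).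
  rewrite kapE exprD -subr_ge0 (_ : _ - _ = 0) //.
  have : (2 : R) ^+ i != 0 by rewrite expf_neq0 // pnatr_eq0.
  by move: (2 ^+ i) => p p0; field; do ?[apply/andP; split].
have Dhi : c / 2 * M <= D * #|hi|%:R.
  have := le_trans act sum_deg; move: b1 b2 tot; rewrite betaE.
  move: (#|S|%:R * D) (D * #|hi|%:R) (mass w) (D / (kap * t) * (2 ^+ i * (#|S|%:R * D))).
  by move=> x y z a; lra.
have hiM : c / (2 * D) * M <= #|hi|%:R.
  by rewrite -(ler_pM2l D_gt0) (le_trans _ Dhi) // -subr_ge0 (_ : _ - _ = 0) //; field; lra.
apply: le_trans hi_low _.
have SM : #|S|%:R <= c / (8 * D) * M.
  apply: le_trans leS _; apply: (@le_trans _ _ (2 * (c / (16 * D) * M))).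
    by rewrite ler_wpM2l.
  by rewrite -subr_ge0 (_ : _ - _ = 0) //; field; lra.
have E : c / (2 * D) = 4 * (c / (8 * D)) by field.
have pos : 0 <= c / (8 * D) * M by rewrite mulr_ge0 // divr_ge0 ?mulr_ge0 // ltW.
move: hiM SM pos; rewrite E; move: (c / (8 * D)) => q; lra.
Qed.

End Invariant.

End Algorithm.

End WeightedHypergraphs.

(** Induction on uniformity: a full run yields a dense link, to which the case of lower uniformity
    applies; an interrupted run leaves only elements of low degree. Allowing every [Z] between the
    fingerprint and [I] is what the induction needs, since both stages are evaluated at the union of
    their fingerprints. *)
Theorem container (R : realType) (i : nat) (c D : R) : 0 < c -> 0 < D ->
  exists delta t0 B : R, [/\ 0 < delta < 1, 0 < t0, 0 < B &
   forall (X : finType) (G : {set X}) (t : R), 0 < t -> t <= t0 -> 1 <= t * #|G|%:R ->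
   exists f : ({set X} -> R) -> {set X} -> {set X}, forall w (I : {set X}),
     spread i.+1 c D t G w -> I \subset G -> independent w I ->
     exists T : {set X}, [/\ T \subset I, #|T|%:R <= B * (t * #|G|%:R) &
       forall Z : {set X}, T \subset Z -> Z \subset I ->
         I \subset f w Z /\ #|f w Z|%:R <= (1 - delta) * #|G|%:R]].
Proof.
elim: i c D => [|i IHi] c D c_gt0 D_gt0.
  exists (c / (D + c)), 1, 1; split=> //.
    by rewrite divr_gt0 ?addr_gt0 //= ltr_pdivrMr ?addr_gt0 // mul1r; lra.
  move=> X G t t_gt0 _ tM; exists (fun w _ => [set x in G | w [set x] == 0]) => w I sw sIG iI.
  exists set0; split; rewrite ?sub0set ?cards0 ?mul1r ?(le_trans ler01) // => Z _ _; split.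
    apply/subsetP => x xI; rewrite inE (subsetP sIG) //=.
    by rewrite iI // sub1set.
  set L := [set x in G | _]; set M : R := #|G|%:R.
  pose H := [set x in G | w [set x] != 0].
  have cLH : M = #|L|%:R + #|H|%:R.
    rewrite /M -natrD; congr _%:R.
    rewrite -(cardsID [set x | w [set x] == 0] G); congr (_ + _)%N.
      by apply: eq_card => x; rewrite !inE.
    by apply: eq_card => x; rewrite !inE andbC.
  have cM : c * M <= D * #|H|%:R.
    apply: le_trans (spread_total sw) _.
    apply: (@le_trans _ _ (\sum_(x : X) codegree w [set x])).
      rewrite /codegree (exchange_big_dep xpredT) //=; apply: ler_sum => A _.
      have w0 := spread_ge0 sw.
      have [->|wA] := eqVneq (w A) 0; first exact: sumr_ge0.
      have [cA _] := spread_supp sw wA; have [x xA] : exists x, x \in A.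
        by apply/set0Pn; rewrite -card_gt0 cA.
      by rewrite (bigD1 x) /= ?sub1set // lerDl sumr_ge0.
    apply: (@le_trans _ _ (\sum_(x in H) D)); last by rewrite sumr_const mulr_natr.
    rewrite [leRHS]big_mkcond; apply: ler_sum => x _; case: ifP => xH.
      have := spread_codeg sw (_ : [set x] != set0).
      by rewrite cards1 subnn expr0 mulr1 -cards_eq0 cards1 => /(_ isT).
    rewrite /codegree big1 // => A; rewrite sub1set => xA; apply/eqP/negPn/negP => wA.
    have [/eqP/cards1P[y Ay] AG] := spread_supp sw wA.
    move: xA; rewrite Ay inE => /eqP xy; move/negP: xH; apply.
    by rewrite inE xy -Ay wA -sub1set -xy xy -Ay AG.
  have M0 : 0 <= M by [].
  have : c / (D + c) * M <= #|H|%:R.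
    rewrite mulrAC ler_pdivrMr ?addr_gt0 //.
    have : (0 : R) <= #|H|%:R by []. 
    by move: cM; move: (#|H|%:R : R) => h; nra.
  by move: cLH; move: (#|H|%:R : R) (#|L|%:R : R) (c / (D + c)) => h b q; lra.
pose beta := c / 4; pose kap := 2 ^+ (i.+1 + 4) * D ^+ 2 / c.
have kap_gt0 : 0 < kap by rewrite divr_gt0 // mulr_gt0 ?exprn_gt0.
have beta_gt0 : 0 < beta by rewrite divr_gt0.
have kD_gt0 : 0 < kap + D by rewrite addr_gt0.
have [delta [t0 [B [/andP[d0 d1] t00 B0 IH]]]] := IHi beta (kap + D) beta_gt0 kD_gt0.
have cD_gt0 (k : R) : 0 < k -> 0 < c / (k * D) by move=> k0; rewrite divr_gt0 ?mulr_gt0.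
exists (Num.min delta (c / (8 * D))), (Num.min t0 (c / (16 * D))), (B + 2); split.
- by rewrite lt_min gt_min d0 d1 cD_gt0.
- by rewrite lt_min t00 cD_gt0.
- by rewrite addr_gt0.
move=> X G t t_gt0; rewrite le_min => /andP[tt0 tc] tM.
have [f' Hf'] := IH X G t t_gt0 tt0 tM.
set M : R := #|G|%:R in tM *.
(* At least t M picks give the link mass at least beta t M, and dividing by [t] restores both the
   total beta M and the codegree exponent |T| - 1. Since t M >= 1, [r] is at most 2 t M. *)
pose r := (Num.truncn (t * M)).+1.
have tM0 : 0 <= t * M by apply: le_trans tM.
have /andP[r1 r2] := truncn_itv tM0.
have rle : r%:R <= 2 * (t * M) by rewrite /r -natr1; lra.
pose f (w : {set X} -> R) Z := let s := run w beta kap t r Z in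
   if #|s.1| == r then f' (fun A => s.2 A / t) Z else low_degree w beta kap t G s.1 s.2.
exists f => w I sw sIG iI.
have inv := run_invariant beta D_gt0 t_gt0 kap_gt0 sw iI r.
set s := run w beta kap t r I in inv *.
have M0 : 0 <= M by [].
have shrink (x y : R) : x <= (1 - y) * M -> Num.min delta (c / (8 * D)) <= y ->
    x <= (1 - Num.min delta (c / (8 * D))) * M.
  by move=> h1 h2; apply: le_trans h1 _; rewrite ler_wpM2r // lerB.
have det (Z : {set X}) : s.1 \subset Z -> Z \subset I -> run w beta kap t r Z = s.
  exact: run_determined.
have [full|notfull] := eqVneq #|s.1| r; last first.
  exists s.1; split.
  - exact: ls_sub inv.
  - rewrite mulrDl -[leLHS]add0r lerD ?(mulr_ge0 (ltW B0) tM0) //.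
    by apply: le_trans rle; rewrite ler_nat (ls_card inv).
  move=> Z sZ ZI; rewrite /f (det Z sZ ZI) (negbTE notfull).
  have stop : forall x, ~~ eligible w beta kap t I s.1 s.2 x.
    by case: (ls_stop inv) => // E; rewrite E eqxx in notfull.
  split; first exact: sub_low_degree sIG inv stop.
  apply: (shrink _ (c / (8 * D))); last by rewrite ge_min lexx orbT.
  apply: (card_low_degree c_gt0 D_gt0 t_gt0 kap_gt0 beta_gt0 sw inv) => //.
    exact: subset_trans (ls_sub inv) sIG.
  by apply: le_trans rle; rewrite ler_nat (ls_card inv).
have sw' : spread i.+1 beta (kap + D) t G (fun A => s.2 A / t).
  split.
  - by move=> A; rewrite divr_ge0 ?(ls_ge0 inv) // ltW.
  - by move=> A; rewrite mulf_eq0 negb_or => /andP[/(ls_supp inv)].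
  - move=> T T0; rewrite /codegree -mulr_suml ler_pdivrMr // -mulrA -exprSr.
    by rewrite subn1 prednK ?card_gt0 //; apply: (ls_codeg inv).
  - rewrite /mass -mulr_suml ler_pdivlMr // -mulrA (mulrC _ t).
    by apply: le_trans (ls_low inv); rewrite full [leLHS]mulrC ler_pM2r // ltW.
have iI' : independent (fun A => s.2 A / t) I by move=> A /(ls_indep inv) ->; rewrite mul0r.
have [T [sTI cT HT]] := Hf' _ _ sw' sIG iI'.
exists (s.1 :|: T); split.
- by rewrite subUset (ls_sub inv).
- apply: (@le_trans _ _ (#|s.1|%:R + #|T|%:R)).
    by rewrite -natrD ler_nat leq_card_setU.
  by rewrite mulrDl addrC lerD // full.
move=> Z; rewrite subUset => /andP[sZ TZ] ZI.
rewrite /f (det Z sZ ZI) full eqxx; have [h1 h2] := HT Z TZ ZI; split=> //.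
by apply: (shrink _ delta) h2 _; rewrite ge_min lexx.
Qed.

(** * Balanced supersaturation *)

Fact ratio_leq (n k j : nat) : (j < k -> k <= n -> (k - j) * n <= (n - j) * k)%N.
Proof. nia. Qed.

Fact pair_ratio (n k : nat) : (1 < k -> k <= n ->
  n * n.-1 * k ^ 2 <= k * k.-1 * 2 * n ^ 2)%N.
Proof.
case: k => [|[|k]] // _; case: n => [|n] // kn; rewrite /= -!mulnn.
have : (n * k.+2 <= k.+1 * 2 * n.+1)%N by nia.
by move/(leq_mul (leqnn (n.+1 * k.+2))); lia.
Qed.

Section SubsetSampling.
Variables (R : realType) (T : finType) (k : nat).
Let n := #|T|.
Hypotheses (k2 : (2 <= k)%N) (kn : (k <= n)%N).

Definition samples : {set {set T}} := [set U : {set T} | #|U| == k].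

Lemma card_samples_above (W : {set T}) : (#|W| <= k)%N ->
  #|[set U in samples | W \subset U]| = 'C(n - #|W|, k - #|W|).
Proof.
move=> Wk; have cC : #|~: W| = (n - #|W|)%N by rewrite /n -(cardsC W) addKn.
rewrite -cC -cards_draws.
have inj : {in [set U in samples | W \subset U] &, injective (fun U => U :\: W)}.
  move=> U U'; rewrite !inE => /andP[_ sU] /andP[_ sU'] E.
  by rewrite -(setID U W) -(setID U' W) E (setIidPr sU) (setIidPr sU').
rewrite -(card_in_imset inj); apply: eq_card => B; rewrite inE.
apply/imsetP/andP => [[U]|[sB /eqP cB]].
  rewrite !inE => /andP[/eqP cU sWU] ->; rewrite setDE subsetIr; split=> //.
  by rewrite -setDE cardsD (setIidPr sWU) cU.
have dBW : [disjoint W & B] by rewrite disjoint_sym disjoints_subset.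
exists (W :|: B); last first.
  rewrite setDUl setDv set0U; apply/esym/setDidPl.
  by rewrite disjoint_sym.
rewrite !inE subsetUl andbT.
have /eqP -> : #|W :|: B| == (#|W| + #|B|)%N by rewrite (leq_card_setU W B).
by rewrite cB subnKC.
Qed.

Let p : R := k%:R / n%:R.
Let n_gt0 : (0 : R) < n%:R. Proof. by rewrite ltr0n (leq_trans _ kn) // ltnW. Qed.

Lemma bin_sub_le j : (j <= k)%N -> 'C(n - j, k - j)%:R <= p ^+ j * 'C(n, k)%:R.
Proof.
elim: j => [|j IHj] jk; first by rewrite !subn0 expr0 mul1r.
have jn : (j < n)%N := leq_trans jk kn.
have nj_gt0 : (0 : R) < (n - j)%:R by rewrite ltr0n subn_gt0.
rewrite -(ler_pM2l nj_gt0).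
have -> : (n - j)%:R * 'C(n - j.+1, k - j.+1)%:R = (k - j)%:R * 'C(n - j, k - j)%:R :> R.
  rewrite -!natrM; congr _%:R; have := mul_bin_diag (n - j) (k - j.+1).
  by rewrite subnSK // -subnS.
apply: (@le_trans _ _ ((n - j)%:R * p * (p ^+ j * 'C(n, k)%:R))); last first.
  by rewrite exprS -!mulrA.
apply: ler_pM => //; last exact: IHj (ltnW jk).
rewrite /p mulrA ler_pdivlMr // -!natrM ler_nat.
exact: ratio_leq.
Qed.

Lemma sample_le (W : {set T}) :
  #|[set U in samples | W \subset U]|%:R <= p ^+ #|W| * #|samples|%:R.
Proof.
rewrite [#|samples|]card_draws; have [Wk|kW] := leqP #|W| k.
  by rewrite card_samples_above // bin_sub_le.
rewrite (_ : [set U in samples | W \subset U] = set0) ?cards0.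
  by rewrite mulr_ge0 ?exprn_ge0 ?divr_ge0.
apply/setP => U; rewrite !inE; apply/negP => /andP[/eqP cU /subset_leq_card].
by rewrite cU leqNgt kW.
Qed.

Lemma sample_pair_ge (W : {set T}) : #|W| = 2 ->
  p ^+ 2 / 2 * #|samples|%:R <= #|[set U in samples | W \subset U]|%:R.
Proof.
move=> W2; rewrite [#|samples|]card_draws card_samples_above W2 //.
have n1_gt0 : (0 : R) < (n * n.-1)%:R.
  by rewrite ltr0n muln_gt0 -subn1 subn_gt0 (leq_trans k2 kn) andbT ltnW // (leq_trans k2 kn).
rewrite -(ler_pM2l n1_gt0).
have -> : (n * n.-1)%:R * 'C(n - 2, k - 2)%:R = (k * k.-1)%:R * 'C(n, k)%:R :> R.
  rewrite -!natrM; congr _%:R.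
  have := mul_bin_diag n k.-1; have := mul_bin_diag n.-1 k.-2.
  have -> : k.-1.+1 = k by rewrite prednK // ltnW.
  have -> : k.-2.+1 = k.-1 by move: k2; case: (k) => [|[|]].
  by rewrite -!subn1 -!subnDA => h1 h2; rewrite -mulnA h1 mulnCA h2 mulnCA mulnA mulnC mulnA.
rewrite mulrA ler_pM2r; last by rewrite ltr0n bin_gt0.
rewrite /p expr_div_n mulrA ler_pdivrMr // mulrA ler_pdivrMr ?exprn_gt0 //.
by rewrite -!natrX -!natrM ler_nat pair_ratio.
Qed.

End SubsetSampling.

Lemma copy_free_inside (R : realType) (V T : finType) (F : {set {set V}}) (U : {set T}) (b : R) :
    (forall G : {set {set 'I_#|U|}}, simple_graph G -> copy_free F G -> #|G|%:R <= b) ->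
  forall H : {set {set T}}, simple_graph H -> (forall g, g \in H -> g \subset U) ->
    copy_free F H -> #|H|%:R <= b.
Proof.
move=> HG H sH HU fH.
pose io (i : 'I_#|U|) : T := enum_val i.
have ioI : injective io := @enum_val_inj _ _.
pose G := [set g : {set 'I_#|U|} | io @: g \in H].
have onto g : g \in H -> exists2 h, h \in G & io @: h = g.
  move=> gH; have E : io @: [set i | io i \in g] = g.
    apply/setP => x; apply/imsetP/idP => [[i]|xg]; first by rewrite inE => ig ->.
    have xU : x \in U := subsetP (HU g gH) x xg.
    by exists (enum_rank_in xU x); rewrite ?inE /io enum_rankK_in.
  by exists [set i | io i \in g] => //; rewrite inE E.
have GH : [set io @: (g : {set _}) | g in G] = H.
  apply/setP => g; apply/imsetP/idP => [[h]|/onto[h hG <-]]; last by exists h.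
  by rewrite inE => hH ->.
have cG : #|G| = #|H| by rewrite -[in RHS]GH card_imset //; apply: imset_inj.
rewrite -cG; apply: HG.
  by apply/forall_inP => g; rewrite inE => /(forall_inP sH); rewrite card_imset.
apply: contraLR fH => /copy_freePn[f fI sf]; apply/copy_freePn.
exists [ffun x => io (f x)]; first by move=> x y; rewrite !ffunE => /ioI/fI.
apply/subsetP => _ /imsetP[g gF ->].
have -> : [ffun x => io (f x)] @: g = io @: (f @: g).
  by rewrite -imset_comp; apply: eq_imset => x; rewrite ffunE.
by have := subsetP sf _ (imset_f _ gF); rewrite inE.
Qed.

Fact le_double_of_lt (R : realFieldType) (x z : R) : 2 <= x -> x < z + 1 -> x <= 2 * z.
Proof. lra. Qed.

Fact supersaturation_arith (R : realFieldType) (P q g b m : R) :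
  0 < P -> 0 < q -> 4 * b <= g * q -> q / 2 * P * g <= P * b + q * P * (2 * m) ->
  g <= 2 ^+ 3 * m.
Proof.
move=> P0 q0 h1 h2.
have {}h2 : q / 2 * g <= b + q * (2 * m).
  by rewrite -(ler_pM2l P0); lra.
rewrite -(ler_pM2l q0); lra.
Qed.

Lemma double_count (R : pzSemiRingType) (I J : finType) (A : {set I}) (B : {set J})
    (r : I -> J -> bool) :
  \sum_(i in A) #|[set j in B | r i j]|%:R = \sum_(j in B) #|[set i in A | r i j]|%:R :> R.
Proof.
have E (I' J' : finType) (A' : {set I'}) (B' : {set J'}) (r' : I' -> J' -> bool) i :
    #|[set j in B' | r' i j]|%:R = \sum_(j in B') (r' i j)%:R :> R.
  rewrite -sum1_card natr_sum big_mkcond [RHS]big_mkcond; apply: eq_bigr => j _.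
  by rewrite inE; case: (j \in B'); case: (r' i j).
under eq_bigr do rewrite (E _ _ A B r); under [RHS]eq_bigr do rewrite (E _ _ B A (fun j i => r i j)).
exact: exchange_big.
Qed.

Section Supersaturation.
Variables (R : realType) (V T : finType) (F : {set {set V}}) (gamma b : R) (k : nat).
Let n := #|T|.
Let e := #|F|.
Hypotheses (sF : simple_graph F) (F_gt0 : (0 < #|F|)%N) (gamma_ge0 : 0 <= gamma)
  (hgamma : forall S : {set {set V}}, S \subset F -> S != set0 ->
     gamma * (#|S|%:R - 1) <= #|cover S|%:R - 2)
  (k2 : (2 <= k)%N) (kn : (k <= n)%N)
  (hb : forall G : {set {set 'I_k}}, simple_graph G -> copy_free F G -> #|G|%:R <= b).
Variable G : {set {set T}}.
Hypotheses (sG : simple_graph G) (dense : 4 * b <= #|G|%:R * (k%:R / n%:R) ^+ 2).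

Let p : R := k%:R / n%:R.
Let t : R := p `^ gamma.

Let n_gt0 : (0 : R) < n%:R. Proof. by rewrite ltr0n (leq_trans _ kn) // ltnW. Qed.
Let p_gt0 : 0 < p. Proof. by rewrite divr_gt0 // ltr0n ltnW. Qed.
Let p_le1 : p <= 1. Proof. by rewrite ler_pdivrMr // mul1r ler_nat. Qed.
Let t_gt0 : 0 < t. Proof. exact: powR_gt0. Qed.
Let t_le1 : t <= 1.
Proof.
have : p `^ gamma <= 1 `^ gamma by rewrite ge0_ler_powR // nnegrE ltW.
by rewrite powR1.
Qed.

Definition is_copy (A : {set {set T}}) : bool :=
  [exists f : {ffun V -> T}, injectiveb f && (A == edge_image f F)].

(** Units so fine that an integer slack of 1 is at most half of every threshold L t^(|S| - 1) in
    use. *)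
Let L : nat := Num.bound (2 / t ^+ e).

Let L_large : 2 <= L%:R * t ^+ e.
Proof.
have h : 0 <= 2 / t ^+ e by rewrite divr_ge0 ?exprn_ge0 // ltW.
by rewrite -ler_pdivrMr ?exprn_gt0 // ltW // archi_boundP.
Qed.

(* Multisets of copies, with multiplicities counted in units of [1 / L]. *)
Let mdeg (m : {ffun {set {set T}} -> 'I_L.+1}) (S : {set {set T}}) : nat :=
  \sum_(A : {set {set T}} | S \subset A) m A.

Let feasible (m : {ffun {set {set T}} -> 'I_L.+1}) : bool :=
  [forall A : {set {set T}}, (m A != ord0) ==> is_copy A && (A \subset G)] &&
  [forall S : {set {set T}}, (S != set0) ==> ((mdeg m S)%:R <= L%:R * t ^+ (#|S| - 1) :> R)].

Let copy_card A : is_copy A -> #|A| = e.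
Proof. by case/existsP => f /andP[/injectiveP fI /eqP ->]; rewrite card_edge_image. Qed.

(** Take a feasible multiset of largest total multiplicity: if no nonempty subset of [A] were
    saturated, one more [A] could be added. The cap [L] on multiplicities does not interfere, as
    singletons have threshold L. *)
Let exists_saturating : exists2 m, feasible m & forall A, is_copy A -> A \subset G ->
  exists S : {set {set T}}, [/\ S != set0, S \subset A & L%:R * t ^+ (#|S| - 1) < (mdeg m S)%:R + 1].
Proof.
pose m0 : {ffun {set {set T}} -> 'I_L.+1} := [ffun=> ord0].
have fm0 : feasible m0.
  apply/andP; split; first by apply/forallP => A; rewrite ffunE eqxx.
  apply/forallP => S; apply/implyP => S0; rewrite /mdeg big1 => [|A _]; last by rewrite ffunE.
  by rewrite mulr_ge0 ?exprn_ge0 // ltW.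
case: (arg_maxnP (fun m : {ffun {set {set T}} -> 'I_L.+1} => \sum_A (m A : nat))%N fm0) => m fm maxm.
exists m => // A cA sAG; have /andP[/forallP f1 /forallP f2] := fm.
have [/existsP[S /and3P[? ? ?]]|] := boolP [exists S : {set {set T}},
    [&& S != set0, S \subset A & L%:R * t ^+ (#|S| - 1) < (mdeg m S)%:R + 1]].
  by exists S.
rewrite negb_exists => /forallP none; exfalso.
have {}none S : S != set0 -> S \subset A -> (mdeg m S)%:R + 1 <= L%:R * t ^+ (#|S| - 1).
  by move=> S0 sSA; have := none S; rewrite S0 sSA /= -leNgt.
have A0 : A != set0 by rewrite -card_gt0 (copy_card cA).
have mA : (m A < L)%N.
  have [g gA] := set0Pn _ A0.
  have := none [set g]; rewrite -cards_eq0 cards1 sub1set gA expr0 mulr1 => /(_ isT isT).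
  rewrite natr1 ler_nat; apply: leq_trans; rewrite ltnS /mdeg.
  by rewrite (bigD1 A) ?sub1set //= leq_addr.
pose m' : {ffun {set {set T}} -> 'I_L.+1} := [ffun B => if B == A then inord (m A).+1 else m B].
have m'A : m' A = (m A).+1 :> nat by rewrite ffunE eqxx inordK.
have m'N B : B != A -> m' B = m B by move=> BA; rewrite ffunE (negbTE BA).
have sumE (P : pred {set {set T}}) : (\sum_(B | P B) m' B = \sum_(B | P B) m B + P A)%N.
  have [PA|PA] := boolP (P A).
    rewrite (bigD1 A) //= [in RHS](bigD1 A) //= m'A addn1 addSn; congr (_ + _).+1.
    by apply: eq_bigr => B /andP[_ /m'N ->].
  rewrite addn0; apply: eq_bigr => B PB; rewrite m'N //.
  by apply: contraNneq PA => <-.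
have fm' : feasible m'.
  apply/andP; split.
    apply/forallP => B; have [->|BA] := eqVneq B A; first by rewrite cA sAG implybT.
    by rewrite m'N.
  apply/forallP => S; apply/implyP => S0; rewrite /mdeg sumE.
  have [sSA|_] := boolP (S \subset A); first by rewrite natrD none.
  by rewrite addn0; have := f2 S; rewrite S0.
by have := maxm _ fm'; rewrite (sumE xpredT) /= addn1 ltnn.
Qed.

(** Every copy in [G] contains a saturated set, so in a random [k]-set [U] deleting one edge from
    each saturated set inside [U] leaves at most [b] edges. The hypothesis on [gamma] gives p^|cover
    S| <= p^2 t^(|S| - 1), and saturation bounds t^(|S| - 1) by 2 codegree w S, so the expected
    number of deletions is p^2 times a multiple of the mass. The factor p^2 cancels against the
    expected number of edges in [U]. *)
Theorem supersaturation : exists2 w : {set {set T}} -> R,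
  spread e (2 ^- (e + 3)) 1 t G w & forall A, w A != 0 -> is_copy A.
Proof.
have [m /andP[/forallP f1 /forallP f2] satm] := exists_saturating.
have L0 : (0 : R) < L%:R.
  rewrite ltr0n lt0n; apply: contraTneq L_large => ->.
  by rewrite mul0r -ltNge.
pose w A : R := (m A : nat)%:R / L%:R.
have w0 A : 0 <= w A by rewrite divr_ge0.
have wN A : w A != 0 -> is_copy A /\ A \subset G.
  move=> wA; apply/andP; apply: (implyP (f1 A)); apply: contraNneq wA => mA.
  by rewrite /w mA mul0r.
have codE S : codegree w S = (mdeg m S)%:R / L%:R.
  by rewrite /codegree /w -mulr_suml natr_sum.
have wsupp A : w A != 0 -> #|A| = e by move=> /wN[/copy_card].
exists w; last by move=> A /wN[].
split=> //; first by move=> A /wN[/copy_card].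
  move=> S S0; rewrite codE ler_pdivrMr // mul1r mulrC.
  by apply: (implyP (f2 S)).
pose sat (S : {set {set T}}) := [&& S != set0, L%:R * t ^+ (#|S| - 1) < (mdeg m S)%:R + 1,
  [exists A, is_copy A && (S \subset A)] & S \subset G].
have sat_codeg S : sat S -> t ^+ (#|S| - 1) <= 2 * codegree w S.
  case/and4P => S0 h /existsP[A /andP[cA sSA]] _; rewrite codE mulrA ler_pdivlMr //.
  have big : 2 <= L%:R * t ^+ (#|S| - 1).
    apply: le_trans L_large _; rewrite ler_pM2l // ler_wiXn2l ?(ltW t_gt0) //.
    by rewrite (leq_trans (leq_subr _ _)) // -(copy_card cA) subset_leq_card.
  by rewrite mulrC; apply: le_double_of_lt big h.
have sat_cover S : sat S -> p ^+ #|cover S| <= p ^+ 2 * t ^+ (#|S| - 1).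
  case/and4P => S0 _ /existsP[A /andP[/existsP[f /andP[/injectiveP fI /eqP AE]] sSA]] _.
  pose S' := [set g in F | f @: (g : {set V}) \in S].
  have SE : S = edge_image f S'.
    apply/setP => g; apply/idP/imsetP => [gS|[h]]; last by rewrite inE => /andP[_ ?] ->.
    have := subsetP sSA g gS; rewrite AE => /imsetP[h hF gE].
    by exists h => //; rewrite inE hF -gE.
  have sS' : S' \subset F by apply/subsetP => g; rewrite inE => /andP[].
  have cS : #|S| = #|S'| by rewrite SE card_edge_image.
  have cc : #|cover S| = #|cover S'|.
    rewrite -(card_imset (mem (cover S')) fI); apply: eq_card => x.
    rewrite SE; apply/bigcupP/imsetP => [[_ /imsetP[g gS ->] /imsetP[y yg ->]]|[y /bigcupP[g gS yg] ->]].
      by exists y => //; apply/bigcupP; exists g.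
    by exists (f @: (g : {set V})); apply: imset_f.
  have S'0 : S' != set0 by rewrite -card_gt0 -cS card_gt0.
  have h := hgamma sS' S'0; rewrite cS cc.
  have c1 : (0 < #|S'|)%N by rewrite card_gt0.
  have := powRrM p gamma (#|S'| - 1)%:R; rewrite powR_mulrn ?powR_ge0 // => <-.
  have -> : p ^+ 2 = p `^ 2 by rewrite -powR_mulrn // ltW.
  rewrite -powRD; last by rewrite (gt_eqF p_gt0) implybT.
  rewrite -powR_mulrn ?(ltW p_gt0) //; apply: ger_powR; first by rewrite p_gt0.
  by rewrite natrB // addrC -lerBrDr.
have small_part (U : {set T}) : U \in samples T k ->
    #|[set g in G | g \subset U]|%:R <= b + #|[set S | sat S && (cover S \subset U)]|%:R.
  rewrite inE => /eqP cU.
  pose GU := [set g in G | g \subset U].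
  pose QU := [set S | sat S && (cover S \subset U)].
  pose e0 (S : {set {set T}}) : {set T} := odflt set0 [pick g in S].
  have e0P S : sat S -> e0 S \in S.
    case/and4P => /set0Pn[g gS] _ _ _; rewrite /e0.
    by case: pickP => // /(_ g); rewrite gS.
  pose H := GU :\: (e0 @: QU).
  have sHG : H \subset G by apply/subsetP => g; rewrite !inE => /andP[_ /andP[]].
  have bH : #|H|%:R <= b.
    apply: (@copy_free_inside R V T F U).
    - by rewrite cU.
    - by apply/forall_inP => g /(subsetP sHG)/(forall_inP sG).
    - by move=> g; rewrite !inE => /andP[_ /andP[]].
    apply/negPn/negP => /copy_freePn[f fI sub].
    have cA : is_copy (edge_image f F).
      by apply/existsP; exists f; rewrite eqxx andbT; apply/injectiveP.
    have [S [S0 sSA hS]] := satm _ cA (subset_trans sub sHG).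
    have sS : sat S.
      rewrite /sat S0 hS (subset_trans sSA (subset_trans sub sHG)) andbT /=.
      by apply/existsP; exists (edge_image f F); rewrite cA.
    have := subsetP sub _ (subsetP sSA _ (e0P S sS)); rewrite inE => /andP[/negP[]].
    rewrite imset_f // inE sS; apply/bigcupsP => g gS.
    by have := subsetP sub _ (subsetP sSA _ gS); rewrite !inE => /andP[_ /andP[]].
  apply: (@le_trans _ _ (#|H|%:R + #|e0 @: QU|%:R)).
    rewrite -natrD ler_nat -(cardsID (e0 @: QU) GU) addnC leq_add2l.
    by apply: subset_leq_card; apply: subsetIr.
  by rewrite lerD // ler_nat leq_imset_card.
set P : R := #|samples T k|%:R.
have P_gt0 : 0 < P by rewrite ltr0n [#|_|]card_draws bin_gt0.
have sum1 : p ^+ 2 / 2 * P * #|G|%:R <= \sum_(U in samples T k) #|[set g in G | g \subset U]|%:R.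
  rewrite mulr_natr -sumr_const double_count; apply: ler_sum => g gG.
  by apply: sample_pair_ge => //; apply/eqP/(forall_inP sG).
have sum2 : \sum_(U in samples T k) #|[set S | sat S && (cover S \subset U)]|%:R
   <= p ^+ 2 * P * (2 * (2 ^+ e * mass w)).
  have -> : \sum_(U in samples T k) #|[set S | sat S && (cover S \subset U)]|%:R =
      \sum_(U in samples T k) #|[set S in [set S | sat S] | cover S \subset U]|%:R :> R.
    by apply: eq_bigr => U _; congr _%:R; apply: eq_card => S; rewrite !inE.
  rewrite double_count -(sum_codegree w0 wsupp) !mulr_sumr big_mkcond.
  apply: ler_sum => S _; have c0 : 0 <= codegree w S by apply: sumr_ge0.
  rewrite inE; case: ifP => sS; last first.
    apply: mulr_ge0; last exact: mulr_ge0.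
    by rewrite mulr_ge0 ?(ltW P_gt0) // exprn_ge0 // ltW.
  apply: le_trans (sample_le R k2 kn (cover S)) _.
  rewrite mulrAC ler_pM2r //; apply: le_trans (sat_cover S sS) _.
  by rewrite ler_pM2l ?exprn_gt0 // sat_codeg.
have key : p ^+ 2 / 2 * P * #|G|%:R <= P * b + p ^+ 2 * P * (2 * (2 ^+ e * mass w)).
  apply: (le_trans sum1); apply: (le_trans (ler_sum _ small_part)).
  by rewrite big_split /= sumr_const -[in X in X + _]mulr_natl lerD.
have {}key : #|G|%:R <= 2 ^+ 3 * (2 ^+ e * mass w).
  apply: (supersaturation_arith P_gt0 _ dense key); exact: exprn_gt0.
by rewrite mulrC ler_pdivrMr ?exprn_gt0 // exprD mulrA [leRHS]mulrC (mulrC (mass w)).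
Qed.

End Supersaturation.

(** * Counting copy-free graphs *)

Lemma powR_le_self (R : realType) (a x y : R) : 0 < a -> 0 <= x -> 0 <= y ->
  x `^ a <= y `^ a -> x <= y.
Proof.
move=> a0 x0 y0 h; rewrite leNgt; apply/negP => yx.
have := gt0_ltr_powR a0; rewrite /= => /(_ y x); rewrite !nnegrE => /(_ y0 x0 yx).
by rewrite ltNge h.
Qed.

Lemma powR_inv_base (R : realType) (x r : R) : 0 < x -> x^-1 `^ r = x `^ (- r).
Proof. by move=> x0; rewrite -powR_inv1 ?ltW // -powRrM mulN1r. Qed.

Section OneStep.
Variables (R : realType) (V : finType) (F : {set {set V}}) (alpha gamma C : R).
Hypotheses (sF : simple_graph F) (F_gt0 : (0 < #|F|)%N)
  (alpha2 : alpha < 2) (gamma_gt : 2 - alpha < gamma) (gamma1 : gamma < 1)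
  (hgamma : forall S : {set {set V}}, S \subset F -> S != set0 ->
     gamma * (#|S|%:R - 1) <= #|cover S|%:R - 2)
  (C1 : 1 <= C)
  (hC : forall n (G : {set {set 'I_n}}), (0 < n)%N -> simple_graph G -> copy_free F G ->
       #|G|%:R <= C * n%:R `^ alpha).
Let mu := 2 - alpha.
Let rho := gamma / mu.
Let mu_gt0 : 0 < mu. Proof. by rewrite subr_gt0. Qed.
Let gamma_gt0 : 0 < gamma. Proof. exact: lt_trans gamma_gt. Qed.
Let alpha_gt1 : 1 < alpha.
Proof. by have := gamma_gt; have := gamma1; rewrite /mu; lra. Qed.
Let rho_gt1 : 1 < rho. Proof. by rewrite ltr_pdivlMr // mul1r. Qed.

(** Sampling at density p of order (4 C / K)^(1 / mu) is just dense enough for a random part of [G]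
    to exceed the extremal bound by a constant factor. Then t = p^gamma is O(K^-rho), and t |G| is
    the fingerprint size. *)
Lemma one_step : exists K0 c4 delta : R, [/\ 1 <= K0, 0 < c4, 0 < delta < 1 &
  forall n (G : {set {set 'I_n}}), (0 < n)%N -> simple_graph G ->
    let K := #|G|%:R / n%:R `^ alpha in K0 < K ->
  exists f : {set {set 'I_n}} -> {set {set 'I_n}}, forall I : {set {set 'I_n}},
    I \subset G -> copy_free F I ->
    exists T : {set {set 'I_n}}, [/\ T \subset I, #|T|%:R <= c4 * K `^ (1 - rho) * n%:R `^ alpha,
      I \subset f T & #|f T|%:R <= (1 - delta) * #|G|%:R]].
Proof.
have c_gt0 : 0 < (2 : R) ^- (#|F| + 3) by rewrite invr_gt0 exprn_gt0.
have [delta [t0 [B [d01 t00 B0 Hc]]]] := container #|F|.-1 c_gt0 (@ltr01 R).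
have C0 : 0 < C := lt_le_trans ltr01 C1.
have C4 : 1 <= 4 * C by apply: le_trans C1 _; rewrite ler_pMl // ler1n.
pose c3 : R := 2 `^ gamma * (4 * C) `^ rho.
have c3_gt0 : 0 < c3 by rewrite mulr_gt0 ?powR_gt0 ?mulr_gt0.
(* The summands ensure, in turn, K > 1; 2 z <= 1 and hence k <= n; and t <= t0. *)
pose K0 := 1 + 4 * C * 2 `^ mu + (c3 / t0) `^ rho^-1.
exists K0, (B * c3), delta; split=> //.
- by rewrite /K0 -addrA lerDl addr_ge0 ?mulr_ge0 ?powR_ge0 // ltW.
- exact: mulr_gt0.
move=> n G n_gt0 sG K K0K.
have nR_gt0 : (0 : R) < n%:R by rewrite ltr0n.
have n1 : (1 : R) <= n%:R by rewrite ler1n.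
have na_gt0 : 0 < n%:R `^ alpha by apply: powR_gt0.
have K_gt1 : 1 < K.
  apply: le_lt_trans K0K; rewrite /K0 -addrA lerDl.
  by rewrite addr_ge0 ?mulr_ge0 ?powR_ge0 // ltW.
have K_gt0 : 0 < K := lt_trans ltr01 K_gt1.
have MK : #|G|%:R = K * n%:R `^ alpha by rewrite /K divfK // gt_eqF.
have K2 : 4 * C * 2 `^ mu <= K.
  apply: le_trans (ltW K0K); rewrite /K0 addrAC lerDr.
  by rewrite addr_ge0 ?powR_ge0.
have K3 : c3 / t0 <= K `^ rho.
  have h : (c3 / t0) `^ rho^-1 <= K.
    by apply: le_trans (ltW K0K); rewrite /K0 lerDr addr_ge0 // !mulr_ge0 ?powR_ge0 // ltW.
  have rho0 : 0 < rho := lt_trans ltr01 rho_gt1.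
  have -> : c3 / t0 = ((c3 / t0) `^ rho^-1) `^ rho.
    by rewrite -powRrM mulVf ?gt_eqF // powRr1 // ltW // divr_gt0.
  by apply: ge0_ler_powR; rewrite ?nnegrE ?powR_ge0 // ltW.
have Kn : K <= n%:R `^ mu.
  rewrite /K ler_pdivrMr // -powRD ?subrK; last by rewrite (gt_eqF nR_gt0) implybT.
  by rewrite powR_mulrn ?ler0n // -natrX ler_nat; have := simple_graph_card sG; rewrite card_ord.
pose x0 := 4 * C / K.
clearbody K; have x0_gt0 : 0 < x0 by rewrite divr_gt0 ?mulr_gt0.
pose z := x0 `^ mu^-1.
have z_gt0 : 0 < z by apply: powR_gt0.
have zmu : z `^ mu = x0 by rewrite /z -powRrM mulVf ?gt_eqF // powRr1 // ltW.
pose y := n%:R * z.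
have y1 : 1 <= y.
  apply: (powR_le_self mu_gt0) => //; first by rewrite mulr_ge0 // ltW.
  rewrite powR1 /y powRM ?ler0n ?(ltW z_gt0) // zmu /x0 mulrA ler_pdivlMr // mul1r.
  apply: le_trans Kn _; by rewrite ler_pMr ?powR_gt0.
have z2 : 2 * z <= 1.
  apply: (powR_le_self mu_gt0) => //; first by rewrite mulr_ge0 // ltW.
  rewrite powR1 powRM ?(ltW z_gt0) // zmu /x0 mulrA ler_pdivrMr // mul1r mulrC.
  by [].
have y_ge0 : 0 <= y := le_trans ler01 y1.
have /andP[k1 k2] := truncn_itv y_ge0.
pose k := (Num.truncn y).+1.
have ky : k%:R <= 2 * y by rewrite /k -natr1 mulr_natl mulr2n lerD.
have kge2 : (2 <= k)%N by rewrite /k ltnS truncn_gt0.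
have kn : (k <= n)%N.
  rewrite -(ler_nat R); apply: le_trans ky _; rewrite /y mulrCA -[leRHS]mulr1.
  by rewrite ler_pM2l.
pose p : R := k%:R / n%:R.
have p_gt0 : 0 < p by rewrite divr_gt0 // ltr0n.
have zp : z <= p by rewrite ler_pdivlMr // mulrC ltW.
have p2z : p <= 2 * z by rewrite ler_pdivrMr // -mulrA (mulrC z).
have hb (H : {set {set 'I_k}}) : simple_graph H -> copy_free F H -> #|H|%:R <= C * k%:R `^ alpha.
  exact: hC.
have dense : 4 * (C * k%:R `^ alpha) <= #|G|%:R * (k%:R / #|'I_n|%:R) ^+ 2.
  rewrite card_ord -/p MK -(powR_mulrn 2 (ltW p_gt0)).
  have -> : (2%:R : R) = mu + alpha by rewrite subrK.
  rewrite powRD; last by rewrite (gt_eqF p_gt0) implybT.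
  have -> : k%:R = p * n%:R by rewrite divfK // gt_eqF.
  rewrite powRM ?(ltW p_gt0) //.
  have xm : x0 <= p `^ mu.
    by rewrite -zmu ge0_ler_powR ?nnegrE // ltW.
  have : 4 * C <= K * p `^ mu by rewrite [leRHS]mulrC -ler_pdivrMr.
  have : 0 < p `^ alpha * n%:R `^ alpha by rewrite mulr_gt0 // powR_gt0.
  move: (p `^ alpha) (n%:R `^ alpha) (p `^ mu) => u1 u2 u3 h1 h2.
  have : (u1 * u2) * (4 * C) <= (u1 * u2) * (K * u3) by rewrite ler_pM2l.
  by congr (_ <= _); ring.
pose t := p `^ gamma.
have t_gt0 : 0 < t by apply: powR_gt0.
have t_le : t <= c3 * K `^ (- rho).
  have -> : c3 * K `^ (- rho) = (2 * z) `^ gamma.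
    rewrite powRM ?(ltW z_gt0) // /c3 -mulrA; congr (_ * _).
    rewrite /z -powRrM (mulrC mu^-1) -/rho -(powR_inv_base _ K_gt0) -powRM //.
      by rewrite mulr_ge0 // ltW.
    by rewrite invr_ge0 ltW.
  have z20 : 0 <= 2 * z by rewrite mulr_ge0 ?ltW.
  have p0 := ltW p_gt0; exact: (ge0_ler_powR (ltW gamma_gt0) p0 z20 p2z).
have tt0 : t <= t0.
  apply: le_trans t_le _; rewrite powRN ler_pdivrMr ?powR_gt0 //.
  by rewrite mulrC -ler_pdivrMr.
(* Holds because p >= 1 / n, |G| >= n^alpha and gamma < 1 < alpha. *)
have tM : 1 <= t * #|G|%:R.
  rewrite MK; apply: (@le_trans _ _ (n%:R `^ (- gamma) * n%:R `^ alpha)).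
    rewrite -powRD; last by rewrite (gt_eqF nR_gt0) implybT.
    have e0 : 0 <= - gamma + alpha.
      by rewrite addrC subr_ge0 ltW // (lt_trans gamma1).
    by have := ler_powR n1 e0; rewrite powRr0.
  rewrite -(powR_inv_base _ nR_gt0).
  rewrite ler_pM ?powR_ge0 //.
    have np : n%:R^-1 <= p by rewrite /p -[leLHS]mul1r ler_pM2r ?invr_gt0 // ler1n.
    have ni0 : 0 <= n%:R^-1 :> R by rewrite invr_ge0.
    exact: (ge0_ler_powR (ltW gamma_gt0) ni0 (ltW p_gt0) np).
  by rewrite ler_pMl // ltW.
have [f Hf] := Hc _ G t t_gt0 tt0 tM.
have [w sw wcopy] := supersaturation F_gt0 (ltW gamma_gt0) hgamma kge2
  (leq_trans kn (eq_leq (esym (card_ord n)))) hb sG dense.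
exists (f w) => I sIG fI.
have iI : independent w I.
  move=> A sAI; apply/eqP/negPn/negP => /wcopy/existsP[g /andP[/injectiveP gI /eqP AE]].
  by move: fI; apply/negP; apply/copy_freePn; exists g; rewrite -?AE.
have [|T [sTI cT HT]] := Hf w I _ sIG iI.
  by move: sw; rewrite card_ord -/p -/t prednK.
have [h1 h2] := HT T (subxx T) sTI.
exists T; split=> //; apply: le_trans cT _.
rewrite -mulrA -mulrA ler_pM2l // MK mulrA.
have -> : K `^ (1 - rho) = K `^ (- rho) * K.
  rewrite -[X in _ * X]powRr1 ?(ltW K_gt0) // -powRD; last by rewrite (gt_eqF K_gt0) implybT.
  by rewrite addrC.
by rewrite !mulrA ler_pM2r // ler_pM2r.
Qed.

End OneStep.

(** Exponential Markov bound: every counted [T] has exp (L s) exp (- L |T|) >= 1, and the sum of exp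
    (- L |T|) over all subsets factorises. *)
Lemma card_small_subsets (R : realType) (U : finType) (G : {set U}) (L s : R) : 0 <= L ->
  #|[set T : {set U} | T \subset G & #|T|%:R <= s]|%:R <= expR (L * s + expR (- L) * #|G|%:R).
Proof.
move=> L0; rewrite expRD.
apply: (@le_trans _ _ (expR (L * s) * \sum_(T : {set U} | T \subset G) \prod_(x in T) expR (- L))).
  rewrite mulr_sumr -sum1_card natr_sum big_mkcond [leRHS]big_mkcond /=.
  apply: ler_sum => T _; rewrite inE; case: (T \subset G) => //=.
  case: ifP => [Ts|_]; last by rewrite mulr_ge0 ?prodr_ge0 // => *; rewrite expR_ge0.
  rewrite prodr_const -expRM_natl -expRD -[leLHS]expR0 ler_expR mulrN subr_ge0.
  by rewrite mulrC ler_wpM2l.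
rewrite ler_pM2l ?expR_gt0 //; apply: le_trans (sum_prod_subsets_le _) _ => [x _|].
  exact: expR_ge0.
by rewrite sumr_const mulr_natr.
Qed.

Lemma ln_le_powR (R : realType) (x eta : R) : 0 < eta -> 1 <= x -> ln x <= x `^ eta / eta.
Proof.
move=> eta0 x1; have x0 : 0 < x := lt_le_trans ltr01 x1.
rewrite ler_pdivlMr // mulrC -ln_powR.
apply: le_trans (_ : ln (1 + (x `^ eta - 1)) <= _); first by rewrite addrC subrK.
apply: le_trans (le_ln1Dx _) _; last by rewrite gerBl.
by rewrite ltrBrDr addNr powR_gt0.
Qed.

Section Iteration.
Variables (R : realType) (K0 c delta rho : R).
Hypotheses (K01 : 1 <= K0) (c_gt0 : 0 < c) (delta01 : 0 < delta < 1) (rho_gt1 : 1 < rho).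

(** Half of the margin rho - 1; the other half absorbs the logarithm in the number of fingerprints.
    These constants precede the ground set and the scale [N], hence do not depend on n. *)
Definition container_rate : R := (rho - 1) / 2.
Let eta := container_rate.
Definition container_cost : R := c * (1 + eta) / eta + 1.
(** Chosen so that the change of gain K^-eta, when K is replaced by (1 - delta) K, equals the price
    container_cost K^-eta of one step. *)
Definition container_gain : R := container_cost / ((1 - delta) `^ (- eta) - 1).
Definition container_const : R := K0 + container_gain * ((1 - delta) * K0) `^ (- eta).

Variables (U : finType) (P : pred {set U}) (N : R) (G0 : {set U}).
Hypotheses (N_gt0 : 0 < N)
  (step : forall G : {set U}, G \subset G0 -> let K := #|G|%:R / N in K0 < K ->
     exists f : {set U} -> {set U}, forall I : {set U}, I \subset G -> P I ->
     exists T : {set U}, [/\ T \subset I, #|T|%:R <= c * K `^ (1 - rho) * N,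
       I \subset f T & #|f T|%:R <= (1 - delta) * #|G|%:R]).

Definition members (G : {set U}) := [set I : {set U} | I \subset G & P I].

Lemma card_members_step (G : {set U}) (f : {set U} -> {set U}) (s m b L : R) :
    0 <= L -> 0 <= b ->
    (forall I : {set U}, I \subset G -> P I -> exists T : {set U}, [/\ T \subset I, #|T|%:R <= s,
       I \subset f T & #|f T|%:R <= m]) ->
    (forall G' : {set U}, G' \subset G -> #|G'|%:R <= m -> #|members G'|%:R <= b) ->
  #|members G|%:R <= expR (L * s + expR (- L) * #|G|%:R) * b.
Proof.
move=> L0 b0 Hf Hm; set TT := [set T : {set U} | T \subset G & #|T|%:R <= s].
apply: (@le_trans _ _ (#|TT|%:R * b)); last first.
  by rewrite ler_wpM2r //; apply: card_small_subsets.
apply: (@le_trans _ _ (\sum_(T in TT) \sum_(I in members G) ((I \subset f T) && (#|f T|%:R <= m))%:R)).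
  rewrite exchange_big /= -sum1_card natr_sum; apply: ler_sum => I.
  rewrite inE => /andP[sIG PI]; have [T [sTI Ts sIf fm]] := Hf I sIG PI.
  rewrite (bigD1 T) /=; last by rewrite inE Ts (subset_trans sTI).
  by rewrite sIf fm /= lerDl sumr_ge0.
rewrite mulr_natl -sumr_const; apply: ler_sum => T _.
have [fm|_] := boolP (#|f T|%:R <= m); last first.
  by rewrite big1 // => I _; rewrite andbF.
(* [f T] need not lie in [G]; the members of [G] inside [f T] are members of the intersection. *)
apply: le_trans (Hm (f T :&: G) (subsetIr _ _) _); last first.
  by apply: le_trans fm; rewrite ler_nat subset_leq_card ?subsetIl.
rewrite -sum1_card natr_sum [leLHS]big_mkcond [leRHS]big_mkcond /=.
apply: ler_sum => I _; rewrite !inE subsetI.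
by case: (I \subset G); case: (I \subset f T); case: (P I).
Qed.

Let eta_gt0 : 0 < eta.
Proof. by rewrite /eta /container_rate divr_gt0 // subr_gt0. Qed.
Let cost_gt0 : 0 < container_cost.
Proof. by rewrite addr_gt0 // divr_gt0 // mulr_gt0 // addr_gt0. Qed.
Let d_gt0 : 0 < 1 - delta.
Proof. by case/andP: delta01 => _; rewrite subr_gt0. Qed.
Let d_lt1 : 1 - delta < 1.
Proof. by case/andP: delta01 => h _; rewrite gtrBl. Qed.
Let den_gt0 : 0 < (1 - delta) `^ (- eta) - 1.
Proof.
rewrite subr_gt0 powRN invf_gt1 ?powR_gt0 //.
have := gt0_ltr_powR eta_gt0; rewrite /= => /(_ (1 - delta) 1).
by rewrite !nnegrE powR1 => -> //; rewrite ltW.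
Qed.
Let gain_gt0 : 0 < container_gain.
Proof. exact: divr_gt0. Qed.

Lemma powRN_le (x y : R) : 0 < x -> x <= y -> y `^ (- eta) <= x `^ (- eta).
Proof.
move=> x0 xy; have y0 := lt_le_trans x0 xy.
rewrite !powRN lef_pV2 ?posrE ?powR_gt0 //.
exact: (ge0_ler_powR (ltW eta_gt0) (ltW x0) (ltW y0) xy).
Qed.

(** The potential gain x^-eta pays for all steps at once, as their prices form a geometric series
    dominated by the lowest density. [x] only bounds the density from above, so a container may be
    much smaller than guaranteed; the range of [x] starts at (1 - delta) K0, since the last step
    starts above K0. *)
Lemma card_members_bound (G : {set U}) (x : R) : G \subset G0 -> (1 - delta) * K0 <= x ->
  #|G|%:R <= x * N -> #|members G|%:R <= expR (N * (container_const - container_gain * x `^ (- eta))).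
Proof.
have K0_gt0 : 0 < K0 := lt_le_trans ltr01 K01.
have kap_gt0 : 0 < (1 - delta) * K0 by rewrite mulr_gt0.
have [k] := ubnP #|G|; elim: k => // k IH in G x *; rewrite ltnS => kG sG kx Gx.
have [GK|KG] := leP #|G|%:R (K0 * N).
  apply: (@le_trans _ _ (expR #|G|%:R)).
    rewrite -[X in expR X]mulr1 expRM_natl; apply: (@le_trans _ _ (2 ^+ #|G|)).
      rewrite -natrX ler_nat -card_powerset subset_leq_card //.
      by apply/subsetP => I; rewrite !inE => /andP[].
    apply: lerXn2r; rewrite ?nnegrE ?expR_ge0 //.
    exact: expR_ge1Dx.
  rewrite ler_expR (le_trans GK) // mulrC ler_pM2l // lerBrDr lerD2l ler_pM2l //.
  exact: powRN_le.
set K : R := #|G|%:R / N.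
have KK0 : K0 < K by rewrite ltr_pdivlMr.
have K_gt0 := lt_trans K0_gt0 KK0.
have K1 : 1 <= K by rewrite ltW // (le_lt_trans K01).
have GE : #|G|%:R = K * N by rewrite divfK ?gt_eqF.
have [f Hf] := step sG KK0; rewrite -/K in Hf.
have Kx : K <= x by rewrite ler_pdivrMr.
(* This gives exp (- L) |G| = K^-eta N, and ln K <= K^eta / eta brings the term L times the
   fingerprint size to the same order. *)
pose L := (1 + eta) * ln K.
have L0 : 0 <= L by rewrite mulr_ge0 ?ln_ge0 // addr_ge0 // ltW.
pose b := expR (N * (container_const - container_gain * ((1 - delta) * K) `^ (- eta))).
have Hm (G' : {set U}) : G' \subset G -> #|G'|%:R <= (1 - delta) * #|G|%:R -> #|members G'|%:R <= b.
  move=> sG'; rewrite GE mulrA => cG'; apply: IH => //.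
  - rewrite (leq_trans _ kG) // -(ltr_nat R) (le_lt_trans cG') // GE ltr_pM2r // gtr_pMl //.
  - exact: subset_trans sG.
  - by rewrite ler_pM2l // ltW.
apply: le_trans (card_members_step L0 (expR_ge0 _) Hf Hm) _.
rewrite -expRD ler_expR.
have eK : expR (- L) * #|G|%:R = K `^ (- eta) * N.
  rewrite GE mulrA; congr (_ * _).
  rewrite -[X in _ * X](powRr1 (ltW K_gt0)) /powR gt_eqF // -!expRD; congr expR.
  by rewrite /L; ring.
have Ls : L * (c * K `^ (1 - rho) * N) <= c * (1 + eta) / eta * K `^ (- eta) * N.
  rewrite mulrA ler_pM2r // mulrC.
  have -> : 1 - rho = (- eta) + (- eta) by rewrite /eta /container_rate; field.
  rewrite powRD; last by rewrite (gt_eqF K_gt0) implybT.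
  have lK := ln_le_powR eta_gt0 K1.
  have KK : K `^ (- eta) * K `^ eta = 1 by rewrite powRN mulVf // gt_eqF // powR_gt0.
  have -> : c * (K `^ (- eta) * K `^ (- eta)) * L =
     (c * (1 + eta) * K `^ (- eta)) * (K `^ (- eta) * ln K) by rewrite /L; ring.
  have -> : c * (1 + eta) / eta * K `^ (- eta) =
     (c * (1 + eta) * K `^ (- eta)) * (K `^ (- eta) * (K `^ eta / eta)).
    transitivity (c * (1 + eta) * K `^ (- eta) * (K `^ (- eta) * K `^ eta) / eta); last by ring.
    by rewrite KK; ring.
  rewrite ler_pM2l; last by rewrite !mulr_gt0 ?powR_gt0 // addr_gt0.
  by rewrite ler_pM2l // powR_gt0.
rewrite eK; apply: (@le_trans _ _ (container_cost * K `^ (- eta) * N +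
    N * (container_const - container_gain * ((1 - delta) * K) `^ (- eta)))).
  rewrite lerD2r /container_cost mulrDl mul1r (mulrDl _ _ N) lerD2r.
  exact: Ls.
rewrite (powRM (- eta) (ltW d_gt0) (ltW K_gt0)).
have -> : container_cost = container_gain * ((1 - delta) `^ (- eta) - 1).
  by rewrite /container_gain divfK // gt_eqF.
have := powRN_le K_gt0 Kx; move: container_gain (gain_gt0) container_const => g g0 B.
move: (x `^ _) (K `^ _) ((1 - delta) `^ _) => u1 u2 u3 u12.
have -> : g * (u3 - 1) * u2 * N + N * (B - g * (u3 * u2)) = N * (B - g * u2) by ring.
by rewrite ler_pM2l // lerD2l lerN2 ler_pM2l.
Qed.

Lemma card_members_le : #|members G0|%:R <= expR (container_const * N).
Proof.
have K0_gt0 : 0 < K0 := lt_le_trans ltr01 K01.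
pose x := (1 - delta) * K0 + #|G0|%:R / N.
have GN0 : 0 <= #|G0|%:R / N by rewrite divr_ge0 // ltW.
apply: le_trans (card_members_bound (subxx _) (_ : _ <= x) _) _.
- by rewrite lerDl.
- by rewrite mulrDl divfK ?gt_eqF // lerDr !mulr_ge0 // ltW.
rewrite ler_expR mulrC ler_pM2r // gerBl mulr_ge0 ?powR_ge0 // ltW //.
Qed.

End Iteration.

Theorem card_copy_free (R : realType) (V : finType) (F : {set {set V}}) (alpha gamma C : R) :
    (0 < #|F|)%N -> alpha < 2 -> 2 - alpha < gamma -> gamma < 1 ->
    (forall S : {set {set V}}, S \subset F -> S != set0 ->
       gamma * (#|S|%:R - 1) <= #|cover S|%:R - 2) ->
    1 <= C ->
    (forall n (G : {set {set 'I_n}}), (0 < n)%N -> simple_graph G -> copy_free F G ->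
       #|G|%:R <= C * n%:R `^ alpha) ->
  exists B : R, forall n, (0 < n)%N ->
    #|[set I : {set {set 'I_n}} | simple_graph I & copy_free F I]|%:R <= expR (B * n%:R `^ alpha).
Proof.
move=> F0 alpha2 gamma_gt gamma1 hgamma C1 hC.
have [K0 [c [delta [K01 c0 d01 step]]]] := one_step F0 alpha2 gamma_gt gamma1 hgamma C1 hC.
have rho1 : 1 < gamma / (2 - alpha) by rewrite ltr_pdivlMr ?mul1r // subr_gt0.
exists (container_const K0 c delta (gamma / (2 - alpha))) => n n0.
pose E := [set g : {set 'I_n} | #|g| == 2].
have simE I : simple_graph I = (I \subset E).
  apply/forall_inP/subsetP => [H g /H|H g /H]; by rewrite inE.
have := @card_members_le _ _ _ _ _ K01 c0 d01 rho1 _ (copy_free F) (n%:R `^ alpha) E.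
rewrite /members (eq_finset _ (fun I => congr1 (andb^~ _) (simE I))) => -> //.
  by rewrite powR_gt0 // ltr0n.
by move=> G; rewrite -simE => sG; apply: step.
Qed.

Theorem max_free_upper (R : realType) (V : finType) (F : {set {set V}}) (H : {set V * V})
    (alpha C : R) (N : nat) : simple_graph F -> has_cycle F -> is_orientation F H ->
    (forall n, (N <= n)%N -> (turan_number F n)%:R <= C * n%:R `^ alpha) ->
  exists B : R, forall n, (0 < n)%N -> (max_free_orientations H n)%:R <= expR (B * n%:R `^ alpha).
Proof.
move=> sF cF oH hex.
have [alpha2|alpha2] := leP 2 alpha.
  exists 1 => n n0; apply: (@le_trans _ _ (expR (n ^ 2)%:R)); last first.
    by rewrite ler_expR mul1r natrX -powR_mulrn // ler_powR // ler1n.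
  apply: (@le_trans _ _ (2 ^ (n ^ 2))%:R); first by rewrite ler_nat (max_free_le_sqr n sF).
  rewrite -[X in expR X]mulr1 expRM_natl natrX; apply: lerXn2r; rewrite ?nnegrE ?expR_ge0 //.
  exact: expR_ge1Dx.
pose q n : R := (turan_number F n)%:R / n%:R `^ alpha.
(* The sum absorbs the finitely many sizes below [N]. *)
pose C' := 1 + `|C| + \sum_(i < N) q i.
have q0 n : 0 <= q n by rewrite divr_ge0 ?powR_ge0.
have C'1 : 1 <= C' by rewrite /C' -addrA lerDl addr_ge0 // sumr_ge0.
have hC n (G : {set {set 'I_n}}) : (0 < n)%N -> simple_graph G -> copy_free F G ->
    #|G|%:R <= C' * n%:R `^ alpha.
  move=> n0 sG fG; apply: (@le_trans _ _ (turan_number F n)%:R).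
    by rewrite ler_nat copy_free_le_turan.
  have p0 : (0 : R) < n%:R `^ alpha by rewrite powR_gt0 // ltr0n.
  have [Nn|nN] := leqP N n.
    apply: le_trans (hex n Nn) _; rewrite ler_pM2r // /C'.
    by rewrite (le_trans (ler_norm C)) // addrAC lerDr addr_ge0 // sumr_ge0.
  rewrite -ler_pdivrMr // -/(q n) /C' (bigD1 (Ordinal nN)) //= addrCA lerDl.
  by rewrite !addr_ge0 // sumr_ge0.
have F_gt0 := has_cycle_gt0 cF.
have [gamma [g1 /andP[_ g2] g3]] := subgraph_exponent sF cF hC.
have [B HB] := card_copy_free F_gt0 alpha2 g1 g2 g3 C'1 hC.
exists B => n n0; apply: le_trans (HB n n0); rewrite ler_nat; exact: max_free_le.
Qed.

(* The statement in Theta notation *)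
From mathcomp Require Import all_classical all_reals all_analysis.
Import numFieldNormedType.Exports.
Local Open Scope classical_set_scope.
Local Open Scope ring_scope.

Lemma natThetaP (R : realType) (f g : nat -> R^o) :
  f \is 'Theta_\oo g <->
  exists c C N, [/\ 0 < c, 0 < C & forall n, (N <= n)%N -> c * `|g n| <= `|f n| <= C * `|g n|].
Proof.
rewrite qualifE; split=> [/asboolP[[c C] /andP[/= c0 C0] [N _ H]]|[c [C [N [c0 C0 H]]]]].
  by exists c, C, N; split=> // n /H /= [-> ->].
apply/asboolP; exists (c, C); first by rewrite /= c0.
by exists N => // n /H /andP[].
Qed.

Theorem proposition1p3 (R : realType) (V : finType) (F : {set {set V}})
    (alpha : R) (hF : simple_graph F) (hcycle : has_cycle F)
    (hex : (fun n : nat => (turan_number F n)%:R : R^o)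
             \is 'Theta_\oo (fun n : nat => n%:R `^ alpha : R^o))
    (H : {set V * V}) (hH : is_orientation F H) :
  exists2 e : nat -> R^o,
    e \is 'Theta_\oo (fun n : nat => n%:R `^ alpha : R^o) &
    \forall n \near \oo, (max_free_orientations H n)%:R = 2 `^ (e n) :> R.
Proof.
have [c [C [N [c0 C0 hcC]]]] := (natThetaP _ _).1 hex.
have cC n : (N <= n)%N -> c * n%:R `^ alpha <= (turan_number F n)%:R <= C * n%:R `^ alpha.
  by move=> /hcC; rewrite !ger0_norm ?powR_ge0.
have [|B HB] := max_free_upper (alpha := alpha) (C := C) (N := N) hF hcycle hH.
  by move=> n /cC/andP[].
have F_gt0 := has_cycle_gt0 hcycle.
have l2 : 0 < ln 2 :> R by rewrite ln_gt0 // ltr1n.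
have D0 n : 0 < (max_free_orientations H n)%:R :> R.
  by rewrite ltr0n (max_free_gt0 hF).
exists (fun n => ln (max_free_orientations H n)%:R / ln 2); last first.
  by exists 0%N => // n _; rewrite /powR pnatr_eq0 /= divfK ?gt_eqF // lnK ?posrE.
have lower n : (turan_number F n)%:R <= ln (max_free_orientations H n)%:R / ln 2 :> R.
  rewrite ler_pdivlMr // mulr_natl -lnXn // ler_ln ?posrE ?exprn_gt0 //.
  by rewrite -natrX ler_nat (turan_le_max_free hF).
(* The summand 1 keeps the upper constant positive when B = 0; the upper bound is available only
   from n = 1 on. *)
apply/natThetaP; exists c, (`|B| / ln 2 + 1), (maxn N 1); split=> //.
  by rewrite ltr_wpDl // divr_ge0 // ltW.
move=> n; rewrite geq_max => /andP[Nn n0]; have /andP[h1 h2] := cC n Nn.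
have e0 := le_trans (ler0n _ _) (lower n).
rewrite (ger0_norm e0) (ger0_norm (powR_ge0 _ _)); apply/andP; split.
  exact: le_trans h1 (lower n).
rewrite mulrDl mul1r.
rewrite -[leLHS]addr0 lerD ?powR_ge0 // ler_pdivrMr // mulrAC divfK ?gt_eqF //.
rewrite -ler_expR lnK ?posrE // (le_trans (HB n n0)) // ler_expR ler_wpM2r ?powR_ge0 //.
exact: ler_norm.
Qed.
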